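(* Let $p>3$ be prime and $1\le\ell\le p-1$. Then the function $\eta(p^2z)\,q^{-1/24}\,C(\zeta_p^{\ell},q)$ is a weakly holomorphic modular form of weight $1$ on the group $\Gamma_0(p^2)\cap\Gamma_1(p)$.
   Context: $z$ lies in the upper half-plane, $q=e^{2\pi i z}$, $q^r=e^{2\pi i r z}$, $\zeta_p=e^{2\pi i/p}$, $\eta(z)=q^{1/24}\prod_{n\ge1}(1-q^n)$, and $(a;q)_\infty=\prod_{k\ge0}(1-aq^k)$. The crank generating function is $C(x,q)=\dfrac{(q;q)_\infty}{(xq;q)_\infty(x^{-1}q;q)_\infty}$ (Andrews–Garvan). *)

(* Defs.v *)
From Stdlib Require Import Reals ZArith Znumtheory.
From Coquelicot Require Import Coquelicot.
Open Scope R_scope.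

Definition cexp (z : C) : C :=
  (exp (fst z) * cos (snd z), exp (fst z) * sin (snd z)).

Definition upper (z : C) : Prop := 0 < Im z.

Definition qpow (r : R) (z : C) : C := cexp (RtoC (2 * PI * r) * Ci * z).

Fixpoint partial_prod (u : nat -> C) (N : nat) : C :=
  match N with
  | O => RtoC 1
  | S n => Cmult (partial_prod u n) (u n)
  end.
Definition inf_prod (u : nat -> C) : C :=
  @lim C_CompleteNormedModule (filtermap (partial_prod u) eventually).

Definition qpoch (a q : C) : C :=
  inf_prod (fun k => Cminus (RtoC 1) (Cmult a (pow_n q k))).

Definition crank (x q : C) : C :=
  Cdiv (qpoch q q) (Cmult (qpoch (Cmult x q) q) (qpoch (Cmult (Cinv x) q) q)).

Definition eta (z : C) : C :=
  Cmult (qpow (1/24) z) (inf_prod (fun n => Cminus (RtoC 1) (qpow (INR (S n)) z))).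

Definition zeta (p : Z) : C := cexp (Cmult (RtoC (2 * PI / IZR p)) Ci).

Definition Fcrank (p : Z) (l : nat) (z : C) : C :=
  Cmult (Cmult (eta (Cmult (RtoC (IZR (p ^ 2))) z)) (qpow (-1/24) z))
        (crank (pow_n (zeta p) l) (qpow 1 z)).

Definition holo_on (U : C -> Prop) (f : C -> C) : Prop :=
  forall z, U z -> @ex_derive C_AbsRing C_NormedModule f z.

Definition in_SL2Z (a b c d : Z) : Prop := (a * d - b * c = 1)%Z.

Definition in_Gamma0p2_Gamma1p (p : Z) (a b c d : Z) : Prop :=
  in_SL2Z a b c d /\ (p ^ 2 | c)%Z /\ (p | a - 1)%Z /\ (p | d - 1)%Z.

Definition mobius (a b c d : Z) (z : C) : C :=
  Cdiv (Cplus (Cmult (RtoC (IZR a)) z) (RtoC (IZR b)))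
       (Cplus (Cmult (RtoC (IZR c)) z) (RtoC (IZR d))).

Definition automorphy (c d : Z) (z : C) : C :=
  Cplus (Cmult (RtoC (IZR c)) z) (RtoC (IZR d)).

Definition slash (k : nat) (f : C -> C) (a b c d : Z) (z : C) : C :=
  Cdiv (f (mobius a b c d z)) (pow_n (automorphy c d z) k).

(* meromorphic at the cusp i*oo: for some width h >= 1, g(z) = G(q_h) with
   q_h = e^{2 pi i z / h} and G(w) = w^{-m} H(w), H holomorphic on |w| < 1;
   i.e. the q_h-expansion has only finitely many negative terms. *)
Definition mero_at_infty (g : C -> C) : Prop :=
  exists (h : nat) (m : nat) (H : C -> C),
    (0 < h)%nat /\ holo_on (fun w => Cmod w < 1) H /\
    forall z, upper z ->
      Cmult (g z) (pow_n (qpow (1 / INR h) z) m) = H (qpow (1 / INR h) z).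

Definition weakly_hol_modular_form (k : nat) (Gam : Z -> Z -> Z -> Z -> Prop)
  (f : C -> C) : Prop :=
  holo_on upper f /\
  (forall a b c d, Gam a b c d -> forall z, upper z ->
      f (mobius a b c d z) = Cmult (pow_n (automorphy c d z) k) (f z)) /\
  (forall a b c d, in_SL2Z a b c d -> mero_at_infty (slash k f a b c d)).

(* Main.v *)
Require Import Defs.
From Stdlib Require Import Reals ZArith Znumtheory Lra Lia List ClassicalEpsilon
  FunctionalExtensionality.
From Coquelicot Require Import Coquelicot.
Local Open Scope C_scope.

(** Write [q = ee z], [x = ee u] and let [klein u z] be the Klein form
    [(x^(1/2) - x^(-1/2)) prod (1 - q^n x) (1 - q^n / x) / (1 - q^n)^2].
    The crank function is a constant times [eta(p^2 z) / (eta(z) klein (l/p) z)].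
    The product of [klein] over the [p]-torsion points of the real axis is
    [eta(pz) / eta(z)^p], so [eta(p^2 z) / eta(z)] is a product of values of [klein] at [z]
    and [pz] times a power of the discriminant, as [24] divides [p^2 - 1]; and the
    discriminant is a power of the product of [klein] over the half periods.
    So everything follows from
    [klein (u/(cz+d)) (gz) = (cz+d)^-1 ee (c u^2 / (2 (cz+d))) klein u z].

    By quasi-periodicity the ratio of the two sides, for [z -> -1/z], is an elliptic
    function of [u] without zeros or poles.  Its third logarithmic derivative [f] satisfies
    [8 f(u) = sum f((u + w)/2)] over the four classes [w] of periods modulo twice the
    periods; being bounded, it vanishes. *)

(** * Complex sequences *)

Lemma RtoC_neq_0 (r : R) : r <> 0%R -> RtoC r <> 0.
Proof. intros r_neq E. now apply r_neq, RtoC_inj. Qed.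

Lemma INR_C_neq_0 (n : nat) : n <> 0%nat -> RtoC (INR n) <> 0.
Proof. intros n_neq. now apply RtoC_neq_0, not_0_INR. Qed.

Lemma IZR_C_neq_0 (n : Z) : n <> 0%Z -> RtoC (IZR n) <> 0.
Proof. intros n_neq. now apply RtoC_neq_0, not_0_IZR. Qed.

Lemma Cmult_eq_reg_r (a b c : C) : c <> 0 -> a * c = b * c -> a = b.
Proof. intros c_neq E. replace a with (a * c / c) by now field. rewrite E. now field. Qed.

Lemma Cinv_neq_0 (a : C) : a <> 0 -> / a <> 0.
Proof. intros a_neq E. apply C1_nz. rewrite <- (Cinv_r a), E by easy. ring. Qed.

Lemma Cminus_neq_0_sym (a b : C) : a - b <> 0 -> b - a <> 0.
Proof. intros ab_neq E. apply ab_neq. rewrite <- Copp_minus_distr, E. ring. Qed.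

Lemma Cminus_0_r (a : C) : a - 0 = a.
Proof. ring. Qed.

Lemma Cinv_0 : / 0 = 0.
Proof. unfold Cinv, RtoC; simpl. f_equal; unfold Rdiv; ring. Qed.

Lemma Cinv_opp (a : C) : / - a = - / a.
Proof.
  destruct (Ceq_dec a 0) as [->|a_neq]; [|now field]. rewrite Copp_0, Cinv_0. ring.
Qed.

#[local] Create HintDb Cneq.
#[local] Hint Resolve Cmult_neq_0 Cinv_neq_0 Cpow_nz : Cneq.
#[local] Hint Extern 2 (RtoC _ <> _) => apply RtoC_neq_0; lra : Cneq.

Local Ltac Cfield := field; repeat split; auto 10 with Cneq nocore.

#[local] Create HintDb Ccast.
#[local] Hint Rewrite <- INR_IZR_INZ : Ccast.
#[local] Hint Rewrite plus_IZR minus_IZR mult_IZR opp_IZR plus_INR mult_INR S_INR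
  RtoC_plus RtoC_minus RtoC_mult RtoC_opp : Ccast.

Local Ltac Ccast := autorewrite with Ccast.

Lemma Cmod_minus_sym (a b : C) : Cmod (a - b) = Cmod (b - a).
Proof. now rewrite <- Cmod_opp, Copp_minus_distr. Qed.

Lemma Cmod_minus_diag (a : C) : Cmod (a - a) = 0%R.
Proof. rewrite <- Cmod_0. f_equal. ring. Qed.

Lemma Cmod_minus_le (a b : C) : Cmod (a - b) <= Cmod a + Cmod b.
Proof. unfold Cminus. rewrite <- (Cmod_opp b). apply Cmod_triangle. Qed.

Lemma Cmod_triangle_rev (a b : C) : Cmod a - Cmod b <= Cmod (a - b).
Proof.
  pose proof (Cmod_triangle (a - b) b) as triangle.
  replace (a - b + b) with a in triangle by ring. lra.
Qed.

Lemma im_le_Cmod (c : C) : Rabs (Im c) <= Cmod c.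
Proof. eapply Rle_trans; [apply Rmax_r|apply Rmax_Cmod]. Qed.

Lemma pow_le_1 (x : R) (n : nat) : 0 <= x <= 1 -> 0 <= x ^ n <= 1.
Proof. split; [now apply pow_le|]. rewrite <- (pow1 n). now apply pow_incr. Qed.

Lemma exp_le (x y : R) : x <= y -> exp x <= exp y.
Proof. intros [lt|eq]; [left; now apply exp_increasing|rewrite eq; lra]. Qed.

Lemma is_lim_seq_0_lt (u : nat -> R) (eps : R) : is_lim_seq u 0 -> 0 < eps ->
  exists N, forall n, (N <= n)%nat -> u n < eps.
Proof.
  intros u_lim eps_pos. apply is_lim_seq_spec in u_lim.
  destruct (u_lim (mkposreal eps eps_pos)) as [N small]. exists N. intros n le_N.
  specialize (small n le_N). simpl in small. rewrite Rminus_0_r in small.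
  eapply Rle_lt_trans; [apply Rle_abs|exact small].
Qed.

Lemma geom_eventually_lt (A r eps : R) : 0 <= r < 1 -> 0 < eps ->
  exists N, forall n, (N <= n)%nat -> A * r ^ n < eps.
Proof.
  intros r_bound. apply is_lim_seq_0_lt.
  replace (Finite 0) with (Rbar_mult A 0) by (simpl; f_equal; ring).
  apply is_lim_seq_scal_l, is_lim_seq_geom. rewrite Rabs_pos_eq; lra.
Qed.

(* Coquelicot proves the continuity of multiplication for the norm topology, whereas the
   default uniform structure of [C] is that of [R * R]. *)
Definition is_Clim_seq (s : nat -> C) (l : C) : Prop :=
  filterlim s eventually (@locally (AbsRing_UniformSpace C_AbsRing) l).

Lemma is_Clim_seq_eps (s : nat -> C) (l : C) : is_Clim_seq s l <->
  forall eps : R, 0 < eps -> exists N, forall n, (N <= n)%nat -> Cmod (s n - l) < eps.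
Proof.
  split.
  - intros s_lim eps eps_pos. apply (s_lim (fun y => Cmod (y - l) < eps)%R).
    now exists (mkposreal eps eps_pos).
  - intros s_lim P [eps ball_P]. destruct (s_lim eps (cond_pos eps)) as [N close].
    exists N. intros n le_N. now apply ball_P, close.
Qed.

Lemma is_Clim_seq_locally (s : nat -> C) (l : C) :
  is_Clim_seq s l <-> filterlim s eventually (@locally C_UniformSpace l).
Proof.
  unfold is_Clim_seq, filterlim, filter_le, filtermap.
  split; intros s_lim P nbhd; apply s_lim, locally_C, nbhd.
Qed.

Lemma is_Clim_seq_unique (s : nat -> C) (a b : C) :
  is_Clim_seq s a -> is_Clim_seq s b -> a = b.
Proof. exact (filterlim_locally_unique (V := AbsRing_NormedModule C_AbsRing) s a b). Qed.

Lemma is_Clim_seq_ext (s t : nat -> C) (l : C) :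
  (forall n, s n = t n) -> is_Clim_seq s l -> is_Clim_seq t l.
Proof. apply filterlim_ext. Qed.

Lemma is_Clim_seq_eq (s : nat -> C) (a b : C) : a = b -> is_Clim_seq s a -> is_Clim_seq s b.
Proof. now intros <-. Qed.

Lemma is_Clim_seq_squeeze (s : nat -> C) (l : C) (a : nat -> R) :
  (forall n, Cmod (s n - l) <= a n) -> is_lim_seq a 0 -> is_Clim_seq s l.
Proof.
  intros le_a a_lim. apply is_Clim_seq_eps. intros eps eps_pos.
  destruct (is_lim_seq_0_lt a eps a_lim eps_pos) as [N small].
  exists N. intros n le_N. eapply Rle_lt_trans; [apply le_a|now apply small].
Qed.

Lemma is_Clim_seq_const (c : C) : is_Clim_seq (fun _ => c) c.
Proof. exact (@filterlim_const nat (AbsRing_UniformSpace C_AbsRing) eventually _ c). Qed.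

Lemma is_Clim_seq_plus (s t : nat -> C) (a b : C) :
  is_Clim_seq s a -> is_Clim_seq t b -> is_Clim_seq (fun n => s n + t n) (a + b).
Proof.
  intros s_lim t_lim. exact (filterlim_comp_2 s t Cplus s_lim t_lim
    (filterlim_plus (V := AbsRing_NormedModule C_AbsRing) a b)).
Qed.

Lemma is_Clim_seq_mult (s t : nat -> C) (a b : C) :
  is_Clim_seq s a -> is_Clim_seq t b -> is_Clim_seq (fun n => s n * t n) (a * b).
Proof.
  intros s_lim t_lim. exact (filterlim_comp_2 s t Cmult s_lim t_lim
    (filterlim_mult (K := C_AbsRing) a b)).
Qed.

Lemma is_Clim_seq_opp (s : nat -> C) (a : C) :
  is_Clim_seq s a -> is_Clim_seq (fun n => - s n) (- a).
Proof.
  intros s_lim. exact (filterlim_comp _ _ _ s Copp _ _ _ s_lim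
    (filterlim_opp (V := AbsRing_NormedModule C_AbsRing) a)).
Qed.

Lemma is_Clim_seq_minus (s t : nat -> C) (a b : C) :
  is_Clim_seq s a -> is_Clim_seq t b -> is_Clim_seq (fun n => s n - t n) (a - b).
Proof. intros s_lim t_lim. apply is_Clim_seq_plus; [easy|now apply is_Clim_seq_opp]. Qed.

Lemma is_Clim_seq_scal (c : C) (s : nat -> C) (a : C) :
  is_Clim_seq s a -> is_Clim_seq (fun n => c * s n) (c * a).
Proof. apply is_Clim_seq_mult, is_Clim_seq_const. Qed.

Lemma is_Clim_seq_pow (s : nat -> C) (a : C) (k : nat) :
  is_Clim_seq s a -> is_Clim_seq (fun n => s n ^ k) (a ^ k).
Proof.
  intros s_lim. induction k as [|k IH]; [apply is_Clim_seq_const|].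
  now apply is_Clim_seq_mult.
Qed.

Lemma is_Clim_seq_div_const (c : C) (s : nat -> C) (a : C) :
  is_Clim_seq s a -> is_Clim_seq (fun n => s n / c) (a / c).
Proof. intros s_lim. exact (is_Clim_seq_mult _ _ _ _ s_lim (is_Clim_seq_const (/ c))). Qed.

Lemma is_Clim_seq_mult_bounded (s t : nat -> C) (M : R) : is_Clim_seq s 0 ->
  (exists N, forall n, (N <= n)%nat -> Cmod (t n) <= M) -> is_Clim_seq (fun n => s n * t n) 0.
Proof.
  rewrite !is_Clim_seq_eps. intros s_lim [N t_le] eps eps_pos.
  assert (M_pos : 0 < Rabs M + 1) by (pose proof (Rabs_pos M); lra).
  destruct (s_lim (eps / (Rabs M + 1))%R) as [N' s_small]; [now apply Rdiv_lt_0_compat|].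
  exists (N + N')%nat. intros n le_n. specialize (s_small n ltac:(lia)).
  specialize (t_le n ltac:(lia)). rewrite Cminus_0_r in *. rewrite Cmod_mult.
  apply Rlt_div_r in s_small; [|easy]. pose proof (Rle_abs M).
  eapply Rle_lt_trans; [|exact s_small]. apply Rmult_le_compat_l; [apply Cmod_ge_0|lra].
Qed.

Lemma is_Clim_seq_subseq (s : nat -> C) (l : C) (k : nat -> nat) :
  (forall n, (n <= k n)%nat) -> is_Clim_seq s l -> is_Clim_seq (fun n => s (k n)) l.
Proof.
  rewrite !is_Clim_seq_eps. intros k_ge s_lim eps eps_pos.
  destruct (s_lim eps eps_pos) as [N close]. exists N. intros n le_N.
  apply close. specialize (k_ge n). lia.
Qed.

Lemma is_Clim_seq_incr_n (s : nat -> C) (l : C) (k : nat) :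
  is_Clim_seq (fun n => s (k + n)%nat) l -> is_Clim_seq s l.
Proof.
  rewrite !is_Clim_seq_eps. intros s_lim eps eps_pos.
  destruct (s_lim eps eps_pos) as [N close]. exists (k + N)%nat.
  intros n le_N. replace n with (k + (n - k))%nat by lia. apply close. lia.
Qed.

Lemma is_Clim_seq_Cmod_le (s : nat -> C) (l : C) (B : R) (N : nat) : is_Clim_seq s l ->
  (forall n, (N <= n)%nat -> Cmod (s n) <= B) -> Cmod l <= B.
Proof.
  rewrite is_Clim_seq_eps. intros s_lim s_le. apply Rnot_lt_le. intros l_gt.
  destruct (s_lim (Cmod l - B)%R ltac:(lra)) as [M close].
  specialize (close (N + M)%nat ltac:(lia)). specialize (s_le (N + M)%nat ltac:(lia)).
  rewrite Cmod_minus_sym in close.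
  pose proof (Cmod_triangle_rev l (s (N + M)%nat)). lra.
Qed.

Lemma is_Clim_seq_Cauchy (s : nat -> C) :
  (forall eps : R, 0 < eps ->
   exists N, forall n m, (N <= n)%nat -> (N <= m)%nat -> Cmod (s n - s m) < eps) ->
  exists l, is_Clim_seq s l.
Proof.
  intros s_Cauchy. destruct (proj1 (filterlim_locally_cauchy (U := C_CompleteNormedModule)
    (F := eventually) s)) as [l s_lim].
  - intros eps. destruct (s_Cauchy eps (cond_pos eps)) as [N close].
    exists (fun n => (N <= n)%nat). split; [now exists N|]. intros n m le_n le_m.
    apply (norm_compat1 (V := C_NormedModule)). now apply close.
  - exists l. now apply is_Clim_seq_locally.
Qed.

Definition Clim_seq (s : nat -> C) : C :=
  @lim C_CompleteNormedModule (filtermap s eventually).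

Lemma Clim_seq_eq (s : nat -> C) (l : C) : is_Clim_seq s l -> Clim_seq s = l.
Proof.
  intros s_lim. apply (is_Clim_seq_unique s); [|exact s_lim].
  apply is_Clim_seq_locally in s_lim. apply is_Clim_seq_locally.
  intros P [eps ball_P].
  apply (filter_imp (F := eventually) (fun n => ball (Clim_seq s) eps (s n))).
  { intros n. apply ball_P. }
  apply (complete_cauchy (T := C_CompleteNormedModule) (filtermap s eventually)).
  - apply filtermap_proper_filter, eventually_filter.
  - intros e. exists l. apply s_lim. now exists e.
Qed.

(** * Sequences with summable increments *)

Section SummableIncrements.

Variable a : nat -> R.
Hypothesis a_summable : ex_series a.

Lemma Series_tail_lim_0 : is_lim_seq (fun n => Series (fun k => a (n + k)%nat)) 0.
Proof.
  apply is_lim_seq_incr_1.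
  apply is_lim_seq_ext with (fun n => (Series a - sum_n a n)%R).
  { intros n. rewrite (Series_incr_n a (S n)) by (lia || easy). rewrite sum_n_Reals. simpl. ring. }
  replace (Finite 0) with (Finite (Series a - Series a)) by (f_equal; ring).
  apply is_lim_seq_minus'; [apply is_lim_seq_const|].
  now apply Series_correct in a_summable.
Qed.

Lemma sum_increments_le_tail (s : nat -> C) (N : nat) :
  (forall n, (N <= n)%nat -> Cmod (s (S n) - s n) <= a n) ->
  forall n k, (N <= n)%nat -> Cmod (s (n + k)%nat - s n) <= Series (fun j => a (n + j)%nat).
Proof.
  intros increment_le n k. revert n. induction k as [|k IH]; intros n le_N.
  - rewrite Nat.add_0_r, Cmod_minus_diag, <- (Rmult_0_l (Series (fun j => a (n + j)%nat))).
    rewrite <- Series_scal_l. apply Series_le; [|now apply ex_series_incr_n].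
    intros j. rewrite Rmult_0_l. split; [lra|].
    eapply Rle_trans; [apply Cmod_ge_0|apply increment_le; lia].
  - rewrite (Series_incr_1 (fun j => a (n + j)%nat)) by now apply ex_series_incr_n.
    replace (s (n + S k)%nat - s n) with ((s (S n) - s n) + (s (S n + k)%nat - s (S n)))
      by (rewrite Nat.add_succ_r; simpl; ring).
    eapply Rle_trans; [apply Cmod_triangle|]. apply Rplus_le_compat.
    + rewrite Nat.add_0_r. now apply increment_le.
    + erewrite Series_ext; [apply IH; lia|]. intros j. simpl. now rewrite Nat.add_succ_r.
Qed.

Lemma summable_increments_unif_Cauchy (N : nat) (eps : R) : 0 < eps ->
  exists M, forall s : nat -> C,
  (forall n, (N <= n)%nat -> Cmod (s (S n) - s n) <= a n) ->
  forall n m, (M <= n)%nat -> (M <= m)%nat -> Cmod (s n - s m) < eps.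
Proof.
  intros eps_pos.
  destruct (is_lim_seq_0_lt _ (eps / 2) Series_tail_lim_0 ltac:(lra)) as [M tail_lt].
  exists (N + M)%nat. intros s increment_le n m le_n le_m.
  assert (near_start : forall k, (N + M <= k)%nat -> Cmod (s k - s (N + M)%nat) < eps / 2).
  { intros k le_k. replace k with (N + M + (k - (N + M)))%nat by lia.
    eapply Rle_lt_trans; [apply (sum_increments_le_tail s N)|apply tail_lt]; auto; lia. }
  replace (s n - s m) with ((s n - s (N + M)%nat) - (s m - s (N + M)%nat)) by ring.
  eapply Rle_lt_trans; [apply Cmod_minus_le|].
  pose proof (near_start n le_n). pose proof (near_start m le_m). lra.
Qed.

Lemma summable_increments_lim (s : nat -> C) (N : nat) :
  (forall n, (N <= n)%nat -> Cmod (s (S n) - s n) <= a n) -> exists l, is_Clim_seq s l.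
Proof.
  intros increment_le. apply is_Clim_seq_Cauchy. intros eps eps_pos.
  destruct (summable_increments_unif_Cauchy N eps eps_pos) as [M close].
  exists M. now apply close.
Qed.

End SummableIncrements.

Lemma ex_series_geom_scal (A r : R) : 0 <= r < 1 -> ex_series (fun n => (A * r ^ n)%R).
Proof.
  intros r_bound. apply (ex_series_scal_l (V := R_NormedModule)), ex_series_geom.
  rewrite Rabs_pos_eq; lra.
Qed.

(** * Complex derivatives *)

Definition is_Cderive (f : C -> C) (z l : C) : Prop :=
  @is_derive C_AbsRing C_NormedModule f z l.

Lemma is_Cderive_norm (f : C -> C) (z l : C) : is_Cderive f z l <->
  @is_derive C_AbsRing (AbsRing_NormedModule C_AbsRing) f z l.
Proof. split; intros [_ domin]; split; try apply is_linear_scal_l; exact domin. Qed.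

Lemma is_Cderive_eps (f : C -> C) (z l : C) : is_Cderive f z l <->
  forall eps : R, 0 < eps -> exists d : R, 0 < d /\
  forall h, Cmod h < d -> Cmod (f (z + h)%C - f z - l * h)%C <= eps * Cmod h.
Proof.
  split.
  - intros [_ domin] eps eps_pos.
    destruct (domin z (fun P nbhd => nbhd) (mkposreal eps eps_pos)) as [[d d_pos] bound].
    exists d. split; [easy|]. intros h h_lt. specialize (bound (z + h)).
    assert (shift : z + h - z = h) by ring.
    change (Cmod (z + h - z) < d ->
      Cmod (f (z + h)%C - f z - (z + h - z) * l)%C <= eps * Cmod (z + h - z))%R in bound.
    rewrite shift, (Cmult_comm h) in bound. now apply bound.
  - intros bound. split; [apply is_linear_scal_l|]. intros x x_lim.
    apply (@is_filter_lim_locally_unique _ (AbsRing_NormedModule C_AbsRing)) in x_lim. subst x.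
    intros eps. destruct (bound eps (cond_pos eps)) as [d [d_pos bound_d]].
    exists (mkposreal d d_pos). intros y y_near.
    change (Cmod (f y - f z - (y - z) * l) <= eps * Cmod (y - z)).
    replace y with (z + (y - z)) at 1 by ring. rewrite (Cmult_comm _ l). exact (bound_d _ y_near).
Qed.

Lemma is_Cderive_ext (f g : C -> C) (z l : C) :
  (forall y, f y = g y) -> is_Cderive f z l -> is_Cderive g z l.
Proof. exact (is_derive_ext (V := C_NormedModule) f g z l). Qed.

Lemma is_Cderive_eq (f : C -> C) (z a b : C) : a = b -> is_Cderive f z a -> is_Cderive f z b.
Proof. now intros <-. Qed.

Lemma is_Cderive_ext_loc (f g : C -> C) (z l : C) (r : R) : 0 < r ->
  (forall y, Cmod (y - z) < r -> f y = g y) -> is_Cderive f z l -> is_Cderive g z l.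
Proof.
  intros r_pos E. apply (is_derive_ext_loc (V := C_NormedModule)). now exists (mkposreal r r_pos).
Qed.

Lemma is_Cderive_const (c z : C) : is_Cderive (fun _ => c) z 0.
Proof. exact (is_derive_const (V := C_NormedModule) c z). Qed.

Lemma is_Cderive_id (z : C) : is_Cderive (fun y => y) z 1.
Proof. apply is_Cderive_norm. exact (is_derive_id (K := C_AbsRing) z). Qed.

Lemma is_Cderive_plus (f g : C -> C) (z a b : C) :
  is_Cderive f z a -> is_Cderive g z b -> is_Cderive (fun y => f y + g y) z (a + b).
Proof. exact (is_derive_plus (V := C_NormedModule) f g z a b). Qed.

Lemma is_Cderive_minus (f g : C -> C) (z a b : C) :
  is_Cderive f z a -> is_Cderive g z b -> is_Cderive (fun y => f y - g y) z (a - b).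
Proof. exact (is_derive_minus (V := C_NormedModule) f g z a b). Qed.

Lemma is_Cderive_opp (f : C -> C) (z a : C) :
  is_Cderive f z a -> is_Cderive (fun y => - f y) z (- a).
Proof. exact (is_derive_opp (V := C_NormedModule) f z a). Qed.

Lemma is_Cderive_mult (f g : C -> C) (z a b : C) :
  is_Cderive f z a -> is_Cderive g z b -> is_Cderive (fun y => f y * g y) z (a * g z + f z * b).
Proof.
  rewrite !is_Cderive_norm. intros Df Dg.
  exact (is_derive_mult (K := C_AbsRing) f g z a b Df Dg Cmult_comm).
Qed.

Lemma is_Cderive_comp (f g : C -> C) (z a b : C) :
  is_Cderive g z b -> is_Cderive f (g z) a -> is_Cderive (fun y => f (g y)) z (a * b).
Proof.
  intros Dg Df. rewrite Cmult_comm. apply is_Cderive_norm in Dg.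
  exact (is_derive_comp (V := C_NormedModule) f g z a b Df Dg).
Qed.

Lemma is_Cderive_continuous (f : C -> C) (z l : C) : is_Cderive f z l ->
  filterlim f (@locally (AbsRing_UniformSpace C_AbsRing) z)
    (@locally (AbsRing_UniformSpace C_AbsRing) (f z)).
Proof.
  rewrite is_Cderive_norm. intros Df.
  apply (ex_derive_continuous (V := AbsRing_NormedModule C_AbsRing) f z). now exists l.
Qed.

Lemma is_Cderive_continuous_eps (f : C -> C) (z l : C) : is_Cderive f z l ->
  forall eps : R, 0 < eps -> exists d : R, 0 < d /\
  forall y, Cmod (y - z) < d -> Cmod (f y - f z) < eps.
Proof.
  intros Df eps eps_pos.
  destruct (is_Cderive_continuous f z l Df (fun y => Cmod (y - f z) < eps)%R) as [[d d_pos] close].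
  { now exists (mkposreal eps eps_pos). }
  now exists d.
Qed.

Lemma is_Cderive_lim_seq (f : C -> C) (z l : C) (s : nat -> C) :
  is_Cderive f z l -> is_Clim_seq s z -> is_Clim_seq (fun n => f (s n)) (f z).
Proof. intros Df s_lim.
exact (filterlim_comp _ _ _ _ _ _ _ _ s_lim (is_Cderive_continuous f z l Df)). Qed.

Lemma is_Cderive_unique (f : C -> C) (z a b : C) : is_Cderive f z a -> is_Cderive f z b -> a = b.
Proof.
  intros Da Db. rewrite <- (is_C_derive_unique f z a Da). now apply is_C_derive_unique.
Qed.

Lemma is_Cderive_quotient_lim (f : C -> C) (z l : C) (w : nat -> C) :
  is_Cderive f z l -> is_Clim_seq w 0 -> (forall n, w n <> 0) ->
  is_Clim_seq (fun n => (f (z + w n) - f z) / w n) l.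
Proof.
  rewrite is_Cderive_eps, !is_Clim_seq_eps. intros Df w_lim w_neq eps eps_pos.
  destruct (Df (eps / 2)%R ltac:(lra)) as [d [d_pos approx]].
  destruct (w_lim d d_pos) as [N w_small]. exists N. intros n le_N.
  specialize (w_small n le_N). rewrite Cminus_0_r in w_small.
  pose proof (proj1 (Cmod_gt_0 _) (w_neq n)) as w_pos.
  replace ((f (z + w n) - f z) / w n - l) with ((f (z + w n) - f z - l * w n) / w n)
    by (field; apply w_neq).
  rewrite Cmod_div by apply w_neq. apply Rlt_div_l; [easy|].
  pose proof (approx (w n) w_small). nra.
Qed.

Lemma is_Cderive_Cinv (z : C) : z <> 0 -> is_Cderive Cinv z (- / (z * z)).
Proof.
  intros z_neq. apply is_Cderive_eps. intros eps eps_pos.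
  pose proof (proj1 (Cmod_gt_0 z) z_neq) as m_pos. set (m := Cmod z) in *.
  exists (Rmin (m / 2) (eps * (m * m * m / 2))). split.
  { apply Rmin_pos; [lra|]. repeat apply Rmult_lt_0_compat; lra. }
  intros h h_lt. apply Rmin_Rgt_l in h_lt as [h_lt_m h_lt_eps].
  assert (zh_gt : m / 2 < Cmod (z + h)).
  { pose proof (Cmod_triangle_rev z (- h)) as triangle. rewrite Cmod_opp in triangle.
    replace (z - - h) with (z + h) in triangle by ring. fold m in triangle. lra. }
  assert (zh_neq : z + h <> 0) by (apply Cmod_gt_0; lra).
  replace (/ (z + h) - / z - - / (z * z) * h) with (h * h / (z * z * (z + h))) by Cfield.
  rewrite Cmod_div, !Cmod_mult by auto with Cneq. fold m.
  pose proof (Cmod_ge_0 h) as h_ge. assert (mm_pos : 0 < m * m) by nra.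
  apply Rle_trans with (Cmod h * Cmod h / (m * m * (m / 2)))%R.
  - apply Rmult_le_compat_l; [nra|]. apply Rinv_le_contravar; [nra|].
    apply Rmult_le_compat_l; lra.
  - apply Rmult_le_reg_r with (m * m * (m / 2))%R; [nra|].
    unfold Rdiv at 1. rewrite Rmult_assoc, Rinv_l by nra. nra.
Qed.

Lemma is_Cderive_inv (f : C -> C) (z a : C) : f z <> 0 -> is_Cderive f z a ->
  is_Cderive (fun y => / f y) z (- a / (f z * f z)).
Proof.
  intros f_neq Df. apply is_Cderive_eq with (- / (f z * f z) * a); [now field|].
  apply (is_Cderive_comp Cinv f); [easy|]. now apply is_Cderive_Cinv.
Qed.

Lemma is_Cderive_div (f g : C -> C) (z a b : C) :
  g z <> 0 -> is_Cderive f z a -> is_Cderive g z b ->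
  is_Cderive (fun y => f y / g y) z ((a * g z - f z * b) / (g z * g z)).
Proof.
  intros g_neq Df Dg. apply is_Cderive_eq with (a * / g z + f z * (- b / (g z * g z))).
  { now field. }
  apply (is_Cderive_mult f (fun y => / g y)); [easy|]. now apply is_Cderive_inv.
Qed.

Lemma is_Cderive_scal (c : C) (f : C -> C) (z a : C) :
  is_Cderive f z a -> is_Cderive (fun y => c * f y) z (c * a).
Proof.
  intros Df. apply is_Cderive_eq with (0 * f z + c * a); [ring|].
  apply (is_Cderive_mult (fun _ => c) f); [apply is_Cderive_const|easy].
Qed.

Lemma is_Cderive_div_const (c : C) (f : C -> C) (z a : C) :
  is_Cderive f z a -> is_Cderive (fun y => f y / c) z (a / c).
Proof.
  intros Df. apply is_Cderive_eq with (a * / c + f z * 0); [unfold Cdiv; ring|].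
  apply (is_Cderive_mult f (fun _ => / c)); [easy|apply is_Cderive_const].
Qed.

Lemma is_Cderive_pow (f : C -> C) (z a : C) (n : nat) : is_Cderive f z a ->
  is_Cderive (fun y => f y ^ n) z (INR n * f z ^ (n - 1) * a).
Proof.
  intros Df. induction n as [|n IH].
  - apply is_Cderive_eq with (RtoC 0); [simpl; ring|]. exact (is_Cderive_const 1 z).
  - apply is_Cderive_ext with (fun y => f y * f y ^ n); [intros; now rewrite Cpow_S|].
    eapply is_Cderive_eq; [|apply is_Cderive_mult; [exact Df|exact IH]]. cbv beta.
    rewrite S_INR, RtoC_plus. destruct n as [|n]; [simpl; ring|].
    replace (S (S n) - 1)%nat with (S n) by lia. replace (S n - 1)%nat with n by lia.
    rewrite Cpow_S. ring.
Qed.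

Lemma is_Cderive_affine (a b z : C) : is_Cderive (fun y => a + y * b) z b.
Proof.
  apply is_Cderive_eq with (0 + (1 * b + z * 0)); [ring|].
  apply is_Cderive_plus; [apply is_Cderive_const|].
  apply (is_Cderive_mult (fun y => y)); [apply is_Cderive_id|apply is_Cderive_const].
Qed.

(** * The mean value inequality *)

Lemma is_Cderive_Re (f : C -> C) (t : R) (l : C) :
  is_Cderive f t l -> derivable_pt_lim (fun s : R => Re (f s)) t (Re l).
Proof.
  rewrite is_Cderive_eps. intros Df eps eps_pos. cbv beta.
  destruct (Df (eps / 2)%R ltac:(lra)) as [d [d_pos bound]].
  exists (mkposreal d d_pos). intros h h_neq h_lt. simpl in h_lt.
  specialize (bound h). rewrite Cmod_R in bound. specialize (bound h_lt).
  pose proof (Rabs_pos_lt h h_neq) as h_pos.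
  replace ((Re (f (t + h)%R) - Re (f t)) / h - Re l)%R
    with (Re (f (t + h) - f t - l * h)%C / h)%R.
  2:{ unfold Cminus. rewrite RtoC_plus, !re_plus, !re_opp, re_scal_r. now field. }
  unfold Rdiv. rewrite Rabs_mult, Rabs_inv.
  apply Rmult_lt_reg_r with (Rabs h); [easy|].
  rewrite Rmult_assoc, Rinv_l, Rmult_1_r by lra.
  eapply Rle_lt_trans; [apply re_le_Cmod|]. nra.
Qed.

Lemma Cmod_increment_le (f f' : C -> C) (a b : C) (M : R) :
  (forall t : R, 0 <= t <= 1 -> is_Cderive f (a + t * (b - a)) (f' (a + t * (b - a)))) ->
  (forall t : R, 0 <= t <= 1 -> Cmod (f' (a + t * (b - a))%C) <= M) ->
  Cmod (f b - f a) <= M * Cmod (b - a).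
Proof.
  intros Df f'_le. set (w := Cconj (f b - f a)).
  destruct (MVT_cor2 (fun t : R => Re (w * f (a + t * (b - a))))
    (fun t : R => Re (w * (f' (a + t * (b - a)) * (b - a)))) 0 1) as [t [mean t_bound]]; [lra| |].
  { intros t t_bound. apply (is_Cderive_Re (fun s => w * f (a + s * (b - a)))).
    apply is_Cderive_scal, (is_Cderive_comp f (fun s => a + s * (b - a))); [|now apply Df].
    apply is_Cderive_affine. }
  replace (a + 1%R * (b - a)) with b in mean by ring.
  replace (a + 0%R * (b - a)) with a in mean by ring.
  assert (increment : (Re (w * f b) - Re (w * f a) = Cmod (f b - f a) * Cmod (f b - f a))%R).
  { transitivity (Re (w * (f b - f a))).
    { replace (w * (f b - f a)) with (w * f b - w * f a) by ring.
      unfold Cminus. now rewrite re_plus, re_opp. }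
    unfold w. rewrite Cmult_comm, <- Cmod2_conj. simpl. ring. }
  assert (slope : Re (w * (f' (a + t * (b - a))%C * (b - a)))
    <= Cmod (f b - f a) * (M * Cmod (b - a))).
  { eapply Rle_trans; [apply Rle_abs|]. eapply Rle_trans; [apply re_le_Cmod|].
    rewrite !Cmod_mult. unfold w. rewrite Cmod_conj.
    apply Rmult_le_compat_l; [apply Cmod_ge_0|].
    apply Rmult_le_compat_r; [apply Cmod_ge_0|]. apply f'_le; lra. }
  destruct (Cmod_ge_0 (f b - f a)) as [pos|zero].
  - apply Rmult_le_reg_l with (Cmod (f b - f a)); [easy|]. lra.
  - rewrite <- zero. apply Rmult_le_pos; [|apply Cmod_ge_0].
    eapply Rle_trans; [apply Cmod_ge_0|apply (f'_le 0%R); lra].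
Qed.

Lemma is_Cderive_0_constant (U : C -> Prop) (f : C -> C) :
  (forall a b (t : R), U a -> U b -> 0 <= t <= 1 -> U (a + t * (b - a))) ->
  (forall y, U y -> is_Cderive f y 0) -> forall a b, U a -> U b -> f a = f b.
Proof.
  intros U_convex Df a b Ua Ub. symmetry. apply Ceq_minus, Cmod_eq_0.
  apply Rle_antisym; [|apply Cmod_ge_0]. rewrite <- (Rmult_0_l (Cmod (b - a))).
  apply (Cmod_increment_le f (fun _ => 0)).
  - intros t t_bound. now apply Df, U_convex.
  - intros t _. rewrite Cmod_0. lra.
Qed.

Lemma ball_segment (z y : C) (t r : R) :
  0 <= t <= 1 -> Cmod (y - z) < r -> Cmod (z + t * (y - z) - z) < r.
Proof.
  intros t_bound y_near. replace (z + t * (y - z) - z) with (t * (y - z)) by ring.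
  rewrite Cmod_mult, Cmod_R, Rabs_pos_eq by lra. pose proof (Cmod_ge_0 (y - z)). nra.
Qed.

Section DerivativeOfLimit.

Variables (F F' : nat -> C -> C) (L : C -> C) (z l : C) (rho : R).
Hypothesis rho_pos : 0 < rho.
Hypothesis F_derive : forall n y, Cmod (y - z) < rho -> is_Cderive (F n) y (F' n y).
Hypothesis F'_Cauchy : forall eps : R, 0 < eps -> exists N, forall n m y,
  (N <= n)%nat -> (N <= m)%nat -> Cmod (y - z) < rho -> Cmod (F' n y - F' m y) < eps.
Hypothesis F_lim : forall y, Cmod (y - z) < rho -> is_Clim_seq (fun n => F n y) (L y).
Hypothesis F'_lim : is_Clim_seq (fun n => F' n z) l.

Lemma increment_lim_approx (eps : R) (N : nat) :
  (forall n m y, (N <= n)%nat -> (N <= m)%nat -> Cmod (y - z) < rho ->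
    Cmod (F' n y - F' m y) < eps) ->
  forall h, Cmod h < rho ->
  Cmod ((L (z + h)%C - L z) - (F N (z + h)%C - F N z))%C <= eps * Cmod h.
Proof.
  intros close h h_lt. replace h with (z + h - z) in h_lt by ring.
  apply (is_Clim_seq_Cmod_le (fun n => (F n (z + h) - F n z) - (F N (z + h) - F N z)) _ _ N).
  - apply is_Clim_seq_minus; [|apply is_Clim_seq_const].
    apply is_Clim_seq_minus; apply F_lim; [easy|]. now rewrite Cmod_minus_diag.
  - intros n le_N.
    replace (F n (z + h) - F n z - (F N (z + h) - F N z)) with
      ((F n (z + h) - F N (z + h)) - (F n z - F N z)) by ring.
    replace (Cmod h) with (Cmod (z + h - z)) by (f_equal; ring).
    apply (Cmod_increment_le (fun y => F n y - F N y) (fun y => F' n y - F' N y));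
      intros t t_bound.
    + apply is_Cderive_minus; apply F_derive; now apply ball_segment.
    + left. apply close; [easy|easy|now apply ball_segment].
Qed.

Lemma is_Cderive_lim : is_Cderive L z l.
Proof.
  apply is_Cderive_eps. intros eps eps_pos.
  destruct (F'_Cauchy (eps / 3)%R ltac:(lra)) as [N close].
  assert (z_near : Cmod (z - z) < rho) by now rewrite Cmod_minus_diag.
  assert (l_approx : Cmod (l - F' N z) <= eps / 3).
  { apply (is_Clim_seq_Cmod_le (fun n => F' n z - F' N z) _ _ N).
    - apply is_Clim_seq_minus; [easy|apply is_Clim_seq_const].
    - intros n le_N. left. now apply close. }
  destruct (proj1 (is_Cderive_eps _ _ _) (F_derive N z z_near) (eps / 3)%R ltac:(lra))
    as [d [d_pos FN_approx]].
  exists (Rmin d rho). split; [now apply Rmin_pos|].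
  intros h h_lt. apply Rmin_Rgt_l in h_lt as [h_lt_d h_lt_rho].
  replace (L (z + h) - L z - l * h) with
    (((L (z + h) - L z) - (F N (z + h) - F N z)) + (F N (z + h) - F N z - F' N z * h)
     - (l - F' N z) * h) by ring.
  eapply Rle_trans; [apply Cmod_minus_le|].
  eapply Rle_trans; [apply Rplus_le_compat_r, Cmod_triangle|].
  rewrite Cmod_mult.
  pose proof (increment_lim_approx (eps / 3) N close h h_lt_rho).
  pose proof (FN_approx h h_lt_d). pose proof (Cmod_ge_0 h). nra.
Qed.

End DerivativeOfLimit.

(** * Infinite products *)

Lemma inf_prod_eq_lim (u : nat -> C) (l : C) :
  is_Clim_seq (partial_prod u) l -> inf_prod u = l.
Proof. apply Clim_seq_eq. Qed.

Fixpoint partial_prod_deriv (u du : nat -> C) (N : nat) : C :=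
  match N with
  | O => 0
  | S n => partial_prod_deriv u du n * u n + partial_prod u n * du n
  end.

Definition head_sum (a : nat -> R) (n : nat) : R := (Series a - Series (fun k => a (n + k)%nat))%R.

Lemma head_sum_0 (a : nat -> R) : head_sum a 0 = 0%R.
Proof. exact (Rminus_diag (Series a)). Qed.

Lemma head_sum_S (a : nat -> R) (n : nat) : ex_series a ->
  head_sum a (S n) = (head_sum a n + a n)%R.
Proof.
  intros a_summable. unfold head_sum.
  rewrite (Series_incr_1 (fun k => a (n + k)%nat)) by now apply ex_series_incr_n.
  rewrite Nat.add_0_r.
  rewrite (Series_ext (fun k => a (S n + k)%nat) (fun k => a (n + S k)%nat)); [ring|].
  intros k. now rewrite Nat.add_succ_r.
Qed.

Lemma head_sum_nonneg (a : nat -> R) (n : nat) : ex_series a -> (forall k, 0 <= a k) ->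
  0 <= head_sum a n.
Proof.
  intros a_summable a_ge. induction n as [|n IH]; [rewrite head_sum_0; lra|].
  rewrite head_sum_S by easy. specialize (a_ge n). lra.
Qed.

Lemma head_sum_le_Series (a : nat -> R) (n : nat) : ex_series a -> (forall k, 0 <= a k) ->
  head_sum a n <= Series a.
Proof.
  intros a_summable a_ge.
  assert (0 <= Series (fun k => a (n + k)%nat)); [|unfold head_sum; lra].
  rewrite <- (Rmult_0_l (Series (fun k => a (n + k)%nat))), <- Series_scal_l.
  apply Series_le; [|now apply ex_series_incr_n].
  intros k. rewrite Rmult_0_l. split; [lra|apply a_ge].
Qed.

Section SummableFactors.

Variables (u : nat -> C) (a : nat -> R).
Hypothesis a_summable : ex_series a.
Hypothesis u_near_1 : forall n, Cmod (u n - 1) <= a n.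

Lemma factor_bound_nonneg (n : nat) : 0 <= a n.
Proof. eapply Rle_trans; [apply Cmod_ge_0|apply u_near_1]. Qed.

Lemma Cmod_factor_le_exp (n : nat) : Cmod (u n) <= exp (a n).
Proof.
  apply Rle_trans with (1 + a n)%R; [|apply exp_ineq1_le].
  replace (u n) with ((u n - 1) + 1) by ring.
  eapply Rle_trans; [apply Cmod_triangle|]. rewrite Cmod_1. pose proof (u_near_1 n). lra.
Qed.

Lemma Cmod_partial_prod_le_exp (n : nat) : Cmod (partial_prod u n) <= exp (head_sum a n).
Proof.
  induction n as [|n IH]; cbn [partial_prod].
  - rewrite Cmod_1, head_sum_0, exp_0. lra.
  - rewrite Cmod_mult, head_sum_S, exp_plus by easy.
    apply Rmult_le_compat; try apply Cmod_ge_0; [exact IH|apply Cmod_factor_le_exp].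
Qed.

Lemma Cmod_partial_prod_le (n : nat) : Cmod (partial_prod u n) <= exp (Series a).
Proof.
  eapply Rle_trans; [apply Cmod_partial_prod_le_exp|].
  auto using exp_le, head_sum_le_Series, factor_bound_nonneg.
Qed.

Lemma partial_prod_increment_le (n : nat) :
  Cmod (partial_prod u (S n) - partial_prod u n) <= exp (Series a) * a n.
Proof.
  cbn [partial_prod]. replace (partial_prod u n * u n - partial_prod u n)
    with (partial_prod u n * (u n - 1)) by ring.
  rewrite Cmod_mult.
  apply Rmult_le_compat; try apply Cmod_ge_0; [apply Cmod_partial_prod_le|apply u_near_1].
Qed.

Variable du : nat -> C.
Hypothesis du_le : forall n, Cmod (du n) <= a n.

Lemma Cmod_partial_prod_deriv_le_exp (n : nat) :
  Cmod (partial_prod_deriv u du n) <= exp (head_sum a n) * head_sum a n.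
Proof.
  induction n as [|n IH]; cbn [partial_prod_deriv].
  - rewrite Cmod_0, head_sum_0. lra.
  - eapply Rle_trans; [apply Cmod_triangle|]. rewrite !Cmod_mult, head_sum_S, exp_plus by easy.
    pose proof (factor_bound_nonneg n) as a_ge. pose proof (exp_pos (head_sum a n)) as exp_head_pos.
    apply Rle_trans with
      (exp (head_sum a n) * head_sum a n * exp (a n) + exp (head_sum a n) * a n)%R.
    + apply Rplus_le_compat; apply Rmult_le_compat; try apply Cmod_ge_0; auto using
        Cmod_factor_le_exp, Cmod_partial_prod_le_exp.
    + pose proof (exp_ineq1_le (a n)).
      assert (exp (head_sum a n) * a n * 1 <= exp (head_sum a n) * a n * exp (a n)); [|lra].
      apply Rmult_le_compat_l; [apply Rmult_le_pos|]; lra.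
Qed.

Lemma partial_prod_deriv_increment_le (n : nat) :
  Cmod (partial_prod_deriv u du (S n) - partial_prod_deriv u du n)
    <= (exp (Series a) * Series a + exp (Series a)) * a n.
Proof.
  cbn [partial_prod_deriv].
  replace (partial_prod_deriv u du n * u n + partial_prod u n * du n - partial_prod_deriv u du n)
    with (partial_prod_deriv u du n * (u n - 1) + partial_prod u n * du n) by ring.
  eapply Rle_trans; [apply Cmod_triangle|]. rewrite !Cmod_mult, Rmult_plus_distr_r.
  apply Rplus_le_compat; apply Rmult_le_compat; auto using Cmod_ge_0, Cmod_partial_prod_le.
  eapply Rle_trans; [apply Cmod_partial_prod_deriv_le_exp|].
  apply Rmult_le_compat;
    auto using head_sum_nonneg, head_sum_le_Series, factor_bound_nonneg, exp_le.
  left. apply exp_pos.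
Qed.

End SummableFactors.

Lemma ex_series_Cmod_le (s : nat -> C) (a : nat -> R) :
  (forall n, Cmod (s n) <= a n) -> ex_series a -> ex_series (fun n => Cmod (s n)).
Proof.
  intros s_le. apply (ex_series_le (V := R_CompleteNormedModule)). intros n.
  change (Rabs (Cmod (s n)) <= a n). rewrite Rabs_pos_eq by apply Cmod_ge_0. apply s_le.
Qed.

Lemma inf_prod_lim (u : nat -> C) :
  ex_series (fun n => Cmod (u n - 1)) -> is_Clim_seq (partial_prod u) (inf_prod u).
Proof.
  intros summable. set (a := fun n => Cmod (u n - 1)) in *.
  destruct (summable_increments_lim (fun n => exp (Series a) * a n)%R) with (s := partial_prod u)
    (N := 0%nat) as [l u_lim].
  - now apply (ex_series_scal_l (V := R_NormedModule)).
  - intros n _. apply partial_prod_increment_le; [easy|]. intros k. apply Rle_refl.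
  - now rewrite (inf_prod_eq_lim u l).
Qed.

Lemma partial_prod_ext (u v : nat -> C) (n : nat) :
  (forall k, (k < n)%nat -> u k = v k) -> partial_prod u n = partial_prod v n.
Proof.
  induction n as [|n IH]; intros E; [easy|]. cbn [partial_prod]. rewrite IH, (E n); auto.
Qed.

Lemma inf_prod_ext (u v : nat -> C) : (forall k, u k = v k) -> inf_prod u = inf_prod v.
Proof.
  intros E. unfold inf_prod. replace (partial_prod u) with (partial_prod v); [easy|].
  apply functional_extensionality. intros n. now apply partial_prod_ext.
Qed.

Lemma partial_prod_mult (u v : nat -> C) (n : nat) :
  partial_prod (fun k => u k * v k) n = partial_prod u n * partial_prod v n.
Proof. induction n as [|n IH]; cbn [partial_prod]; [ring|]. rewrite IH; ring. Qed.

Lemma partial_prod_const (c : C) (n : nat) : partial_prod (fun _ => c) n = c ^ n.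
Proof. induction n as [|n IH]; cbn [partial_prod]; [easy|]. rewrite IH, Cpow_S. ring. Qed.

Lemma partial_prod_neq_0 (u : nat -> C) (n : nat) :
  (forall k, (k < n)%nat -> u k <> 0) -> partial_prod u n <> 0.
Proof.
  induction n as [|n IH]; intros u_neq; cbn [partial_prod]; [apply C1_nz|].
  apply Cmult_neq_0; auto.
Qed.

Lemma partial_prod_S_l (u : nat -> C) (n : nat) :
  partial_prod u (S n) = u O * partial_prod (fun k => u (S k)) n.
Proof.
  induction n as [|n IH]; [cbn; ring|].
  change (partial_prod u (S (S n))) with (partial_prod u (S n) * u (S n)).
  rewrite IH. cbn [partial_prod]. ring.
Qed.

Lemma partial_prod_exchange (f : nat -> nat -> C) (m n : nat) :
  partial_prod (fun k => partial_prod (f k) n) m =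
  partial_prod (fun j => partial_prod (fun k => f k j) m) n.
Proof.
  induction n as [|n IH]; cbn [partial_prod].
  - rewrite partial_prod_const. apply Cpow_1_l.
  - now rewrite partial_prod_mult, IH.
Qed.

Lemma partial_prod_fold (u : nat -> C) (m : nat) :
  partial_prod u (2 * m) = partial_prod (fun k => u k * u (2 * m - 1 - k)%nat) m.
Proof.
  rewrite partial_prod_mult. replace (2 * m)%nat with (m + m)%nat by lia.
  assert (split : forall n, partial_prod u (m + n) =
    partial_prod u m * partial_prod (fun k => u (m + k)%nat) n).
  { induction n as [|n IH]; cbn [partial_prod]; [rewrite Nat.add_0_r; ring|].
    rewrite Nat.add_succ_r. cbn [partial_prod]. rewrite IH. ring. }
  assert (reverse : forall n v, partial_prod v n = partial_prod (fun k => v (n - 1 - k)%nat) n).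
  { induction n as [|n IH]; intros v; [easy|]. rewrite partial_prod_S_l, IH. cbn [partial_prod].
    rewrite Cmult_comm. f_equal; [apply partial_prod_ext; intros k k_lt|]; f_equal; lia. }
  rewrite split. f_equal. rewrite reverse. apply partial_prod_ext. intros k k_lt. f_equal. lia.
Qed.

Lemma is_Clim_seq_partial_prod (s : nat -> nat -> C) (l : nat -> C) (m : nat) :
  (forall k, is_Clim_seq (s k) (l k)) ->
  is_Clim_seq (fun n => partial_prod (fun k => s k n) m) (partial_prod l m).
Proof.
  intros s_lim. induction m as [|m IH]; cbn [partial_prod]; [apply is_Clim_seq_const|].
  now apply is_Clim_seq_mult.
Qed.

Lemma inv_minus_1_summable (u : nat -> C) : (forall n, u n <> 0) ->
  ex_series (fun n => Cmod (u n - 1)) -> ex_series (fun n => Cmod (/ u n - 1)).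
Proof.
  intros u_neq summable.
  destruct (is_lim_seq_0_lt _ (1 / 2) (ex_series_lim_0 _ summable) ltac:(lra)) as [N small].
  apply (ex_series_incr_n _ N).
  apply (ex_series_Cmod_le _ (fun n => (2 * Cmod (u (N + n)%nat - 1))%R)).
  2:{ apply (ex_series_scal_l (V := R_NormedModule)).
      exact (proj1 (ex_series_incr_n _ N) summable). }
  intros k. set (x := u (N + k)%nat). assert (x_neq : x <> 0) by apply u_neq.
  change (Cmod (/ x - 1) <= 2 * Cmod (x - 1)).
  assert (x_near : Cmod (x - 1) < 1 / 2) by (apply small; lia).
  assert (x_gt : 1 / 2 < Cmod x).
  { pose proof (Cmod_triangle_rev 1 (1 - x)) as triangle.
    rewrite Cmod_1, (Cmod_minus_sym 1 x) in triangle.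
    replace (1 - (1 - x)) with x in triangle by ring. lra. }
  replace (/ x - 1) with ((1 - x) / x) by now field.
  rewrite Cmod_div, Cmod_minus_sym by easy. apply Rle_div_l; [lra|].
  pose proof (Cmod_ge_0 (x - 1)). nra.
Qed.

(* The reciprocal product also converges, and the two limits multiply to 1. *)
Lemma inf_prod_neq_0 (u : nat -> C) :
  ex_series (fun n => Cmod (u n - 1)) -> (forall n, u n <> 0) -> inf_prod u <> 0.
Proof.
  intros summable u_neq inf_prod_0.
  pose proof (is_Clim_seq_mult _ _ _ _ (inf_prod_lim u summable)
    (inf_prod_lim _ (inv_minus_1_summable u u_neq summable))) as prod_lim.
  apply C1_nz. transitivity (inf_prod u * inf_prod (fun n => / u n)); [|rewrite inf_prod_0; ring].
  apply (is_Clim_seq_unique (fun _ => 1)); [apply is_Clim_seq_const|].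
  eapply is_Clim_seq_ext; [|exact prod_lim]. intros n. cbv beta.
  rewrite <- partial_prod_mult, <- (Cpow_1_l n), <- partial_prod_const.
  apply partial_prod_ext. intros k _. apply Cinv_r, u_neq.
Qed.

Lemma is_Cderive_partial_prod (u u' : nat -> C -> C) (y : C) :
  (forall n, is_Cderive (u n) y (u' n y)) ->
  forall n, is_Cderive (fun y => partial_prod (fun n => u n y) n) y
    (partial_prod_deriv (fun n => u n y) (fun n => u' n y) n).
Proof.
  intros Du n. induction n as [|n IH]; [exact (is_Cderive_const 1 y)|].
  cbn [partial_prod partial_prod_deriv].
  apply (is_Cderive_mult (fun y => partial_prod (fun n => u n y) n) (u n)); auto.
Qed.

Lemma is_Cderive_inf_prod (u u' : nat -> C -> C) (z : C) (rho : R) (a : nat -> R) :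
  0 < rho -> ex_series a ->
  (forall n y, Cmod (y - z) < rho -> is_Cderive (u n) y (u' n y)) ->
  (forall n y, Cmod (y - z) < rho -> Cmod (u n y - 1) <= a n) ->
  (forall n y, Cmod (y - z) < rho -> Cmod (u' n y) <= a n) ->
  exists l, is_Cderive (fun y => inf_prod (fun n => u n y)) z l /\
    is_Clim_seq (partial_prod_deriv (fun n => u n z) (fun n => u' n z)) l.
Proof.
  intros rho_pos a_summable Du u_near_1 u'_le.
  assert (z_near : Cmod (z - z) < rho) by now rewrite Cmod_minus_diag.
  set (b := fun n => ((exp (Series a) * Series a + exp (Series a)) * a n)%R).
  assert (b_summable : ex_series b) by now apply (ex_series_scal_l (V := R_NormedModule)).
  assert (increment_le : forall y, Cmod (y - z) < rho -> forall n, (0 <= n)%nat ->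
    Cmod (partial_prod_deriv (fun n => u n y) (fun n => u' n y) (S n)
      - partial_prod_deriv (fun n => u n y) (fun n => u' n y) n) <= b n).
  { intros y y_near n _. apply (partial_prod_deriv_increment_le (fun n => u n y) a); auto. }
  destruct (summable_increments_lim b b_summable _ 0 (increment_le z z_near)) as [l l_lim].
  exists l. split; [|easy].
  apply (is_Cderive_lim (fun n y => partial_prod (fun n => u n y) n)
    (fun n y => partial_prod_deriv (fun n => u n y) (fun n => u' n y) n)) with (rho := rho); auto.
  - intros n y y_near. apply is_Cderive_partial_prod. intros k. now apply Du.
  - intros eps eps_pos.
    destruct (summable_increments_unif_Cauchy b b_summable 0 eps eps_pos) as [N close].
    exists N. intros n m y le_n le_m y_near.
    now apply (close (partial_prod_deriv (fun n => u n y) (fun n => u' n y))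
      (increment_le y y_near)).
  - intros y y_near. apply inf_prod_lim.
    apply (ex_series_Cmod_le _ a); auto.
Qed.

Fixpoint partial_sum (u : nat -> C) (N : nat) : C :=
  match N with O => 0 | S n => partial_sum u n + u n end.

Lemma partial_sum_ext (u v : nat -> C) (n : nat) :
  (forall k, (k < n)%nat -> u k = v k) -> partial_sum u n = partial_sum v n.
Proof.
  induction n as [|n IH]; intros E; [easy|]. cbn [partial_sum]. rewrite IH, (E n); auto.
Qed.

Lemma partial_prod_deriv_log (u du : nat -> C) : (forall n, u n <> 0) ->
  forall n, partial_prod_deriv u du n = partial_prod u n * partial_sum (fun k => du k / u k) n.
Proof.
  intros u_neq n. induction n as [|n IH]; cbn [partial_prod partial_prod_deriv partial_sum].
  - ring.
  - rewrite IH. field. apply u_neq.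
Qed.

Lemma is_Cderive_inf_prod_log (u u' : nat -> C -> C) (z : C) (rho : R) (a : nat -> R) :
  0 < rho -> ex_series a ->
  (forall n y, Cmod (y - z) < rho -> is_Cderive (u n) y (u' n y)) ->
  (forall n y, Cmod (y - z) < rho -> Cmod (u n y - 1) <= a n) ->
  (forall n y, Cmod (y - z) < rho -> Cmod (u' n y) <= a n) ->
  (forall n, u n z <> 0) ->
  exists s, is_Cderive (fun y => inf_prod (fun n => u n y)) z (inf_prod (fun n => u n z) * s) /\
    is_Clim_seq (partial_sum (fun n => u' n z / u n z)) s.
Proof.
  intros rho_pos a_summable Du u_near_1 u'_le u_neq.
  destruct (is_Cderive_inf_prod u u' z rho a) as [l [Dprod l_lim]]; auto.
  assert (summable : ex_series (fun n => Cmod (u n z - 1))).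
  { apply (ex_series_Cmod_le _ a); [|easy]. intros n. apply u_near_1.
    now rewrite Cmod_minus_diag. }
  pose proof (inf_prod_neq_0 _ summable u_neq) as prod_neq.
  pose proof (inf_prod_lim _ summable) as prod_lim.
  exists (/ inf_prod (fun n => u n z) * l). split.
  { apply is_Cderive_eq with l; [now field|easy]. }
  eapply is_Clim_seq_ext; [|exact (is_Clim_seq_mult _ _ _ _
    (is_Cderive_lim_seq Cinv _ _ _ (is_Cderive_Cinv _ prod_neq) prod_lim) l_lim)].
  intros n. cbv beta. rewrite partial_prod_deriv_log by easy. field.
  now apply partial_prod_neq_0.
Qed.

(** * The exponential *)

Lemma Cmod_pair_le (x y : R) : Cmod (x, y) <= Rabs x + Rabs y.
Proof.
  replace (x, y) with (x + Ci * y) by (unfold Cplus, Cmult, Ci, RtoC; simpl; f_equal; ring).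
  eapply Rle_trans; [apply Cmod_triangle|]. rewrite Cmod_mult, Cmod_Ci, !Cmod_R. lra.
Qed.

Lemma is_Cderive_Cauchy_Riemann (u v : R -> R -> R) (z : C) (a b : R) :
  differentiable_pt_lim u (Re z) (Im z) a (- b) ->
  differentiable_pt_lim v (Re z) (Im z) b a ->
  is_Cderive (fun w => (u (Re w) (Im w), v (Re w) (Im w))) z (a, b).
Proof.
  intros Du Dv. apply is_Cderive_eps. intros eps eps_pos.
  assert (half_pos : 0 < eps / 2) by lra.
  destruct (Du (mkposreal _ half_pos)) as [[d1 d1_pos] u_approx].
  destruct (Dv (mkposreal _ half_pos)) as [[d2 d2_pos] v_approx].
  exists (Rmin d1 d2). split; [now apply Rmin_pos|].
  intros h h_lt. apply Rmin_Rgt_l in h_lt as [h_lt1 h_lt2].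
  pose proof (re_le_Cmod h) as re_le. pose proof (im_le_Cmod h) as im_le.
  destruct z as [x y], h as [s t]. simpl in *.
  specialize (u_approx (x + s) (y + t))%R. specialize (v_approx (x + s) (y + t))%R.
  replace (x + s - x)%R with s in * by ring. replace (y + t - y)%R with t in * by ring.
  specialize (u_approx ltac:(lra) ltac:(lra)). specialize (v_approx ltac:(lra) ltac:(lra)).
  pose proof (Rmax_lub _ _ _ re_le im_le).
  match goal with |- Cmod ?w <= _ => replace w with
    (u (x + s) (y + t) - u x y - (a * s + - b * t),
     v (x + s) (y + t) - v x y - (b * s + a * t))%R end.
  - eapply Rle_trans; [apply Cmod_pair_le|]. nra.
  - unfold Cminus, Cplus, Copp, Cmult; simpl. f_equal; ring.
Qed.

Lemma differentiable_pt_lim_mult_separate (f g : R -> R) (x y l m : R) :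
  derivable_pt_lim f x l -> derivable_pt_lim g y m ->
  differentiable_pt_lim (fun u v => f u * g v)%R x y (l * g y) (f x * m).
Proof.
  intros Df Dg.
  pose proof (proj2 (filterdiff_differentiable_pt_lim _ x y l 0)
    (differentiable_pt_lim_proj1_0 f x y l Df)) as diff_f.
  assert (diff_g : filterdiff (fun p : R * R => g (snd p)) (locally (x, y))
    (fun p => snd p * m)%R).
  { apply (filterdiff_comp' (U := prod_NormedModule _ R_NormedModule R_NormedModule)
      (fun p : R * R => snd p) g (x, y) (fun p => snd p) (fun t => t * m)%R).
    - apply filterdiff_linear, is_linear_snd.
    - apply is_derive_Reals in Dg. exact Dg. }
  apply filterdiff_differentiable_pt_lim.
  eapply filterdiff_ext_lin; [exact (filterdiff_mult_fct _ _ (x, y) _ _ Rmult_comm diff_f diff_g)|].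
  intros [s t]. unfold plus, mult; simpl. unfold mult; simpl. ring.
Qed.

Lemma is_Cderive_cexp (z : C) : is_Cderive cexp z (cexp z).
Proof.
  apply (is_Cderive_Cauchy_Riemann (fun x y => exp x * cos y)%R (fun x y => exp x * sin y)%R).
  - rewrite Ropp_mult_distr_r.
    apply differentiable_pt_lim_mult_separate;
      [apply derivable_pt_lim_exp|apply derivable_pt_lim_cos].
  - apply differentiable_pt_lim_mult_separate;
      [apply derivable_pt_lim_exp|apply derivable_pt_lim_sin].
Qed.

Lemma cexp_plus (a b : C) : cexp (a + b) = cexp a * cexp b.
Proof.
  destruct a as [a1 a2], b as [b1 b2]. unfold cexp, Cmult, Cplus; simpl.
  rewrite exp_plus, cos_plus, sin_plus. f_equal; ring.
Qed.

Lemma cexp_0 : cexp 0 = 1.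
Proof. unfold cexp; simpl. rewrite exp_0, cos_0, sin_0. unfold RtoC. f_equal; ring. Qed.

Lemma Cmod_cexp (a : C) : Cmod (cexp a) = exp (Re a).
Proof.
  destruct a as [a b]. unfold Cmod, cexp; simpl.
  replace (exp a * cos b * (exp a * cos b * 1) + exp a * sin b * (exp a * sin b * 1))%R
    with (exp a * exp a * (Rsqr (sin b) + Rsqr (cos b)))%R by (unfold Rsqr; ring).
  rewrite sin2_cos2, Rmult_1_r. apply sqrt_square. left; apply exp_pos.
Qed.

Definition tpi : C := RtoC (2 * PI) * Ci.

Lemma tpi_neq_0 : tpi <> 0.
Proof. pose proof PI_RGT_0. apply Cmult_neq_0; [apply RtoC_neq_0; lra|apply Ci_nz]. Qed.

Definition ee (w : C) : C := cexp (tpi * w).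

Lemma ee_plus (a b : C) : ee (a + b) = ee a * ee b.
Proof. unfold ee. rewrite <- cexp_plus. f_equal; ring. Qed.

Lemma ee_0 : ee 0 = 1.
Proof. unfold ee. rewrite Cmult_0_r. apply cexp_0. Qed.

Lemma Cmod_ee (a : C) : Cmod (ee a) = exp (- (2 * PI) * Im a).
Proof.
  unfold ee, tpi. rewrite Cmod_cexp. f_equal. destruct a. unfold RtoC, Ci, Cmult; simpl. ring.
Qed.

Lemma Cmod_ee_RtoC (x : R) : Cmod (ee x) = 1%R.
Proof. rewrite Cmod_ee, im_RtoC, Rmult_0_r. apply exp_0. Qed.

Lemma ee_neq_0 (a : C) : ee a <> 0.
Proof. apply Cmod_gt_0. rewrite Cmod_ee. apply exp_pos. Qed.
#[local] Hint Resolve tpi_neq_0 ee_neq_0 : Cneq.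

Lemma ee_opp (a : C) : ee (- a) = / ee a.
Proof.
  apply (Cmult_eq_reg_r _ _ (ee a)); [apply ee_neq_0|].
  rewrite <- ee_plus, Cinv_l by apply ee_neq_0. rewrite <- ee_0. f_equal. ring.
Qed.

Lemma ee_minus (a b : C) : ee (a - b) = ee a / ee b.
Proof. unfold Cminus. now rewrite ee_plus, ee_opp. Qed.

Lemma ee_double (a b : C) : a = 2 * b -> ee a = ee b * ee b.
Proof. intros ->. rewrite <- ee_plus. f_equal. ring. Qed.

Lemma ee_pow (a : C) (n : nat) : ee a ^ n = ee (INR n * a).
Proof.
  induction n as [|n IH].
  - simpl. now rewrite Cmult_0_l, ee_0.
  - rewrite S_INR, RtoC_plus, Cpow_S, IH, <- ee_plus. f_equal; ring.
Qed.

Lemma ee_RtoC (x : R) : ee x = (cos (2 * PI * x), sin (2 * PI * x)).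
Proof.
  unfold ee, cexp, tpi, Cmult, RtoC, Ci; simpl.
  replace ((2 * PI * 0 - 0 * 1) * x - (2 * PI * 1 + 0 * 0) * 0)%R with 0%R by ring.
  rewrite exp_0. f_equal; rewrite Rmult_1_l; f_equal; ring.
Qed.

Lemma ee_1 : ee 1 = 1.
Proof. rewrite ee_RtoC, Rmult_1_r, cos_2PI, sin_2PI. easy. Qed.

Lemma ee_half : ee (/ 2) = - (1).
Proof.
  rewrite <- RtoC_inv, ee_RtoC by lra. replace (2 * PI * / 2)%R with PI by field.
  rewrite cos_PI, sin_PI. unfold Copp; simpl. f_equal. ring.
Qed.

Lemma ee_plus_half (a : C) : ee (a + / 2) = - ee a.
Proof. rewrite ee_plus, ee_half. ring. Qed.

Lemma ee_IZR (n : Z) : ee (IZR n) = 1.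
Proof.
  assert (ee_INR : forall m : nat, ee (INR m) = 1).
  { intros m. now rewrite <- (Cmult_1_r (INR m)), <- ee_pow, ee_1, Cpow_1_l. }
  destruct (Z.le_ge_cases 0 n) as [n_ge|n_le].
  - rewrite <- (Z2Nat.id n), <- INR_IZR_INZ by easy. apply ee_INR.
  - replace n with (- Z.of_nat (Z.to_nat (- n)))%Z by lia.
    rewrite opp_IZR, <- INR_IZR_INZ, RtoC_opp, ee_opp, ee_INR. now field.
Qed.

Lemma ee_plus_IZR (a : C) (n : Z) : ee (a + IZR n) = ee a.
Proof. rewrite ee_plus, ee_IZR. ring. Qed.

Lemma ee_half_even (n : Z) : Z.even n = true -> ee (IZR n / 2) = 1.
Proof.
  intros even. apply Z.even_spec in even as [m ->]. rewrite mult_IZR, RtoC_mult.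
  replace (2 * IZR m / 2) with (RtoC (IZR m)) by field. apply ee_IZR.
Qed.

Lemma ee_eq_1 (a : C) : ee a = 1 -> exists n : Z, a = IZR n.
Proof.
  intros ee_a. pose proof PI_RGT_0.
  assert (real : Im a = 0%R).
  { pose proof (Cmod_ee a) as mod_a. rewrite ee_a, Cmod_1, <- exp_0 in mod_a.
    apply exp_inv in mod_a. nra. }
  destruct a as [x y]. simpl in real. subst y. change (x, 0%R) with (RtoC x) in *.
  rewrite ee_RtoC in ee_a. injection ee_a. intros _ cos_1.
  replace (2 * PI * x)%R with (2 * (PI * x))%R in cos_1 by ring. rewrite cos_2a_sin in cos_1.
  destruct (sin_eq_0_0 (PI * x)) as [k x_eq]; [nra|]. exists k. f_equal. nra.
Qed.

Lemma is_Cderive_ee (f : C -> C) (z l : C) : is_Cderive f z l ->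
  is_Cderive (fun y => ee (f y)) z (tpi * ee (f z) * l).
Proof.
  intros Df. apply is_Cderive_eq with (ee (f z) * (tpi * l)); [ring|].
  apply (is_Cderive_comp cexp (fun y => tpi * f y)).
  - now apply is_Cderive_scal.
  - apply is_Cderive_cexp.
Qed.

(* Plain [eassumption] would try to convert the functions by unfolding infinite products. *)
Local Ltac syntactic_Cderive_assumption f :=
  match goal with
  | derivative : is_Cderive ?g _ _ |- _ =>
      let f_eta := eval cbv beta in (fun y : C => f y) in
      let g_eta := eval cbv beta in (fun y : C => g y) in
      constr_eq f_eta g_eta; exact derivative
  end.

Local Ltac auto_Cderive :=
  lazymatch goal with
  | |- is_Cderive (fun y => y) _ _ => apply is_Cderive_id
  | |- is_Cderive (fun _ => ?c) _ _ => apply is_Cderive_const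
  | |- is_Cderive (fun y => - @?f y) _ _ => apply (is_Cderive_opp f); auto_Cderive
  | |- is_Cderive (fun y => @?f y + @?g y) _ _ => apply (is_Cderive_plus f g); auto_Cderive
  | |- is_Cderive (fun y => @?f y - @?g y) _ _ => apply (is_Cderive_minus f g); auto_Cderive
  | |- is_Cderive (fun y => @?f y * @?g y) _ _ =>
      lazymatch f with
      | fun _ => ?c => apply (is_Cderive_scal c g)
      | _ => apply (is_Cderive_mult f g)
      end; auto_Cderive
  | |- is_Cderive (fun y => @?f y / @?g y) _ _ =>
      lazymatch g with
      | fun _ => ?c => apply (is_Cderive_div_const c f)
      | _ => apply (is_Cderive_div f g)
      end; auto_Cderive
  | |- is_Cderive (fun y => / @?f y) _ _ => apply (is_Cderive_inv f); auto_Cderive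
  | |- is_Cderive (fun y => @?f y ^ ?n) _ _ => apply (is_Cderive_pow f); auto_Cderive
  | |- is_Cderive (fun y => ee (@?f y)) _ _ => apply (is_Cderive_ee f); auto_Cderive
  | |- is_Cderive ?f _ _ => syntactic_Cderive_assumption f
  | |- _ => auto 10 with Cneq nocore
  end.

Local Ltac Cderive := eapply is_Cderive_eq; [|auto_Cderive]; cbv beta.

Lemma is_Clim_seq_ee_0 (s : nat -> C) : is_Clim_seq s 0 -> is_Clim_seq (fun n => ee (s n)) 1.
Proof.
  intros s_lim. rewrite <- ee_0.
  apply (is_Cderive_lim_seq ee 0 (tpi * ee 0 * 1)); [|easy].
  apply (is_Cderive_ee (fun y => y)), is_Cderive_id.
Qed.

Lemma Cmod_ee_le (a : C) : Cmod (ee a) <= exp (2 * PI * Cmod a).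
Proof.
  rewrite Cmod_ee. apply exp_le. pose proof PI_RGT_0. pose proof (im_le_Cmod a).
  pose proof (Rle_abs (- Im a)) as im_ge. rewrite Rabs_Ropp in im_ge. nra.
Qed.

Lemma Cmod_ee_ball (u y : C) (r : R) :
  Cmod (y - u) < r -> Cmod (ee y) <= exp (2 * PI * (Cmod u + r)).
Proof.
  intros y_near. eapply Rle_trans; [apply Cmod_ee_le|apply exp_le].
  pose proof PI_RGT_0. pose proof (Cmod_triangle_rev y u). apply Rmult_le_compat_l; lra.
Qed.

Lemma Cmod_ee_lt_1 (z : C) : upper z -> Cmod (ee z) < 1.
Proof.
  intros z_upper. rewrite Cmod_ee, <- exp_0. apply exp_increasing.
  pose proof PI_RGT_0. unfold upper in z_upper. nra.
Qed.

(** * The q-Pochhammer symbol *)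

Lemma ex_series_S_geom (r : R) : 0 <= r < 1 -> ex_series (fun n => (INR (S n) * r ^ n)%R).
Proof.
  intros r_bound. apply ex_series_Rabs.
  apply (ex_series_ext (fun n => Rabs (PS_derive (fun _ => 1%R) n * r ^ n))).
  { intros n. unfold PS_derive. now rewrite Rmult_1_r. }
  apply CV_disk_inside. rewrite CV_radius_derive, Rabs_pos_eq by lra.
  apply Rbar_lt_le_trans with (Finite 1); [simpl; lra|].
  apply CV_radius_bounded. exists 1%R. intros n. rewrite pow1, Rmult_1_r, Rabs_R1. lra.
Qed.

Lemma pow_n_Cpow (x : C) (n : nat) : pow_n x n = x ^ n.
Proof.
  induction n as [|n IH]; [easy|].
  change (pow_n x (S n)) with (x * pow_n x n). now rewrite IH, Cpow_S.
Qed.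

Lemma qpoch_inf_prod (a q : C) : qpoch a q = inf_prod (fun k => 1 - a * q ^ k).
Proof. apply inf_prod_ext. intros k. now rewrite pow_n_Cpow. Qed.

Lemma Cmod_qpoch_factor (a q : C) (k : nat) :
  Cmod (1 - a * q ^ k - 1) = (Cmod a * Cmod q ^ k)%R.
Proof. rewrite <- Cmod_pow, <- Cmod_mult, <- Cmod_opp. f_equal. ring. Qed.

Lemma qpoch_factors_summable (a q : C) : Cmod q < 1 ->
  ex_series (fun k => Cmod (1 - a * q ^ k - 1)).
Proof.
  intros q_lt. eapply ex_series_ext; [intros k; symmetry; apply Cmod_qpoch_factor|].
  apply ex_series_geom_scal. pose proof (Cmod_ge_0 q). lra.
Qed.

Lemma qpoch_lim (a q : C) : Cmod q < 1 ->
  is_Clim_seq (partial_prod (fun k => 1 - a * q ^ k)) (qpoch a q).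
Proof. intros q_lt. rewrite qpoch_inf_prod. now apply inf_prod_lim, qpoch_factors_summable. Qed.

Lemma qpoch_neq_0 (a q : C) : Cmod q < 1 -> (forall k, 1 - a * q ^ k <> 0) -> qpoch a q <> 0.
Proof. intros q_lt. rewrite qpoch_inf_prod. now apply inf_prod_neq_0, qpoch_factors_summable. Qed.

Lemma qpoch_neq_0_of_lt (a q : C) : Cmod q < 1 -> Cmod a < 1 -> qpoch a q <> 0.
Proof.
  intros q_lt a_lt. apply qpoch_neq_0; [easy|]. intros k E. apply Ceq_minus in E.
  apply (f_equal Cmod) in E. rewrite Cmod_1, Cmod_mult, Cmod_pow in E.
  pose proof (Cmod_ge_0 a). pose proof (pow_le_1 (Cmod q) k ltac:(pose proof (Cmod_ge_0 q); lra)).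
  nra.
Qed.

Lemma qpoch_S (a q : C) : Cmod q < 1 -> qpoch a q = (1 - a) * qpoch (a * q) q.
Proof.
  intros q_lt. rewrite qpoch_inf_prod. apply inf_prod_eq_lim, (is_Clim_seq_incr_n _ _ 1).
  eapply is_Clim_seq_ext; [|exact (is_Clim_seq_scal (1 - a) _ _ (qpoch_lim (a * q) q q_lt))].
  intros n. cbv beta. rewrite partial_prod_S_l. f_equal; [simpl; ring|].
  apply partial_prod_ext. intros k _. rewrite Cpow_S. ring.
Qed.

Section QPochhammerDerivative.

Variables (A Q A' Q' : C -> C) (w : C) (rho M r : R).
Hypothesis rho_pos : 0 < rho.
Hypothesis r_bound : 0 < r < 1.
Hypothesis A_derive : forall y, Cmod (y - w) < rho -> is_Cderive A y (A' y).
Hypothesis Q_derive : forall y, Cmod (y - w) < rho -> is_Cderive Q y (Q' y).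
Hypothesis A_le : forall y, Cmod (y - w) < rho -> Cmod (A y) <= M.
Hypothesis A'_le : forall y, Cmod (y - w) < rho -> Cmod (A' y) <= M.
Hypothesis Q_le : forall y, Cmod (y - w) < rho -> Cmod (Q y) <= r.
Hypothesis Q'_le : forall y, Cmod (y - w) < rho -> Cmod (Q' y) <= M.

Let factor (n : nat) (y : C) : C := 1 - A y * Q y ^ n.
Let factor' (n : nat) (y : C) : C :=
  - (A' y * Q y ^ n + A y * (INR n * Q y ^ (n - 1) * Q' y)).
Let majorant (n : nat) : R := ((M + M * M / r) * (INR (S n) * r ^ n))%R.

Lemma qpoch_majorant_summable : ex_series majorant.
Proof. apply (ex_series_scal_l (V := R_NormedModule)), ex_series_S_geom. lra. Qed.

Lemma Cmod_qpoch_base_pow_le (n : nat) (y : C) : Cmod (y - w) < rho -> Cmod (Q y ^ n) <= r ^ n.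
Proof.
  intros y_near. rewrite Cmod_pow. apply pow_incr. split; [apply Cmod_ge_0|now apply Q_le].
Qed.

Lemma qpoch_bound_nonneg : 0 <= M.
Proof. eapply Rle_trans; [apply Cmod_ge_0|apply (A_le w)]. now rewrite Cmod_minus_diag. Qed.

Lemma is_Cderive_qpoch_factor (n : nat) (y : C) : Cmod (y - w) < rho ->
  is_Cderive (factor n) y (factor' n y).
Proof.
  intros y_near. unfold factor, factor'. pose proof (A_derive y y_near).
  pose proof (Q_derive y y_near). Cderive. ring.
Qed.

Lemma qpoch_factor_near_1 (n : nat) (y : C) :
  Cmod (y - w) < rho -> Cmod (factor n y - 1) <= majorant n.
Proof.
  intros y_near. unfold factor, majorant. rewrite Cmod_qpoch_factor, <- Cmod_pow.
  pose proof (Cmod_qpoch_base_pow_le n y y_near).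
  pose proof qpoch_bound_nonneg.
  assert (0 < r ^ n) by (apply pow_lt; lra). pose proof (pos_INR n).
  assert (0 <= M * M / r) by (apply Rdiv_le_0_compat; nra).
  apply Rle_trans with (M * r ^ n)%R.
  - apply Rmult_le_compat; auto using Cmod_ge_0.
  - rewrite <- Rmult_assoc. apply Rmult_le_compat_r; [lra|]. rewrite <- (Rmult_1_r M) at 1.
    apply Rmult_le_compat; rewrite ?S_INR; lra.
Qed.

Lemma Cmod_qpoch_factor'_le (n : nat) (y : C) :
  Cmod (y - w) < rho -> Cmod (factor' n y) <= majorant n.
Proof.
  intros y_near. unfold factor', majorant. pose proof qpoch_bound_nonneg.
  assert (r_pow_pos : 0 < r ^ n) by (apply pow_lt; lra). pose proof (pos_INR n) as n_ge.
  rewrite Cmod_opp. eapply Rle_trans; [apply Cmod_triangle|].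
  rewrite !Cmod_mult, Cmod_R, Rabs_pos_eq by easy.
  apply Rle_trans with (M * r ^ n + M * M / r * (INR n * r ^ n))%R.
  - apply Rplus_le_compat.
    + apply Rmult_le_compat; auto using Cmod_ge_0, Cmod_qpoch_base_pow_le.
    + replace (M * M / r * (INR n * r ^ n))%R with (M * (INR n * (r ^ n / r) * M))%R
        by (field; lra).
      assert (pow_pred : INR n * Cmod (Q y ^ (n - 1)) <= INR n * (r ^ n / r)).
      { destruct n as [|n]; [simpl; lra|]. replace (S n - 1)%nat with n by lia.
        replace (r ^ S n / r)%R with (r ^ n)%R by (simpl; field; lra).
        apply Rmult_le_compat_l; auto using Cmod_qpoch_base_pow_le. }
      apply Rmult_le_compat; auto using Cmod_ge_0; [|apply Rmult_le_compat];
        auto using Rmult_le_pos, Cmod_ge_0.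
  - assert (0 <= M * M / r) by (apply Rdiv_le_0_compat; nra). rewrite S_INR.
    assert (0 <= M * (INR n * r ^ n)) by
      (apply Rmult_le_pos; nra). nra.
Qed.

Lemma ex_Cderive_qpoch : exists l, is_Cderive (fun y => qpoch (A y) (Q y)) w l.
Proof.
  destruct (is_Cderive_inf_prod factor factor' w rho majorant) as [l [Dprod _]];
    auto using qpoch_majorant_summable, is_Cderive_qpoch_factor, qpoch_factor_near_1,
      Cmod_qpoch_factor'_le.
  exists l. eapply is_Cderive_ext; [|exact Dprod]. intros y. symmetry. apply qpoch_inf_prod.
Qed.

Lemma is_Cderive_qpoch_log : (forall n, factor n w <> 0) ->
  exists s, is_Cderive (fun y => qpoch (A y) (Q y)) w (qpoch (A w) (Q w) * s) /\
    is_Clim_seq (partial_sum (fun n => factor' n w / factor n w)) s.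
Proof.
  intros factors_neq.
  destruct (is_Cderive_inf_prod_log factor factor' w rho majorant) as [s [Dprod s_lim]];
    auto using qpoch_majorant_summable, is_Cderive_qpoch_factor, qpoch_factor_near_1,
      Cmod_qpoch_factor'_le.
  exists s. split; [|easy]. rewrite qpoch_inf_prod.
  eapply is_Cderive_ext; [|exact Dprod]. intros y. symmetry. apply qpoch_inf_prod.
Qed.

End QPochhammerDerivative.

(** * The period lattice *)

Definition in_lattice (z u : C) : Prop := exists m n : Z, u = IZR m * z + IZR n.

Lemma upper_neq_0 (z : C) : upper z -> z <> 0.
Proof. intros z_upper ->. unfold upper in z_upper. simpl in z_upper. lra. Qed.

Lemma upper_neg_inv (z : C) : upper z -> upper (- / z).
Proof.
  destruct z as [x y]. unfold upper. simpl. intros y_pos.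
  assert (0 < x * (x * 1) + y * (y * 1)) by nra.
  replace (- (- y / (x * (x * 1) + y * (y * 1))))%R with (y / (x * (x * 1) + y * (y * 1)))%R
    by (field; lra).
  now apply Rdiv_lt_0_compat.
Qed.

Lemma upper_scal (r : R) (z : C) : 0 < r -> upper z -> upper (r * z).
Proof. unfold upper. rewrite im_scal_l. apply Rmult_lt_0_compat. Qed.

Lemma in_lattice_ee (z u : C) (m : Z) : ee (u + IZR m * z) = 1 -> in_lattice z u.
Proof.
  intros E. destruct (ee_eq_1 _ E) as [n u_eq]. exists (- m)%Z, n.
  rewrite <- u_eq. Ccast. ring.
Qed.

Lemma off_lattice_ee (z u : C) : ~ in_lattice z u -> ee u <> 1.
Proof. intros off E. apply off, (in_lattice_ee z u 0). now rewrite Cmult_0_l, Cplus_0_r. Qed.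

Lemma in_lattice_0 (z : C) : in_lattice z 0.
Proof. exists 0%Z, 0%Z. ring. Qed.

Lemma off_lattice_neq_0 (z u : C) : ~ in_lattice z u -> u <> 0.
Proof. intros off ->. apply off, in_lattice_0. Qed.

Lemma off_lattice_shift (z u : C) (m n : Z) :
  ~ in_lattice z u -> ~ in_lattice z (u + IZR m * z + IZR n).
Proof.
  intros off [a [b E]]. apply off. exists (a - m)%Z, (b - n)%Z.
  replace u with (u + IZR m * z + IZR n - IZR m * z - IZR n) by ring. rewrite E. Ccast. ring.
Qed.

Lemma off_lattice_opp (z u : C) : ~ in_lattice z u -> ~ in_lattice z (- u).
Proof.
  intros off [a [b E]]. apply off. exists (- a)%Z, (- b)%Z.
  replace u with (- - u) by ring. rewrite E. Ccast. ring.
Qed.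

Lemma off_lattice_neg_inv (z u : C) :
  upper z -> ~ in_lattice z u -> ~ in_lattice (- / z) (u / z).
Proof.
  intros z_upper off [m [n E]]. apply off. exists n, (- m)%Z.
  pose proof (upper_neq_0 z z_upper).
  replace u with (u / z * z) by now field. rewrite E. Ccast. now field.
Qed.

Lemma off_lattice_half (z u : C) (m n : Z) :
  ~ in_lattice z u -> ~ in_lattice z ((u + IZR m * z + IZR n) / 2).
Proof.
  intros off [a [b E]]. apply off. exists (2 * a - m)%Z, (2 * b - n)%Z.
  replace u with ((u + IZR m * z + IZR n) / 2 * 2 - IZR m * z - IZR n) by field.
  rewrite E. Ccast. ring.
Qed.

Lemma lattice_coords_0 (z : C) (m : Z) (x : R) : upper z ->
  IZR m * z + x = 0 -> m = 0%Z /\ x = 0%R.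
Proof.
  intros z_upper E. assert (m_eq : m = 0%Z).
  { apply (f_equal Im) in E. rewrite im_plus, im_scal_l, !im_RtoC, Rplus_0_r in E.
    unfold upper in z_upper. apply eq_IZR. destruct (Rmult_integral _ _ E); [easy|lra]. }
  split; [easy|]. apply RtoC_inj. rewrite <- E, m_eq. ring.
Qed.

Lemma half_period_off_lattice (z : C) (m n : Z) : upper z ->
  (Z.odd m || Z.odd n = true)%bool -> ~ in_lattice z ((IZR m * z + IZR n) / 2).
Proof.
  intros z_upper odd [a [b E]].
  destruct (lattice_coords_0 z (m - 2 * a) (IZR (n - 2 * b)) z_upper) as [m_eq n_eq].
  { replace (IZR (m - 2 * a) * z + IZR (n - 2 * b)) with
      (2 * ((IZR m * z + IZR n) / 2 - (IZR a * z + IZR b))) by (Ccast; field).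
    rewrite E. ring. }
  apply eq_IZR in n_eq. replace m with (2 * a)%Z in odd by lia.
  replace n with (2 * b)%Z in odd by lia.
  rewrite !Z.odd_mul in odd. discriminate.
Qed.

Lemma real_off_lattice (z : C) (x : R) : upper z ->
  (forall n : Z, x <> IZR n) -> ~ in_lattice z x.
Proof.
  intros z_upper not_int [m [n E]].
  destruct (lattice_coords_0 z m (IZR n - x) z_upper) as [_ x_eq]; [rewrite RtoC_minus, E; ring|].
  apply (not_int n). lra.
Qed.

Lemma period_IZR_mult (T : Type) (f : C -> T) (a : C) : (forall u, f (u + a) = f u) ->
  forall (m : Z) (u : C), f (u + IZR m * a) = f u.
Proof.
  intros period. induction m as [|m IH|m IH] using Z.peano_ind; intros u.
  - f_equal. ring.
  - unfold Z.succ. rewrite <- (IH u), <- (period (u + IZR m * a)). f_equal. Ccast. ring.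
  - replace (Z.pred m) with (m - 1)%Z by lia.
    rewrite <- period, <- (IH u). f_equal. Ccast. ring.
Qed.

(** * The Klein form *)

Definition qprod (u z : C) : C := qpoch (ee (u + z)) (ee z).

Definition two_i_sin_pi (u : C) : C := ee (u / 2) - ee (- (u / 2)).

Definition klein (u z : C) : C :=
  two_i_sin_pi u * (qprod u z * qprod (- u) z) / (qprod 0 z * qprod 0 z).

Lemma qprod_factor (u z : C) (k : nat) :
  1 - ee (u + z) * ee z ^ k = 1 - ee (u + INR (S k) * z).
Proof. rewrite ee_pow, <- ee_plus. do 2 f_equal. Ccast. ring. Qed.

Definition qprod_dlog_term (u z : C) (k : nat) : C :=
  - (tpi * ee (u + INR (S k) * z)) / (1 - ee (u + INR (S k) * z)).

Lemma qprod_lim (u z : C) : upper z ->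
  is_Clim_seq (partial_prod (fun k => 1 - ee (u + INR (S k) * z))) (qprod u z).
Proof.
  intros z_upper. eapply is_Clim_seq_ext; [|apply qpoch_lim, Cmod_ee_lt_1, z_upper].
  intros n. apply partial_prod_ext. intros k _. apply qprod_factor.
Qed.

Lemma qprod_factor_neq_0 (u z : C) (k : nat) :
  ~ in_lattice z u -> 1 - ee (u + INR (S k) * z) <> 0.
Proof.
  intros off E. apply Ceq_minus in E. apply off, (in_lattice_ee z u (Z.of_nat (S k))).
  now rewrite <- INR_IZR_INZ.
Qed.

Lemma qprod_neq_0 (u z : C) : upper z -> ~ in_lattice z u -> qprod u z <> 0.
Proof.
  intros z_upper off. apply qpoch_neq_0; [now apply Cmod_ee_lt_1|].
  intros k. rewrite qprod_factor. now apply qprod_factor_neq_0.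
Qed.

Lemma qprod_0_neq_0 (z : C) : upper z -> qprod 0 z <> 0.
Proof.
  intros z_upper. apply qpoch_neq_0_of_lt; [|rewrite Cplus_0_l]; now apply Cmod_ee_lt_1.
Qed.
#[local] Hint Resolve upper_neq_0 qprod_0_neq_0 : Cneq.

Lemma qprod_S (u z : C) : upper z -> qprod u z = (1 - ee (u + z)) * qprod (u + z) z.
Proof.
  intros z_upper. unfold qprod. rewrite (qpoch_S (ee (u + z))) by now apply Cmod_ee_lt_1.
  now rewrite <- ee_plus.
Qed.

Lemma qprod_plus_1 (u z : C) : qprod (u + 1) z = qprod u z.
Proof.
  unfold qprod. replace (u + 1 + z) with (u + z + 1) by ring. now rewrite (ee_plus_IZR _ 1).
Qed.

Lemma qprod_minus_1 (u z : C) : qprod (u - 1) z = qprod u z.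
Proof. rewrite <- qprod_plus_1. f_equal. ring. Qed.

Lemma qprod_modulus_plus_IZR (u z : C) (k : Z) : qprod u (z + IZR k) = qprod u z.
Proof. unfold qprod. now rewrite Cplus_assoc, !ee_plus_IZR. Qed.

Lemma klein_modulus_plus_IZR (u z : C) (k : Z) : klein u (z + IZR k) = klein u z.
Proof. unfold klein. now rewrite !qprod_modulus_plus_IZR. Qed.

Lemma two_i_sin_pi_opp (u : C) : two_i_sin_pi (- u) = - two_i_sin_pi u.
Proof.
  unfold two_i_sin_pi. replace (- u / 2) with (- (u / 2)) by field.
  replace (- - (u / 2)) with (u / 2) by ring. ring.
Qed.

Lemma two_i_sin_pi_factor (u : C) : two_i_sin_pi u = ee (u / 2) * (1 - ee (- u)).
Proof.
  unfold two_i_sin_pi. replace (ee (- (u / 2))) with (ee (u / 2) * ee (- u)); [ring|].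
  rewrite <- ee_plus. f_equal. field.
Qed.

Lemma two_i_sin_pi_factor_opp (u : C) : two_i_sin_pi u = - ee (- (u / 2)) * (1 - ee u).
Proof.
  replace u with (- - u) at 1 by ring. rewrite two_i_sin_pi_opp, two_i_sin_pi_factor.
  replace (- u / 2) with (- (u / 2)) by field. replace (- - u) with u by ring. ring.
Qed.

Lemma two_i_sin_pi_neq_0 (u : C) : ee u <> 1 -> two_i_sin_pi u <> 0.
Proof.
  intros u_neq. rewrite two_i_sin_pi_factor, ee_opp. apply Cmult_neq_0; auto with Cneq.
  intros E. apply u_neq. replace (ee u) with (1 + ee u * (1 - / ee u)) by Cfield. rewrite E. ring.
Qed.

Lemma two_i_sin_pi_0 : two_i_sin_pi 0 = 0.
Proof. rewrite two_i_sin_pi_factor, Copp_0, ee_0. ring. Qed.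

Lemma two_i_sin_pi_plus_1 (u : C) : two_i_sin_pi (u + 1) = - two_i_sin_pi u.
Proof.
  rewrite !two_i_sin_pi_factor. replace ((u + 1) / 2) with (u / 2 + / 2) by field.
  replace (- (u + 1)) with (- u + IZR (-1)) by ring.
  rewrite ee_plus_half, ee_plus_IZR. ring.
Qed.

Lemma klein_opp (u z : C) : klein (- u) z = - klein u z.
Proof.
  unfold klein. rewrite two_i_sin_pi_opp. replace (- - u) with u by ring. unfold Cdiv. ring.
Qed.

Lemma klein_plus_1 (u z : C) : klein (u + 1) z = - klein u z.
Proof.
  unfold klein. rewrite two_i_sin_pi_plus_1, qprod_plus_1.
  replace (- (u + 1)) with (- u - 1) by ring. rewrite qprod_minus_1. unfold Cdiv. ring.
Qed.

Lemma klein_minus_1 (u z : C) : klein (u - 1) z = - klein u z.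
Proof. replace u with (u - 1 + 1) at 2 by ring. rewrite klein_plus_1. ring. Qed.

Lemma klein_plus_z (u z : C) : upper z -> klein (u + z) z = - ee (- u - z / 2) * klein u z.
Proof.
  intros z_upper. unfold klein. rewrite (qprod_S u z z_upper), (qprod_S (- (u + z)) z z_upper).
  replace (- (u + z) + z) with (- u) by ring. rewrite !two_i_sin_pi_factor.
  replace ((u + z) / 2) with (u / 2 + z / 2) by field.
  replace (- u - z / 2) with (- u + - (z / 2)) by ring.
  rewrite !ee_plus, !ee_opp, ee_plus.
  rewrite (ee_double u (u / 2)), (ee_double z (z / 2)) by field. Cfield.
Qed.

Lemma klein_minus_z (u z : C) : upper z -> klein (u - z) z = - ee (u - z / 2) * klein u z.
Proof.
  intros z_upper. replace u with (u - z + z) at 3 by ring. rewrite klein_plus_z by easy.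
  replace (- (u - z) - z / 2) with (- (u - z / 2)) by field. rewrite ee_opp. Cfield.
Qed.

Lemma klein_plus_IZR (u z : C) (n : Z) : klein (u + IZR n) z = ee (IZR n / 2) * klein u z.
Proof.
  revert u. induction n as [|n IH|n IH] using Z.peano_ind; intros u.
  - rewrite Cplus_0_r. replace (0 / 2) with (RtoC 0) by field. rewrite ee_0. ring.
  - unfold Z.succ. replace (u + IZR (n + 1)) with (u + 1 + IZR n) by (Ccast; ring).
    replace (IZR (n + 1) / 2) with (IZR n / 2 + / 2) by (Ccast; field).
    rewrite IH, klein_plus_1, ee_plus_half. ring.
  - replace (Z.pred n) with (n - 1)%Z by lia.
    replace (u + IZR (n - 1)) with (u - 1 + IZR n) by (Ccast; ring).
    replace (IZR n / 2) with (IZR (n - 1) / 2 + / 2) in IH by (Ccast; field).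
    rewrite IH, klein_minus_1, ee_plus_half. ring.
Qed.

Lemma klein_plus_IZR_z (u z : C) (m : Z) : upper z ->
  klein (u + IZR m * z) z = ee (IZR m / 2 - IZR m * u - IZR m * IZR m * z / 2) * klein u z.
Proof.
  intros z_upper. revert u. induction m as [|m IH|m IH] using Z.peano_ind; intros u.
  - replace (u + 0%R * z) with u by ring.
    replace (0 / 2 - 0 * u - 0 * 0 * z / 2) with (RtoC 0) by field. rewrite ee_0. ring.
  - unfold Z.succ. replace (u + IZR (m + 1) * z) with (u + z + IZR m * z) by (Ccast; ring).
    replace (IZR (m + 1) / 2 - IZR (m + 1) * u - IZR (m + 1) * IZR (m + 1) * z / 2) with
      (IZR m / 2 - IZR m * (u + z) - IZR m * IZR m * z / 2 + (- u - z / 2) + / 2)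
      by (Ccast; field).
    rewrite IH, klein_plus_z, ee_plus_half, ee_plus by easy. ring.
  - replace (Z.pred m) with (m - 1)%Z by lia.
    replace (u + IZR (m - 1) * z) with (u - z + IZR m * z) by (Ccast; ring).
    rewrite IH, klein_minus_z by easy.
    replace (IZR m / 2 - IZR m * (u - z) - IZR m * IZR m * z / 2)
      with (IZR (m - 1) / 2 - IZR (m - 1) * u - IZR (m - 1) * IZR (m - 1) * z / 2
        - (u - z / 2) + / 2) by (Ccast; field).
    rewrite ee_plus_half, ee_minus. Cfield.
Qed.

Lemma klein_lattice (u z : C) : upper z -> in_lattice z u -> klein u z = 0.
Proof.
  intros z_upper [m [n ->]]. rewrite klein_plus_IZR, <- (Cplus_0_l (IZR m * z)).
  rewrite klein_plus_IZR_z by easy. unfold klein. rewrite two_i_sin_pi_0. unfold Cdiv. ring.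
Qed.

Lemma klein_neq_0 (u z : C) : upper z -> ~ in_lattice z u -> klein u z <> 0.
Proof.
  intros z_upper off. pose proof (two_i_sin_pi_neq_0 u (off_lattice_ee z u off)).
  unfold klein, Cdiv. auto 10 using qprod_neq_0, off_lattice_opp with Cneq.
Qed.

Section KleinDerivative.

Variables (u z : C).
Hypothesis z_upper : upper z.

Let A (y : C) : C := ee (y + z).
Let A' (y : C) : C := tpi * ee (y + z).
Let M : R := ((1 + Cmod tpi) * exp (2 * PI * (Cmod (u + z) + 1)))%R.

Lemma Cmod_ee_plus_near (y : C) : Cmod (y - u) < 1 ->
  Cmod (ee (y + z)) <= exp (2 * PI * (Cmod (u + z) + 1)).
Proof.
  intros y_near. apply Cmod_ee_ball. now replace (y + z - (u + z)) with (y - u) by ring.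
Qed.

Lemma qpoch_arg_derive (y : C) : Cmod (y - u) < 1 -> is_Cderive A y (A' y).
Proof. intros _. unfold A, A'. Cderive. ring. Qed.

Lemma qpoch_arg_le (y : C) : Cmod (y - u) < 1 -> Cmod (A y) <= M.
Proof.
  intros y_near. pose proof (Cmod_ee_plus_near y y_near). pose proof (Cmod_ge_0 tpi).
  unfold M, A. rewrite <- (Rmult_1_l (Cmod _)). apply Rmult_le_compat; auto using Cmod_ge_0; lra.
Qed.

Lemma qpoch_arg_derive_le (y : C) : Cmod (y - u) < 1 -> Cmod (A' y) <= M.
Proof.
  intros y_near. pose proof (Cmod_ee_plus_near y y_near).
  unfold M, A'. rewrite Cmod_mult. apply Rmult_le_compat; auto using Cmod_ge_0; lra.
Qed.

Lemma Cmod_nome_bound : 0 < Cmod (ee z) < 1.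
Proof. split; [apply Cmod_gt_0, ee_neq_0|now apply Cmod_ee_lt_1]. Qed.

Lemma qpoch_arg_bound_nonneg : 0 <= M.
Proof. eapply Rle_trans; [apply Cmod_ge_0|apply (qpoch_arg_le u)]. rewrite Cmod_minus_diag. lra.
Qed.

Lemma ex_Cderive_qprod : exists l, is_Cderive (fun y => qprod y z) u l.
Proof.
  apply (ex_Cderive_qpoch A (fun _ => ee z) A' (fun _ => 0) u 1 M (Cmod (ee z)));
    auto using Cmod_nome_bound, qpoch_arg_derive, qpoch_arg_le, qpoch_arg_derive_le,
      is_Cderive_const; try lra.
  - intros y _. apply Rle_refl.
  - intros y _. rewrite Cmod_0. apply qpoch_arg_bound_nonneg.
Qed.

Lemma is_Cderive_qprod_log : ~ in_lattice z u ->
  exists s, is_Cderive (fun y => qprod y z) u (qprod u z * s) /\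
    is_Clim_seq (partial_sum (qprod_dlog_term u z)) s.
Proof.
  intros off.
  destruct (is_Cderive_qpoch_log A (fun _ => ee z) A' (fun _ => 0) u 1 M (Cmod (ee z)))
    as [s [Dqpoch s_lim]];
    auto using Cmod_nome_bound, qpoch_arg_derive, qpoch_arg_le, qpoch_arg_derive_le,
      is_Cderive_const; try lra.
  - intros y _. apply Rle_refl.
  - intros y _. rewrite Cmod_0. apply qpoch_arg_bound_nonneg.
  - intros n. unfold A. rewrite qprod_factor. now apply qprod_factor_neq_0.
  - exists s. split; [exact Dqpoch|].
    eapply is_Clim_seq_ext; [|exact s_lim]. intros n. apply partial_sum_ext. intros k _.
    unfold A, A', qprod_dlog_term. rewrite qprod_factor. f_equal.
    rewrite <- Cmult_assoc, ee_pow, <- ee_plus.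
    replace (u + INR (S k) * z) with (u + z + INR k * z) by (Ccast; ring). ring.
Qed.

End KleinDerivative.

Lemma ex_Cderive_klein (u z : C) : upper z -> exists l, is_Cderive (fun y => klein y z) u l.
Proof.
  intros z_upper. destruct (ex_Cderive_qprod u z z_upper) as [l Dqprod].
  destruct (ex_Cderive_qprod (- u) z z_upper) as [l' Dqprod'].
  pose proof (is_Cderive_comp (fun y => qprod y z) (fun y => - y) u l' _
    (is_Cderive_opp _ _ _ (is_Cderive_id u)) Dqprod') as Dqprod_opp.
  eexists. unfold klein, two_i_sin_pi. auto_Cderive.
Qed.

Lemma off_lattice_open (u z : C) : upper z -> ~ in_lattice z u ->
  exists rho : R, 0 < rho /\ forall y, Cmod (y - u) < rho -> ~ in_lattice z y.
Proof.
  intros z_upper off. destruct (ex_Cderive_klein u z z_upper) as [l Dklein].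
  pose proof (proj1 (Cmod_gt_0 _) (klein_neq_0 u z z_upper off)) as klein_pos.
  destruct (is_Cderive_continuous_eps _ _ _ Dklein _ klein_pos) as [rho [rho_pos close]].
  exists rho. split; [easy|]. intros y y_near y_lattice.
  specialize (close y y_near). cbv beta in close.
  rewrite (klein_lattice y z z_upper y_lattice), Cmod_minus_sym in close.
  replace (klein u z - 0) with (klein u z) in close by ring. lra.
Qed.

(** * Lattice sums *)

Fixpoint sym_sum (g : Z -> C) (N : nat) : C :=
  match N with
  | O => g 0%Z
  | S n => sym_sum g n + (g (Z.of_nat (S n)) + g (- Z.of_nat (S n))%Z)
  end.

Lemma sym_sum_ext (g h : Z -> C) (n : nat) : (forall m, g m = h m) -> sym_sum g n = sym_sum h n.
Proof. intros E. f_equal. now apply functional_extensionality. Qed.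

Lemma sym_sum_plus (g h : Z -> C) (n : nat) :
  sym_sum (fun m => g m + h m) n = sym_sum g n + sym_sum h n.
Proof. induction n as [|n IH]; cbn [sym_sum]; [easy|]. rewrite IH. ring. Qed.

Lemma sym_sum_scal (a : C) (g : Z -> C) (n : nat) : sym_sum (fun m => a * g m) n = a * sym_sum g n.
Proof. induction n as [|n IH]; cbn [sym_sum]; [easy|]. rewrite IH. ring. Qed.

Lemma sym_sum_shift (g : Z -> C) (n : nat) :
  sym_sum (fun m => g (m + 1)%Z) n = sym_sum g n + g (Z.of_nat (S n)) - g (- Z.of_nat n)%Z.
Proof.
  induction n as [|n IH]; cbn [sym_sum]; [simpl; ring|]. rewrite IH.
  replace (Z.of_nat (S n) + 1)%Z with (Z.of_nat (S (S n))) by lia.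
  replace (- Z.of_nat (S n) + 1)%Z with (- Z.of_nat n)%Z by lia. ring.
Qed.

Lemma sym_sum_even_odd (g : Z -> C) (n : nat) :
  sym_sum (fun m => g (2 * m)%Z) n + sym_sum (fun m => g (2 * m + 1)%Z) n
  = sym_sum g (2 * n) + g (Z.of_nat (S (2 * n))).
Proof.
  induction n as [|n IH]; [easy|].
  replace (2 * S n)%nat with (S (S (2 * n))) by lia. cbn [sym_sum].
  transitivity (sym_sum g (2 * n) + g (Z.of_nat (S (2 * n))) +
    (g (2 * Z.of_nat (S n))%Z + g (2 * - Z.of_nat (S n))%Z) +
    (g (2 * Z.of_nat (S n) + 1)%Z + g (2 * - Z.of_nat (S n) + 1)%Z)).
  { rewrite <- IH. ring. }
  replace (2 * Z.of_nat (S n))%Z with (Z.of_nat (S (S (2 * n)))) by lia.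
  replace (2 * - Z.of_nat (S n))%Z with (- Z.of_nat (S (S (2 * n))))%Z by lia.
  replace (Z.of_nat (S (S (2 * n))) + 1)%Z with (Z.of_nat (S (S (S (2 * n))))) by lia.
  replace (- Z.of_nat (S (S (2 * n))) + 1)%Z with (- Z.of_nat (S (2 * n)))%Z by lia.
  ring.
Qed.

Lemma is_Cderive_sym_sum (G G' : Z -> C -> C) (u : C) :
  (forall m, is_Cderive (G m) u (G' m u)) ->
  forall n, is_Cderive (fun y => sym_sum (fun m => G m y) n) u (sym_sum (fun m => G' m u) n).
Proof.
  intros DG n. induction n as [|n IH]; cbn [sym_sum]; [apply DG|].
  apply (is_Cderive_plus (fun y => sym_sum (fun m => G m y) n)); [easy|].
  now apply is_Cderive_plus.
Qed.

Definition lattice_term (c : C -> C) (u z : C) (m : Z) : C := c (ee (u + IZR m * z)).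

Definition lattice_sum (c : C -> C) (u z : C) : C := Clim_seq (sym_sum (lattice_term c u z)).

Definition decays (c : C -> C) : Prop :=
  forall s : R, s < 1 -> exists K : R, 0 <= K /\
  forall y : C, y <> 0 -> Cmod y <= s ->
  Cmod (c y) <= K * Cmod y /\ Cmod (c (/ y)%C) <= K * Cmod y.

Lemma Cmod_ee_plus_mult (u z : C) (n : nat) :
  Cmod (ee (u + INR n * z)) = (Cmod (ee u) * Cmod (ee z) ^ n)%R.
Proof. now rewrite ee_plus, <- ee_pow, Cmod_mult, Cmod_pow. Qed.

Lemma lattice_terms_le (c : C -> C) (s : R) : decays c -> s < 1 ->
  exists K : R, 0 <= K /\ forall (B : R) (u z : C) (n : nat),
  Cmod (ee u) <= B -> Cmod (ee (- u)) <= B -> B * Cmod (ee z) ^ n <= s ->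
  Cmod (lattice_term c u z (Z.of_nat n)) <= K * B * Cmod (ee z) ^ n /\
  Cmod (lattice_term c u z (- Z.of_nat n)) <= K * B * Cmod (ee z) ^ n.
Proof.
  intros c_decays s_lt. destruct (c_decays s s_lt) as [K [K_ge c_le]]. exists K. split; [easy|].
  intros B u z n u_le opp_le small.
  assert (pow_ge : 0 <= Cmod (ee z) ^ n) by apply pow_le, Cmod_ge_0.
  assert (arg_le : forall v, Cmod (ee v) <= B ->
    Cmod (ee (v + INR n * z)) <= B * Cmod (ee z) ^ n).
  { intros v v_le. rewrite Cmod_ee_plus_mult. now apply Rmult_le_compat_r. }
  unfold lattice_term.
  replace (u + IZR (Z.of_nat n) * z) with (u + INR n * z) by now rewrite INR_IZR_INZ.
  replace (u + IZR (- Z.of_nat n) * z) with (- (- u + INR n * z)) by (Ccast; ring).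
  rewrite ee_opp, !Rmult_assoc.
  pose proof (arg_le u u_le). pose proof (arg_le (- u) opp_le).
  split; eapply Rle_trans; try (apply c_le; [apply ee_neq_0|lra]); now apply Rmult_le_compat_l.
Qed.

Section LatticeSum.

Variable z : C.
Hypothesis z_upper : upper z.
Let q : R := Cmod (ee z).

Lemma Cmod_nome_lt_1 : 0 <= q < 1.
Proof. split; [apply Cmod_ge_0|now apply Cmod_ee_lt_1]. Qed.

Lemma sym_sum_increment_le (c : C -> C) (B s : R) (N : nat) :
  decays c -> 0 <= B -> s < 1 -> B * q ^ S N <= s ->
  exists a : nat -> R, ex_series a /\
  forall n u, (N <= n)%nat -> Cmod (ee u) <= B -> Cmod (ee (- u)) <= B ->
  Cmod (sym_sum (lattice_term c u z) (S n) - sym_sum (lattice_term c u z) n) <= a n.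
Proof.
  intros c_decays B_ge s_lt small. pose proof Cmod_nome_lt_1 as q_bound.
  destruct (lattice_terms_le c s c_decays s_lt) as [K [K_ge terms_le]].
  exists (fun n => (2 * K * B * q * q ^ n)%R). split; [now apply ex_series_geom_scal|].
  intros n u le_N u_le opp_le.
  replace (sym_sum (lattice_term c u z) (S n) - sym_sum (lattice_term c u z) n) with
    (lattice_term c u z (Z.of_nat (S n)) + lattice_term c u z (- Z.of_nat (S n)))
    by (cbn [sym_sum]; ring).
  destruct (terms_le B u z (S n)) as [pos_le neg_le]; try easy.
  { eapply Rle_trans; [|exact small]. apply Rmult_le_compat_l; [easy|].
    replace (S n) with (S N + (n - N))%nat by lia. rewrite pow_add.
    pose proof (pow_le q (S N) ltac:(lra)). pose proof (pow_le_1 q (n - N) ltac:(lra)).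
    fold q. nra. }
  eapply Rle_trans; [apply Cmod_triangle|]. fold q in pos_le, neg_le. cbn [pow] in *. lra.
Qed.

Lemma sym_sum_increment_le_ball (c : C -> C) (u : C) : decays c ->
  exists (a : nat -> R) N, ex_series a /\ forall n y, (N <= n)%nat -> Cmod (y - u) < 1 ->
  Cmod (sym_sum (lattice_term c y z) (S n) - sym_sum (lattice_term c y z) n) <= a n.
Proof.
  intros c_decays. set (B := exp (2 * PI * (Cmod u + 1))).
  assert (B_pos : 0 < B) by apply exp_pos.
  destruct (geom_eventually_lt B q (1 / 2) Cmod_nome_lt_1 ltac:(lra)) as [N small].
  destruct (sym_sum_increment_le c B (1 / 2) N) as [a [a_summable increment_le]]; try easy; try lra.
  { left. apply small. lia. }
  exists a, N. split; [easy|]. intros n y le_N y_near.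
  apply increment_le; [easy|now apply Cmod_ee_ball|].
  unfold B. rewrite <- (Cmod_opp u). apply Cmod_ee_ball.
  replace (- y - - u) with (- (y - u)) by ring. now rewrite Cmod_opp.
Qed.

Lemma lattice_sum_lim (c : C -> C) (u : C) : decays c ->
  is_Clim_seq (sym_sum (lattice_term c u z)) (lattice_sum c u z).
Proof.
  intros c_decays.
  destruct (sym_sum_increment_le_ball c u c_decays) as [a [N [a_summable increment_le]]].
  destruct (summable_increments_lim a a_summable (sym_sum (lattice_term c u z)) N) as [l l_lim].
  - intros n le_N. apply increment_le; [easy|]. rewrite Cmod_minus_diag. lra.
  - unfold lattice_sum. now rewrite (Clim_seq_eq _ l).
Qed.

Lemma lattice_terms_lim_0 (c : C -> C) (u : C) : decays c ->
  is_Clim_seq (fun n => lattice_term c u z (Z.of_nat n)) 0 /\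
  is_Clim_seq (fun n => lattice_term c u z (- Z.of_nat n)) 0.
Proof.
  intros c_decays. pose proof Cmod_nome_lt_1 as q_bound.
  destruct (lattice_terms_le c (1 / 2) c_decays ltac:(lra)) as [K [K_ge terms_le]].
  set (B := Rmax (Cmod (ee u)) (Cmod (ee (- u)))).
  destruct (geom_eventually_lt B q (1 / 2) q_bound ltac:(lra)) as [N small].
  assert (tails : forall n, Cmod (lattice_term c u z (Z.of_nat (N + n))) <= K * B * q ^ N * q ^ n /\
    Cmod (lattice_term c u z (- Z.of_nat (N + n))) <= K * B * q ^ N * q ^ n).
  { intros n. rewrite (Rmult_assoc (K * B)), <- pow_add.
    apply terms_le; [apply Rmax_l|apply Rmax_r|]. left. apply small. lia. }
  assert (tail_lim : is_lim_seq (fun n => K * B * q ^ N * q ^ n)%R 0).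
  { apply ex_series_lim_0. now apply ex_series_geom_scal. }
  split; apply (is_Clim_seq_incr_n _ _ N); (eapply is_Clim_seq_squeeze; [|exact tail_lim]);
    intros n; cbv beta; rewrite Cminus_0_r; [apply (proj1 (tails n))|apply (proj2 (tails n))].
Qed.

Lemma lattice_sum_plus_1 (c : C -> C) (u : C) : lattice_sum c (u + 1) z = lattice_sum c u z.
Proof.
  unfold lattice_sum. do 2 f_equal. apply functional_extensionality.
  intros m. unfold lattice_term. f_equal.
  replace (u + 1 + IZR m * z) with (u + IZR m * z + 1) by ring. apply (ee_plus_IZR _ 1).
Qed.

Lemma lattice_sum_plus_z (c : C -> C) (u : C) : decays c ->
  lattice_sum c (u + z) z = lattice_sum c u z.
Proof.
  intros c_decays. apply Clim_seq_eq.
  destruct (lattice_terms_lim_0 c u c_decays) as [pos_lim neg_lim].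
  apply (is_Clim_seq_eq _ (lattice_sum c u z + 0 - 0)); [ring|].
  eapply is_Clim_seq_ext; [|exact (is_Clim_seq_minus _ _ _ _ (is_Clim_seq_plus _ _ _ _
    (lattice_sum_lim c u c_decays) (is_Clim_seq_subseq _ _ S Nat.le_succ_diag_r pos_lim)) neg_lim)].
  intros n. cbv beta. rewrite <- sym_sum_shift. apply sym_sum_ext.
  intros m. unfold lattice_term. do 2 f_equal. Ccast. ring.
Qed.

Lemma is_Cderive_lattice_sum (c c' : C -> C) (u : C) : decays c' ->
  (forall y : C, y <> 0 -> y <> 1 -> is_Cderive c y (c' y / y)) ->
  (forall y, ~ in_lattice z y -> is_Clim_seq (sym_sum (lattice_term c y z)) (lattice_sum c y z)) ->
  ~ in_lattice z u -> is_Cderive (fun y => lattice_sum c y z) u (tpi * lattice_sum c' u z).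
Proof.
  intros c'_decays Dc sum_lim off.
  destruct (off_lattice_open u z z_upper off) as [rho [rho_pos off_near]].
  destruct (sym_sum_increment_le_ball c' u c'_decays) as [a [N [a_summable increment_le]]].
  apply (is_Cderive_lim (fun n y => sym_sum (lattice_term c y z) n)
    (fun n y => tpi * sym_sum (lattice_term c' y z) n) _ _ _ (Rmin rho 1)).
  - apply Rmin_pos; lra.
  - intros n y y_near. apply Rmin_Rgt_l in y_near as [y_near _]. rewrite <- sym_sum_scal.
    apply (is_Cderive_sym_sum (fun m y => lattice_term c y z m)
      (fun m y => tpi * lattice_term c' y z m)).
    intros m. unfold lattice_term. pose proof (ee_neq_0 (y + IZR m * z)).
    eapply is_Cderive_eq; [|apply (is_Cderive_comp c (fun y => ee (y + IZR m * z)))].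
    3:{ apply Dc; [easy|]. intros E. apply (off_near y y_near), (in_lattice_ee _ _ m E). }
    2:{ auto_Cderive. }
    cbv beta. now field.
  - intros eps eps_pos.
    assert (tpi_pos : 0 < Cmod tpi) by apply Cmod_gt_0, tpi_neq_0.
    destruct (summable_increments_unif_Cauchy a a_summable N (eps / Cmod tpi)) as [M close].
    { now apply Rdiv_lt_0_compat. }
    exists M. intros n m y le_n le_m y_near. apply Rmin_Rgt_l in y_near as [_ y_near].
    replace (tpi * sym_sum (lattice_term c' y z) n - tpi * sym_sum (lattice_term c' y z) m)
      with (tpi * (sym_sum (lattice_term c' y z) n - sym_sum (lattice_term c' y z) m)) by ring.
    rewrite Cmod_mult, Rmult_comm. apply Rlt_div_r; [easy|]. apply close; auto.
  - intros y y_near. apply Rmin_Rgt_l in y_near as [y_near _]. now apply sum_lim, off_near.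
  - now apply is_Clim_seq_scal, lattice_sum_lim.
Qed.

Lemma lattice_sum_near_0 (c : C -> C) : decays c ->
  exists rho M : R, 0 < rho /\
  forall w, Cmod w < rho -> Cmod (lattice_sum c w z - c (ee w)) <= M.
Proof.
  intros c_decays. pose proof PI_RGT_0 as PI_pos.
  assert (q_pos : 0 < q) by apply Cmod_gt_0, ee_neq_0. pose proof Cmod_nome_lt_1 as q_bound.
  set (s := ((1 + q) / 2)%R). set (B := (s / q)%R).
  assert (B_gt : 1 < B) by (apply Rlt_div_r; unfold s; lra).
  destruct (sym_sum_increment_le c B s 0) as [a [a_summable increment_le]];
    [easy|lra|unfold s; lra|unfold B; simpl; right; field; lra|].
  exists (ln B / (2 * PI))%R, (Series (fun j => a (0 + j)%nat)).
  split; [apply Rdiv_lt_0_compat; [rewrite <- ln_1; apply ln_increasing|]; lra|].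
  intros w w_near.
  assert (exp_le_B : exp (2 * PI * Cmod w) <= B).
  { rewrite <- (exp_ln B) by lra. apply exp_le.
    apply Rlt_div_r in w_near; [|lra]. lra. }
  replace (c (ee w)) with (sym_sum (lattice_term c w z) 0).
  2:{ cbn [sym_sum]. unfold lattice_term. do 2 f_equal. ring. }
  apply (is_Clim_seq_Cmod_le (fun n => sym_sum (lattice_term c w z) n
    - sym_sum (lattice_term c w z) 0) _ _ 0).
  - apply is_Clim_seq_minus; [now apply lattice_sum_lim|apply is_Clim_seq_const].
  - intros n _. apply (sum_increments_le_tail a a_summable _ 0 ) with (n := 0%nat) (k := n); [|lia].
    intros k _. apply increment_le; [lia| |]; (eapply Rle_trans; [apply Cmod_ee_le|]); [easy|].
    now rewrite Cmod_opp.
Qed.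

End LatticeSum.

(* [tpi * cot_kernel (ee u)] is the logarithmic derivative of [two_i_sin_pi u], and each of
   the other kernels is the image of the preceding one under [x d/dx]. *)
Definition cot_kernel (x : C) : C := (x + 1) / (2 * (x - 1)).
Definition cot_kernel' (x : C) : C := x * - (1) / (x - 1) ^ 2.
Definition cot_kernel'' (x : C) : C := x * (x + 1) / (x - 1) ^ 3.
Definition cot_kernel''' (x : C) : C := x * - (x * x + 4 * x + 1) / (x - 1) ^ 4.

Lemma is_Cderive_cot_kernel (y : C) :
  y <> 0 -> y <> 1 -> is_Cderive cot_kernel y (cot_kernel' y / y).
Proof.
  intros y_neq y_neq_1. apply Cminus_eq_contra in y_neq_1. unfold cot_kernel, cot_kernel'.
  Cderive. Cfield.
Qed.

Lemma is_Cderive_cot_kernel' (y : C) :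
  y <> 0 -> y <> 1 -> is_Cderive cot_kernel' y (cot_kernel'' y / y).
Proof.
  intros y_neq y_neq_1. apply Cminus_eq_contra in y_neq_1. unfold cot_kernel', cot_kernel''.
  Cderive. simpl. rewrite !RtoC_plus. Cfield.
Qed.

Lemma is_Cderive_cot_kernel'' (y : C) :
  y <> 0 -> y <> 1 -> is_Cderive cot_kernel'' y (cot_kernel''' y / y).
Proof.
  intros y_neq y_neq_1. apply Cminus_eq_contra in y_neq_1. unfold cot_kernel'', cot_kernel'''.
  Cderive. simpl. rewrite !RtoC_plus. Cfield.
Qed.

Lemma decays_rational (p : C -> C) (k : nat) (M : R) :
  (forall y : C, Cmod y <= 1 -> Cmod (p y) <= M) ->
  (forall y : C, y <> 0 -> y - 1 <> 0 ->
    Cmod (/ y * p (/ y) / (/ y - 1) ^ k) = Cmod (y * p y / (y - 1) ^ k)) ->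
  decays (fun y => y * p y / (y - 1) ^ k).
Proof.
  intros p_le sym s s_lt.
  assert (M_ge : 0 <= M).
  { eapply Rle_trans; [apply Cmod_ge_0|apply (p_le 0)]. rewrite Cmod_0. lra. }
  assert (pow_pos : 0 < (1 - s) ^ k) by (apply pow_lt; lra).
  exists (M / (1 - s) ^ k)%R. split; [now apply Rdiv_le_0_compat|].
  intros y y_neq y_le.
  assert (dist_ge : 1 - s <= Cmod (y - 1)).
  { pose proof (Cmod_triangle_rev 1 y) as triangle. rewrite Cmod_1 in triangle.
    rewrite Cmod_minus_sym. lra. }
  assert (y_neq_1 : y - 1 <> 0) by (apply Cmod_gt_0; lra).
  assert (bound : Cmod (y * p y / (y - 1) ^ k) <= M / (1 - s) ^ k * Cmod y).
  { rewrite Cmod_div, Cmod_mult, Cmod_pow by now apply Cpow_nz.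
    replace (M / (1 - s) ^ k * Cmod y)%R with (Cmod y * M / (1 - s) ^ k)%R by (field; lra).
    unfold Rdiv. apply Rmult_le_compat.
    - apply Rmult_le_pos; apply Cmod_ge_0.
    - left. apply Rinv_0_lt_compat, pow_lt. lra.
    - apply Rmult_le_compat_l; [apply Cmod_ge_0|]. apply p_le. lra.
    - apply Rinv_le_contravar; [easy|]. apply pow_incr. lra. }
  split; [easy|]. now rewrite sym.
Qed.

Lemma decays_cot_kernel' : decays cot_kernel'.
Proof.
  apply (decays_rational (fun _ => - (1)) 2 1).
  - intros y _. rewrite Cmod_m1. lra.
  - intros y y_neq y_neq_1. f_equal. simpl. field. auto using Cminus_neq_0_sym.
Qed.

Lemma decays_cot_kernel'' : decays cot_kernel''.
Proof.
  apply (decays_rational (fun x => x + 1) 3 2).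
  - intros y y_le. eapply Rle_trans; [apply Cmod_triangle|]. rewrite Cmod_1. lra.
  - intros y y_neq y_neq_1. rewrite <- (Cmod_opp (y * (y + 1) / (y - 1) ^ 3)).
    f_equal. simpl. field. auto using Cminus_neq_0_sym.
Qed.

Lemma decays_cot_kernel''' : decays cot_kernel'''.
Proof.
  apply (decays_rational (fun x => - (x * x + 4 * x + 1)) 4 6).
  - intros y y_le. rewrite Cmod_opp. eapply Rle_trans; [apply Cmod_triangle|].
    eapply Rle_trans; [apply Rplus_le_compat_r, Cmod_triangle|].
    rewrite !Cmod_mult, Cmod_1, Cmod_R, Rabs_pos_eq by lra. pose proof (Cmod_ge_0 y). nra.
  - intros y y_neq y_neq_1. f_equal. simpl. field. auto using Cminus_neq_0_sym.
Qed.

Lemma cot_kernel''_dup (y : C) : y * y <> 1 ->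
  cot_kernel'' y + cot_kernel'' (- y) = 8 * cot_kernel'' (y * y).
Proof.
  intros y_neq. apply Cminus_eq_contra in y_neq.
  assert (minus_neq : y - 1 <> 0).
  { intros E. apply y_neq. replace (y * y - 1) with ((y - 1) * (y + 1)) by ring. rewrite E. ring. }
  assert (plus_neq : - y - 1 <> 0).
  { intros E. apply y_neq. replace (y * y - 1) with ((1 - y) * (- y - 1)) by ring.
    rewrite E. ring. }
  unfold cot_kernel''. field. auto.
Qed.

Lemma lattice_term_cot_kernel''_dup (u z : C) (m k : Z) : ~ in_lattice z u ->
  lattice_term cot_kernel'' ((u + IZR k * z) / 2) z m
    + lattice_term cot_kernel'' ((u + IZR k * z + 1) / 2) z m
  = 8 * lattice_term cot_kernel'' u z (2 * m + k).
Proof.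
  intros off. unfold lattice_term. set (w := (u + IZR k * z) / 2 + IZR m * z).
  replace ((u + IZR k * z + 1) / 2 + IZR m * z) with (w + / 2) by (unfold w; field).
  assert (double : u + IZR (2 * m + k) * z = 2 * w) by (unfold w; Ccast; field).
  rewrite ee_plus_half, (ee_double _ w double). apply cot_kernel''_dup.
  rewrite <- (ee_double _ w double). intros E. apply off, (in_lattice_ee _ _ _ E).
Qed.

Lemma lattice_sum_cot_kernel''_dup (u z : C) : upper z -> ~ in_lattice z u ->
  lattice_sum cot_kernel'' (u / 2) z + lattice_sum cot_kernel'' ((u + 1) / 2) z
    + (lattice_sum cot_kernel'' ((u + z) / 2) z + lattice_sum cot_kernel'' ((u + z + 1) / 2) z)
  = 8 * lattice_sum cot_kernel'' u z.
Proof.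
  intros z_upper off.
  assert (sum_lim := fun v => lattice_sum_lim z z_upper cot_kernel'' v decays_cot_kernel'').
  destruct (lattice_terms_lim_0 z z_upper cot_kernel'' u decays_cot_kernel'') as [term_lim _].
  eapply is_Clim_seq_unique.
  { exact (is_Clim_seq_plus _ _ _ _ (is_Clim_seq_plus _ _ _ _ (sum_lim _) (sum_lim _))
      (is_Clim_seq_plus _ _ _ _ (sum_lim _) (sum_lim _))). }
  apply (is_Clim_seq_eq _ (8 * (lattice_sum cot_kernel'' u z + 0))); [ring|].
  eapply is_Clim_seq_ext; [|exact (is_Clim_seq_scal 8 _ _ (is_Clim_seq_plus _ _ _ _
    (is_Clim_seq_subseq _ _ (fun n => 2 * n)%nat ltac:(intros n; cbv beta; lia) (sum_lim u))
    (is_Clim_seq_subseq _ _ (fun n => S (2 * n)) ltac:(intros n; cbv beta; lia) term_lim)))].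
  intros n. cbv beta. rewrite <- sym_sum_even_odd.
  rewrite Cmult_plus_distr_l, <- !sym_sum_scal,
    <- (sym_sum_plus (lattice_term _ (u / 2) z)),
    <- (sym_sum_plus (lattice_term _ ((u + z) / 2) z)).
  f_equal; apply sym_sum_ext; intros m; symmetry.
  - rewrite <- (Z.add_0_r (2 * m)), <- lattice_term_cot_kernel''_dup by easy.
    now replace (u + 0%R * z) with u by ring.
  - rewrite <- lattice_term_cot_kernel''_dup by easy.
    now replace (u + 1%R * z) with (u + z) by ring.
Qed.

(** * The logarithmic derivatives of the Klein form *)

Lemma is_Cderive_two_i_sin_pi (u : C) : ee u <> 1 ->
  is_Cderive two_i_sin_pi u (two_i_sin_pi u * (tpi * cot_kernel (ee u))).
Proof.
  intros u_neq. apply Cminus_eq_contra in u_neq. unfold two_i_sin_pi, cot_kernel.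
  Cderive. rewrite !ee_opp. rewrite (ee_double u (u / 2)) in * by field. Cfield.
Qed.

Lemma sym_sum_cot_kernel (u z : C) (N : nat) : ~ in_lattice z u ->
  sym_sum (lattice_term cot_kernel u z) N = cot_kernel (ee u) +
  / tpi * (partial_sum (qprod_dlog_term u z) N - partial_sum (qprod_dlog_term (- u) z) N).
Proof.
  intros off. induction N as [|N IH]; cbn [sym_sum partial_sum].
  - unfold lattice_term. replace (u + 0%R * z) with u by ring. ring.
  - rewrite IH. unfold lattice_term, cot_kernel, qprod_dlog_term.
    pose proof (qprod_factor_neq_0 u z N off) as pos_neq.
    pose proof (qprod_factor_neq_0 (- u) z N (off_lattice_opp z u off)) as neg_neq.
    replace (u + IZR (Z.of_nat (S N)) * z) with (u + INR (S N) * z) by now rewrite INR_IZR_INZ.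
    replace (u + IZR (- Z.of_nat (S N)) * z) with (- (- u + INR (S N) * z))
      by (rewrite opp_IZR, <- INR_IZR_INZ, RtoC_opp; ring).
    pose proof (Cminus_neq_0_sym _ _ pos_neq).
    pose proof (Cminus_eq_contra _ _ (off_lattice_ee z u off)).
    rewrite ee_opp. Cfield.
Qed.

Lemma klein_log_derivative (u z : C) : upper z -> ~ in_lattice z u ->
  is_Clim_seq (sym_sum (lattice_term cot_kernel u z)) (lattice_sum cot_kernel u z) /\
  is_Cderive (fun y => klein y z) u (klein u z * (tpi * lattice_sum cot_kernel u z)).
Proof.
  intros z_upper off.
  destruct (is_Cderive_qprod_log u z z_upper off) as [s [Dpos pos_lim]].
  destruct (is_Cderive_qprod_log (- u) z z_upper (off_lattice_opp z u off)) as [s' [Dneg neg_lim]].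
  assert (sum_lim : is_Clim_seq (sym_sum (lattice_term cot_kernel u z))
    (cot_kernel (ee u) + / tpi * (s - s'))).
  { eapply is_Clim_seq_ext; [intros n; symmetry; now apply sym_sum_cot_kernel|].
    apply is_Clim_seq_plus; [apply is_Clim_seq_const|].
    now apply is_Clim_seq_scal, is_Clim_seq_minus. }
  unfold lattice_sum. rewrite (Clim_seq_eq _ _ sum_lim). split; [easy|].
  pose proof (is_Cderive_two_i_sin_pi u (off_lattice_ee z u off)) as Dsin.
  pose proof (is_Cderive_comp (fun y => qprod y z) (fun y => - y) u _ _
    (is_Cderive_opp _ _ _ (is_Cderive_id u)) Dneg) as Dneg_opp.
  unfold klein. Cderive. Cfield.
Qed.

Lemma is_Cderive_klein_0 (z : C) : upper z -> is_Cderive (fun y => klein y z) 0 tpi.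
Proof.
  intros z_upper. destruct (ex_Cderive_qprod 0 z z_upper) as [l Dqprod].
  assert (Dqprod_opp : is_Cderive (fun y => qprod (- y) z) 0 (l * - (1))).
  { apply (is_Cderive_comp (fun y => qprod y z) (fun y => - y)).
    - apply is_Cderive_opp, is_Cderive_id.
    - now rewrite Copp_0. }
  unfold klein, two_i_sin_pi. Cderive. replace (0 / 2) with (RtoC 0) by field.
  rewrite !Copp_0, !ee_0. Cfield.
Qed.

Lemma is_Cderive_lattice_sum_cot_kernel (z u : C) : upper z -> ~ in_lattice z u ->
  is_Cderive (fun y => lattice_sum cot_kernel y z) u (tpi * lattice_sum cot_kernel' u z).
Proof.
  intros z_upper off.
  apply is_Cderive_lattice_sum; auto using decays_cot_kernel', is_Cderive_cot_kernel.
  intros y y_off. now apply klein_log_derivative.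
Qed.

Lemma is_Cderive_lattice_sum_cot_kernel' (z u : C) : upper z -> ~ in_lattice z u ->
  is_Cderive (fun y => lattice_sum cot_kernel' y z) u (tpi * lattice_sum cot_kernel'' u z).
Proof.
  intros z_upper off.
  apply is_Cderive_lattice_sum; auto using decays_cot_kernel'', is_Cderive_cot_kernel'.
  intros y _. apply lattice_sum_lim; auto using decays_cot_kernel'.
Qed.

Lemma is_Cderive_lattice_sum_cot_kernel'' (z u : C) : upper z -> ~ in_lattice z u ->
  is_Cderive (fun y => lattice_sum cot_kernel'' y z) u (tpi * lattice_sum cot_kernel''' u z).
Proof.
  intros z_upper off.
  apply is_Cderive_lattice_sum; auto using decays_cot_kernel''', is_Cderive_cot_kernel''.
  intros y _. apply lattice_sum_lim; auto using decays_cot_kernel''.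
Qed.

Lemma is_Cderive_lattice_sum_neg_inv (c c' : C -> C) :
  (forall z u, upper z -> ~ in_lattice z u ->
    is_Cderive (fun y => lattice_sum c y z) u (tpi * lattice_sum c' u z)) ->
  forall z u, upper z -> ~ in_lattice z u ->
  is_Cderive (fun y => lattice_sum c (y / z) (- / z)) u (tpi * lattice_sum c' (u / z) (- / z) / z).
Proof.
  intros Dsum z u z_upper off.
  apply is_Cderive_eq with (tpi * lattice_sum c' (u / z) (- / z) * (1 / z)).
  { unfold Cdiv. ring. }
  apply (is_Cderive_comp (fun v => lattice_sum c v (- / z)) (fun y => y / z)).
  - apply is_Cderive_div_const, is_Cderive_id.
  - apply Dsum; [now apply upper_neg_inv|now apply off_lattice_neg_inv].
Qed.

(** * Bounded functions on the torus *)

Lemma contracting_recursion_le (a : nat -> R) (k M : R) : 1 < k ->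
  (forall n, a n <= a (S n) / k + M) -> is_lim_seq (fun n => a n / k ^ n)%R 0 ->
  a 0%nat <= M * (k / (k - 1)).
Proof.
  intros k_gt step a_lim.
  assert (unrolled : forall n, a 0%nat <= a n / k ^ n + M * (k / (k - 1)) * (1 - / k ^ n)).
  { induction n as [|n IH]; [cbn [pow]; unfold Rdiv; rewrite Rinv_1; lra|].
    assert (pow_pos : 0 < / k ^ n) by (apply Rinv_0_lt_compat, pow_lt; lra).
    eapply Rle_trans; [exact IH|].
    apply Rle_trans with ((a (S n) / k + M) * / k ^ n + M * (k / (k - 1)) * (1 - / k ^ n))%R.
    - apply Rplus_le_compat_r, Rmult_le_compat_r; [lra|apply step].
    - right. simpl. field. repeat split; try apply pow_nonzero; lra. }
  assert (pow_lim : is_lim_seq (fun n => / k ^ n)%R 0).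
  { apply is_lim_seq_ext with (fun n => (/ k) ^ n)%R; [intros n; apply pow_inv|].
    apply is_lim_seq_geom. rewrite Rabs_inv, Rabs_pos_eq by lra.
    rewrite <- Rinv_1. apply Rinv_lt_contravar; lra. }
  apply (is_lim_seq_le (fun _ => a 0%nat) _ (a 0%nat) (M * (k / (k - 1)))%R unrolled).
  - apply is_lim_seq_const.
  - replace (Finite (M * (k / (k - 1)))) with (Finite (0 + M * (k / (k - 1)) * (1 - 0)))
      by (f_equal; ring).
    apply is_lim_seq_plus'; [easy|].
    apply (is_lim_seq_scal_l _ (M * (k / (k - 1))) (Finite (1 - 0))).
    apply is_lim_seq_minus'; [apply is_lim_seq_const|easy].
Qed.

Lemma fundamental_domain (z u : C) : upper z -> exists (m n : Z) (s t : R),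
  0 <= s < 1 /\ 0 <= t < 1 /\ u + IZR m * z + IZR n = s * z + t.
Proof.
  intros z_upper. set (s := (Im u / Im z)%R). set (t := (Re u - s * Re z)%R).
  assert (coords : u = s * z + t).
  { unfold upper in z_upper. destruct u as [a b], z as [x y]. unfold t, s.
    unfold Cplus, Cmult, RtoC, Re, Im in *; simpl in *. f_equal; field; lra. }
  exists (- Int_part s)%Z, (- Int_part t)%Z, (s - IZR (Int_part s))%R, (t - IZR (Int_part t))%R.
  destruct (base_Int_part s). destruct (base_Int_part t).
  split; [lra|]. split; [lra|]. rewrite coords. Ccast. ring.
Qed.

Section PeriodicBounded.

Variables (z : C) (D : C -> Prop) (f : C -> R).
Hypothesis z_upper : upper z.
Hypothesis D_period : forall u (m n : Z), D u -> D (u + IZR m * z + IZR n).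
Hypothesis f_period : forall u (m n : Z), f (u + IZR m * z + IZR n) = f u.
Hypothesis f_locally_bounded : forall v, exists rho M : R, 0 < rho /\
  forall y, Cmod (y - v) < rho -> D y -> f y <= M.

(* One number serves both as radius and as inverse bound, so that
   the compactness of the square of coordinates yields a uniform bound. *)
Lemma locally_bounded_gauge (s t : R) :
  exists d : posreal, forall s' t' : R, Rabs (s' - s) < d -> Rabs (t' - t) < d ->
  D (s' * z + t') -> f (s' * z + t') <= / d.
Proof.
  destruct (f_locally_bounded (s * z + t)) as [rho [M [rho_pos f_le]]].
  pose proof (Cmod_ge_0 z) as z_ge. pose proof (Rle_abs M) as M_le. pose proof (Rabs_pos M).
  assert (d_pos : 0 < Rmin (rho / (Cmod z + 1)) (/ (Rabs M + 1))).
  { apply Rmin_pos; [apply Rdiv_lt_0_compat; lra|apply Rinv_0_lt_compat; lra]. }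
  exists (mkposreal _ d_pos). simpl. intros s' t' s_near t_near D'.
  apply Rmin_Rgt_l in s_near as [s_near _]. apply Rmin_Rgt_l in t_near as [t_near _].
  apply Rle_trans with M.
  - apply f_le; [|easy].
    replace (s' * z + t' - (s * z + t)) with (RtoC (s' - s) * z + RtoC (t' - t)) by (Ccast; ring).
    eapply Rle_lt_trans; [apply Cmod_triangle|]. rewrite Cmod_mult, !Cmod_R.
    apply Rle_lt_trans with (rho / (Cmod z + 1) * Cmod z + Rabs (t' - t))%R.
    { apply Rplus_le_compat_r, Rmult_le_compat_r; lra. }
    replace rho with (rho / (Cmod z + 1) * Cmod z + rho / (Cmod z + 1))%R at 2 by (field; lra).
    lra.
  - apply Rle_trans with (Rabs M + 1)%R; [lra|]. rewrite <- (Rinv_inv (Rabs M + 1)) at 1.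
    apply Rinv_le_contravar; [easy|apply Rmin_r].
Qed.

Lemma periodic_locally_bounded_bounded : exists M : R, forall u, D u -> f u <= M.
Proof.
  set (delta := fun s t : R => proj1_sig
    (constructive_indefinite_description _ (locally_bounded_gauge s t))).
  destruct (compactness_value_2d 0 1 0 1 delta) as [d cover].
  exists (/ d)%R. intros u Du.
  destruct (fundamental_domain z u z_upper) as [m [n [s [t [s_bound [t_bound E]]]]]].
  apply (D_period u m n) in Du. rewrite <- (f_period u m n). rewrite E in Du |- *.
  specialize (cover s t ltac:(lra) ltac:(lra)). apply NNPP in cover.
  destruct cover as [a [b [_ [_ [s_near [t_near d_le]]]]]].
  unfold delta in s_near, t_near, d_le.
  destruct (constructive_indefinite_description _ (locally_bounded_gauge a b)) as [e f_le].
  simpl in *. eapply Rle_trans; [now apply f_le|].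
  apply Rinv_le_contravar; [apply cond_pos|easy].
Qed.

End PeriodicBounded.

Lemma is_Clim_seq_halving (w : C) : is_Clim_seq (fun n => w / 2 ^ n) 0.
Proof.
  apply is_Clim_seq_squeeze with (fun n => Cmod w * (1 / 2) ^ n)%R.
  - intros n. right. rewrite Cminus_0_r, Cmod_div, Cmod_pow by auto with Cneq.
    rewrite Cmod_R, Rabs_pos_eq by lra. unfold Rdiv. now rewrite Rmult_1_l, pow_inv.
  - apply ex_series_lim_0, ex_series_geom_scal. lra.
Qed.

Lemma halving_S (w : C) (n : nat) : w / 2 ^ S n = w / 2 ^ n / 2.
Proof. rewrite Cpow_S. Cfield. Qed.

Lemma Cmod_halving_le (w : C) (n : nat) : Cmod (w / 2 ^ n) <= Cmod w.
Proof.
  induction n as [|n IH]; [simpl; replace (w / 1) with w by field; lra|].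
  rewrite halving_S, Cmod_div, Cmod_R, Rabs_pos_eq by (lra || auto with Cneq).
  pose proof (Cmod_ge_0 (w / 2 ^ n)). lra.
Qed.

Lemma off_lattice_halving (w z : C) : ~ in_lattice z w -> forall n, ~ in_lattice z (w / 2 ^ n).
Proof.
  intros off n. induction n as [|n IH].
  - simpl. now replace (w / 1) with w by field.
  - rewrite halving_S. apply (off_lattice_half z _ 0 0) in IH.
    now replace (w / 2 ^ n + 0%R * z + 0%R) with (w / 2 ^ n) in IH by ring.
Qed.

Section TorusDuplication.

Variables (z : C) (F : C -> C).
Hypothesis z_upper : upper z.
Hypothesis F_period : forall u (m n : Z), F (u + IZR m * z + IZR n) = F u.
Hypothesis F_dup : forall u, ~ in_lattice z u ->
  F (u / 2) + F ((u + 1) / 2) + F ((u + z) / 2) + F ((u + z + 1) / 2) = 8 * F u.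
Hypothesis F_locally_bounded : forall u, ~ in_lattice z u ->
  exists rho M : R, 0 < rho /\ forall y, Cmod (y - u) < rho -> Cmod (F y) <= M.
Hypothesis F_pole : forall w : nat -> C, is_Clim_seq w 0 -> (forall n, ~ in_lattice z (w n)) ->
  is_Clim_seq (fun n => w n ^ 3 * F (w n)) 0.

Lemma torus_dup_le (u : C) : ~ in_lattice z u ->
  Cmod (F u) <= (Cmod (F (u / 2)%C) + Cmod (F ((u + 1) / 2)%C) +
     Cmod (F ((u + z) / 2)%C) + Cmod (F ((u + z + 1) / 2)%C)) / 8.
Proof.
  intros off. pose proof (F_dup u off) as dup. apply (f_equal Cmod) in dup.
  rewrite Cmod_mult, (Cmod_R 8), (Rabs_pos_eq 8) in dup by lra.
  set (a := F (u / 2)) in *. set (b := F ((u + 1) / 2)) in *.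
  set (c := F ((u + z) / 2)) in *. set (d := F ((u + z + 1) / 2)) in *.
  pose proof (Cmod_triangle (a + b + c) d). pose proof (Cmod_triangle (a + b) c).
  pose proof (Cmod_triangle a b). lra.
Qed.

Lemma torus_dup_halving_le : exists rho M : R, 0 < rho /\
  forall w, Cmod w < rho -> ~ in_lattice z w ->
  Cmod (F w) <= Cmod (F (w / 2)%C) / 8 + M.
Proof.
  assert (bounded_at : forall m n : Z, (Z.odd m || Z.odd n = true)%bool ->
    exists rho M : R, 0 < rho /\ forall w, Cmod w < rho ->
    Cmod (F ((w + (IZR m * z + IZR n)) / 2)%C) <= M).
  { intros m n odd.
    destruct (F_locally_bounded _ (half_period_off_lattice z m n z_upper odd))
      as [rho [M [rho_pos bound]]].
    exists rho, M. split; [easy|]. intros w w_lt. apply bound.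
    replace ((w + (IZR m * z + IZR n)) / 2 - (IZR m * z + IZR n) / 2) with (w / 2) by field.
    rewrite Cmod_div, Cmod_R, Rabs_pos_eq by (lra || auto with Cneq).
    lra. }
  destruct (bounded_at 0%Z 1%Z eq_refl) as [rho_1 [M_1 [rho_1_pos bound_1]]].
  destruct (bounded_at 1%Z 0%Z eq_refl) as [rho_z [M_z [rho_z_pos bound_z]]].
  destruct (bounded_at 1%Z 1%Z eq_refl) as [rho_z1 [M_z1 [rho_z1_pos bound_z1]]].
  exists (Rmin rho_1 (Rmin rho_z rho_z1)), ((M_1 + M_z + M_z1) / 8)%R.
  split; [repeat apply Rmin_pos; easy|]. intros w w_lt off.
  apply Rmin_Rgt_l in w_lt as [w_lt_1 w_lt]. apply Rmin_Rgt_l in w_lt as [w_lt_z w_lt_z1].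
  specialize (bound_1 w w_lt_1). specialize (bound_z w w_lt_z). specialize (bound_z1 w w_lt_z1).
  pose proof (torus_dup_le w off) as dup.
  replace (w + (0%R * z + 1%R)) with (w + 1) in bound_1 by ring.
  replace (w + (1%R * z + 0%R)) with (w + z) in bound_z by ring.
  replace (w + (1%R * z + 1%R)) with (w + z + 1) in bound_z1 by ring. lra.
Qed.

Lemma torus_dup_halving_lim (w : C) : ~ in_lattice z w ->
  is_lim_seq (fun n => Cmod (F (w / 2 ^ n)%C) / 8 ^ n)%R 0.
Proof.
  intros off. pose proof (off_lattice_neq_0 z w off) as w_neq.
  pose proof (F_pole _ (is_Clim_seq_halving w) (off_lattice_halving w z off)) as pole.
  pose proof (proj1 (is_Clim_seq_eps _ _) (is_Clim_seq_div_const (w ^ 3) _ _ pole)) as small.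
  apply is_lim_seq_spec. intros eps.
  destruct (small eps (cond_pos eps)) as [N small_N]. exists N. intros n le_N.
  specialize (small_N n le_N). eapply Rle_lt_trans; [|exact small_N]. right.
  rewrite Rminus_0_r, Rabs_pos_eq
    by (apply Rdiv_le_0_compat; [apply Cmod_ge_0|apply pow_lt; lra]).
  rewrite <- (Rabs_pos_eq 8), <- (Cmod_R 8), <- Cmod_pow, <- Cmod_div by (lra || auto with Cneq).
  f_equal. replace (RtoC 8) with (2 ^ 3) by (simpl; rewrite <- !RtoC_mult; f_equal; ring).
  rewrite <- Cpow_mult_r, Nat.mul_comm, Cpow_mult_r. Cfield.
Qed.

Lemma torus_dup_bounded_near_0 : exists rho M : R, 0 < rho /\
  forall w, Cmod w < rho -> ~ in_lattice z w -> Cmod (F w) <= M.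
Proof.
  destruct torus_dup_halving_le as [rho [M [rho_pos step]]].
  exists rho, (M * (8 / (8 - 1)))%R. split; [easy|]. intros w w_lt off.
  pose proof (contracting_recursion_le (fun n => Cmod (F (w / 2 ^ n)%C)) 8 M) as le.
  cbv beta in le. replace (w / 2 ^ 0) with w in le by (simpl; field).
  apply le; [lra| |now apply torus_dup_halving_lim].
  intros n. rewrite halving_S. apply step; [|now apply off_lattice_halving].
  eapply Rle_lt_trans; [apply Cmod_halving_le|easy].
Qed.

Lemma torus_dup_bounded : exists M : R, forall u, ~ in_lattice z u -> Cmod (F u) <= M.
Proof.
  apply (periodic_locally_bounded_bounded z (fun u => ~ in_lattice z u)
    (fun u => Cmod (F u))).
  - exact z_upper.
  - intros u m n. apply off_lattice_shift.
  - intros u m n. now rewrite F_period.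
  - intros v. destruct (classic (in_lattice z v)) as [[m [n v_eq]]|off].
    + destruct torus_dup_bounded_near_0 as [rho [M [rho_pos bound]]].
      exists rho, M. split; [easy|]. intros y y_near y_off.
      rewrite <- (F_period y (- m) (- n)). apply bound; [|now apply off_lattice_shift].
      rewrite v_eq in y_near. Ccast.
      now replace (y + - IZR m * z + - IZR n) with (y - (IZR m * z + IZR n)) by ring.
    + destruct (F_locally_bounded v off) as [rho [M [rho_pos bound]]].
      exists rho, M. auto.
Qed.

(* Duplication halves any bound, as it expresses [F] as an eighth of four values. *)
Lemma torus_dup_eq_0 (u : C) : ~ in_lattice z u -> F u = 0.
Proof.
  intros off. destruct torus_dup_bounded as [M bound].
  assert (bound_n : forall n v, ~ in_lattice z v -> Cmod (F v) <= M * (1 / 2) ^ n).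
  { induction n as [|n IH]; intros v v_off; [simpl; rewrite Rmult_1_r; auto|].
    assert (halves : forall m k : Z,
      Cmod (F ((v + IZR m * z + IZR k) / 2)%C) <= M * (1 / 2) ^ n).
    { intros m k. now apply IH, off_lattice_half. }
    pose proof (halves 0%Z 0%Z) as half0. pose proof (halves 0%Z 1%Z) as half1.
    pose proof (halves 1%Z 0%Z) as halfz. pose proof (halves 1%Z 1%Z) as halfz1.
    replace (v + 0%R * z + 0%R) with v in half0 by ring.
    replace (v + 0%R * z + 1%R) with (v + 1) in half1 by ring.
    replace (v + 1%R * z + 0%R) with (v + z) in halfz by ring.
    replace (v + 1%R * z + 1%R) with (v + z + 1) in halfz1 by ring.
    pose proof (torus_dup_le v v_off). simpl. lra. }
  apply Cmod_eq_0, Rle_antisym; [|apply Cmod_ge_0].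
  apply Rle_plus_epsilon. intros eps eps_pos. rewrite Rplus_0_l.
  destruct (geom_eventually_lt M (1 / 2) eps ltac:(lra) eps_pos) as [N small].
  left. eapply Rle_lt_trans; [apply (bound_n N u off)|now apply small].
Qed.

End TorusDuplication.

(** * The transformation of the third logarithmic derivative *)

Lemma lattice_sum_cot_kernel''_pole (z : C) (w : nat -> C) :
  upper z -> is_Clim_seq w 0 -> (forall n, ~ in_lattice z (w n)) ->
  is_Clim_seq (fun n => w n ^ 3 * lattice_sum cot_kernel'' (w n) z) (2 / tpi ^ 3).
Proof.
  intros z_upper w_lim off. assert (w_neq := fun n => off_lattice_neq_0 z (w n) (off n)).
  destruct (lattice_sum_near_0 z z_upper cot_kernel'' decays_cot_kernel'')
    as [rho [M [rho_pos rest_le]]].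
  pose proof (is_Clim_seq_ee_0 w w_lim) as ee_lim.
  assert (quotient_lim : is_Clim_seq (fun n => (ee (w n) - 1) / w n) tpi).
  { apply (is_Clim_seq_eq _ (tpi * ee 0 * 1)); [rewrite ee_0; ring|].
    eapply is_Clim_seq_ext; [|apply (is_Cderive_quotient_lim ee 0 _ w); [|easy|easy]].
    - intros n. cbv beta. now rewrite Cplus_0_l, ee_0.
    - apply (is_Cderive_ee (fun y => y)), is_Cderive_id. }
  pose proof (is_Clim_seq_mult _ _ _ _ (is_Clim_seq_mult _ _ _ _ ee_lim
    (is_Clim_seq_plus _ _ _ _ ee_lim (is_Clim_seq_const 1)))
    (is_Clim_seq_pow _ _ 3
      (is_Cderive_lim_seq Cinv _ _ _ (is_Cderive_Cinv _ tpi_neq_0) quotient_lim)))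
    as main_lim.
  assert (rest_lim : is_Clim_seq
    (fun n => w n ^ 3 * (lattice_sum cot_kernel'' (w n) z - cot_kernel'' (ee (w n)))) 0).
  { apply (is_Clim_seq_mult_bounded _ _ M).
    - apply (is_Clim_seq_eq _ (0 ^ 3)); [ring|]. now apply is_Clim_seq_pow.
    - destruct (proj1 (is_Clim_seq_eps _ _) w_lim rho rho_pos) as [N near_0].
      exists N. intros n le_N. specialize (near_0 n le_N).
      rewrite Cminus_0_r in near_0. now apply rest_le. }
  apply (is_Clim_seq_eq _ (1 * (1 + 1) * (/ tpi) ^ 3 + 0)); [Cfield|].
  eapply is_Clim_seq_ext; [|exact (is_Clim_seq_plus _ _ _ _ main_lim rest_lim)].
  intros n. cbv beta. unfold cot_kernel''.
  pose proof (Cminus_eq_contra _ _ (off_lattice_ee z _ (off n))). Cfield.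
Qed.

Definition S_defect (z u : C) : C :=
  lattice_sum cot_kernel'' (u / z) (- / z) / z ^ 3 - lattice_sum cot_kernel'' u z.

Section SDefect.

Variable z : C.
Hypothesis z_upper : upper z.

Let z_neq : z <> 0 := upper_neq_0 z z_upper.
Let neg_inv_upper : upper (- / z) := upper_neg_inv z z_upper.

Lemma S_defect_plus_1 (u : C) : S_defect z (u + 1) = S_defect z u.
Proof.
  unfold S_defect. rewrite lattice_sum_plus_1. do 2 f_equal.
  rewrite <- (lattice_sum_plus_z _ neg_inv_upper _ ((u + 1) / z)) by apply decays_cot_kernel''.
  f_equal. now field.
Qed.

Lemma S_defect_plus_z (u : C) : S_defect z (u + z) = S_defect z u.
Proof.
  unfold S_defect. rewrite (lattice_sum_plus_z z z_upper) by apply decays_cot_kernel''.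
  do 2 f_equal. rewrite <- (lattice_sum_plus_1 (- / z) cot_kernel'' (u / z)). f_equal. now field.
Qed.

Lemma S_defect_period (u : C) (m n : Z) : S_defect z (u + IZR m * z + IZR n) = S_defect z u.
Proof.
  rewrite <- (Cmult_1_r (IZR n)), (period_IZR_mult _ (S_defect z) 1 S_defect_plus_1).
  apply (period_IZR_mult _ (S_defect z) z S_defect_plus_z).
Qed.

Lemma S_defect_dup (u : C) : ~ in_lattice z u ->
  S_defect z (u / 2) + S_defect z ((u + 1) / 2) + S_defect z ((u + z) / 2)
    + S_defect z ((u + z + 1) / 2) = 8 * S_defect z u.
Proof.
  intros off.
  pose proof (lattice_sum_cot_kernel''_dup u z z_upper off) as dup.
  pose proof (lattice_sum_cot_kernel''_dup (u / z) (- / z) neg_inv_upper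
    (off_lattice_neg_inv z u z_upper off)) as dup_S.
  assert (shift : forall v, lattice_sum cot_kernel'' v (- / z) =
    lattice_sum cot_kernel'' (v + - / z) (- / z)).
  { intros v. symmetry. apply lattice_sum_plus_z; auto using decays_cot_kernel''. }
  unfold S_defect. rewrite (shift ((u + 1) / 2 / z)), (shift ((u + z + 1) / 2 / z)).
  replace (u / 2 / z) with (u / z / 2) by now field.
  replace ((u + 1) / 2 / z + - / z) with ((u / z + - / z) / 2) by now field.
  replace ((u + z) / 2 / z) with ((u / z + 1) / 2) by now field.
  replace ((u + z + 1) / 2 / z + - / z) with ((u / z + - / z + 1) / 2) by now field.
  transitivity (8 * lattice_sum cot_kernel'' (u / z) (- / z) / z ^ 3
    - 8 * lattice_sum cot_kernel'' u z); [|now field].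
  rewrite <- dup, <- dup_S. now field.
Qed.

Lemma S_defect_locally_bounded (u : C) : ~ in_lattice z u ->
  exists rho M : R, 0 < rho /\ forall y, Cmod (y - u) < rho -> Cmod (S_defect z y) <= M.
Proof.
  intros off.
  assert (DS : exists l, is_Cderive (S_defect z) u l).
  { eexists. apply is_Cderive_minus; [apply is_Cderive_div_const|].
    - apply (is_Cderive_lattice_sum_neg_inv _ _ is_Cderive_lattice_sum_cot_kernel''); easy.
    - now apply is_Cderive_lattice_sum_cot_kernel''. }
  destruct DS as [l DS].
  destruct (is_Cderive_continuous_eps _ _ _ DS 1 ltac:(lra)) as [d [d_pos close]].
  exists d, (Cmod (S_defect z u) + 1)%R. split; [easy|]. intros y y_near.
  specialize (close y y_near). pose proof (Cmod_triangle_rev (S_defect z y) (S_defect z u)). lra.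
Qed.

Lemma S_defect_pole (w : nat -> C) : is_Clim_seq w 0 -> (forall n, ~ in_lattice z (w n)) ->
  is_Clim_seq (fun n => w n ^ 3 * S_defect z (w n)) 0.
Proof.
  intros w_lim off.
  assert (scaled_lim : is_Clim_seq (fun n => w n / z) 0).
  { apply (is_Clim_seq_eq _ (0 / z)); [now field|]. now apply is_Clim_seq_div_const. }
  apply (is_Clim_seq_eq _ (2 / tpi ^ 3 - 2 / tpi ^ 3)); [ring|].
  eapply is_Clim_seq_ext; [|exact (is_Clim_seq_minus _ _ _ _
    (lattice_sum_cot_kernel''_pole (- / z) _ neg_inv_upper scaled_lim
      (fun n => off_lattice_neg_inv z _ z_upper (off n)))
    (lattice_sum_cot_kernel''_pole z w z_upper w_lim off))].
  intros n. cbv beta. unfold S_defect. now field.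
Qed.

Lemma S_defect_eq_0 (u : C) : ~ in_lattice z u -> S_defect z u = 0.
Proof.
  apply torus_dup_eq_0;
    auto using S_defect_period, S_defect_dup, S_defect_locally_bounded, S_defect_pole.
Qed.

End SDefect.

(** * The transformation of the Klein form under z -> -1/z *)

Definition S_ratio (z u : C) : C :=
  z * klein (u / z) (- / z) * ee (- (u * u / (2 * z))) / klein u z.

Definition S_dlog (z u : C) : C :=
  lattice_sum cot_kernel (u / z) (- / z) / z - lattice_sum cot_kernel u z - u / z.

Definition S_dlog' (z u : C) : C :=
  tpi * (lattice_sum cot_kernel' (u / z) (- / z) / (z * z) - lattice_sum cot_kernel' u z) - / z.

Definition strip (z u : C) : Prop := (0 < Im u < Im z).

Section SRatio.

Variable z : C.
Hypothesis z_upper : upper z.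

Let z_neq : z <> 0 := upper_neq_0 z z_upper.
Let neg_inv_upper : upper (- / z) := upper_neg_inv z z_upper.

Lemma S_ratio_neq_0 (u : C) : ~ in_lattice z u -> S_ratio z u <> 0.
Proof.
  intros off. pose proof (klein_neq_0 u z z_upper off).
  pose proof (klein_neq_0 _ _ neg_inv_upper (off_lattice_neg_inv z u z_upper off)).
  unfold S_ratio, Cdiv. auto 10 with Cneq.
Qed.

Lemma is_Cderive_S_dlog' (u : C) : ~ in_lattice z u -> is_Cderive (S_dlog' z) u 0.
Proof.
  intros off.
  pose proof (is_Cderive_lattice_sum_neg_inv _ _ is_Cderive_lattice_sum_cot_kernel'
    z u z_upper off).
  pose proof (is_Cderive_lattice_sum_cot_kernel' z u z_upper off).
  unfold S_dlog'. Cderive.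
  transitivity (tpi * tpi * S_defect z u).
  - unfold S_defect. now field.
  - rewrite S_defect_eq_0 by easy. ring.
Qed.

Lemma is_Cderive_S_dlog (u : C) : ~ in_lattice z u -> is_Cderive (S_dlog z) u (S_dlog' z u).
Proof.
  intros off.
  pose proof (is_Cderive_lattice_sum_neg_inv _ _ is_Cderive_lattice_sum_cot_kernel
    z u z_upper off).
  pose proof (is_Cderive_lattice_sum_cot_kernel z u z_upper off).
  unfold S_dlog, S_dlog'. Cderive. now field.
Qed.

Lemma is_Cderive_S_ratio (u : C) : ~ in_lattice z u ->
  is_Cderive (S_ratio z) u (S_ratio z u * (tpi * S_dlog z u)).
Proof.
  intros off. pose proof (klein_neq_0 u z z_upper off).
  destruct (klein_log_derivative u z z_upper off) as [_ Dklein].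
  destruct (klein_log_derivative _ _ neg_inv_upper (off_lattice_neg_inv z u z_upper off))
    as [_ Dklein_S].
  pose proof (is_Cderive_comp _ _ _ _ _
    (is_Cderive_div_const z _ _ _ (is_Cderive_id u)) Dklein_S) as Dklein_S_comp.
  unfold S_ratio, S_dlog. Cderive. Cfield.
Qed.

Lemma S_ratio_plus_1 (u : C) : S_ratio z (u + 1) = S_ratio z u.
Proof.
  unfold S_ratio. rewrite klein_plus_1.
  pose proof (klein_plus_z ((u + 1) / z) (- / z) neg_inv_upper) as shift.
  replace ((u + 1) / z + - / z) with (u / z) in shift by now field.
  rewrite shift.
  replace (- ((u + 1) * (u + 1) / (2 * z))) with
    (- (u * u / (2 * z)) + (- ((u + 1) / z) - - / z / 2)) by Cfield.
  rewrite ee_plus. unfold Cdiv. rewrite Cinv_opp. ring.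
Qed.

Lemma S_ratio_plus_z (u : C) : S_ratio z (u + z) = S_ratio z u.
Proof.
  unfold S_ratio. rewrite klein_plus_z by easy.
  replace ((u + z) / z) with (u / z + 1) by now field. rewrite klein_plus_1.
  replace (- ((u + z) * (u + z) / (2 * z))) with
    (- (u * u / (2 * z)) + (- u - z / 2)) by Cfield.
  rewrite ee_plus. destruct (Ceq_dec (klein u z) 0) as [zero|nonzero]; [|Cfield].
  rewrite zero, Cmult_0_r. unfold Cdiv. rewrite Cinv_0. ring.
Qed.

Lemma S_ratio_opp (u : C) : S_ratio z (- u) = S_ratio z u.
Proof.
  unfold S_ratio. replace (- u / z) with (- (u / z)) by (unfold Cdiv; ring).
  rewrite !klein_opp. replace (- u * - u) with (u * u) by ring.
  unfold Cdiv. rewrite Cinv_opp. ring.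
Qed.

Lemma S_dlog_of_symmetry (a b u : C) : (forall y, S_ratio z (a * y + b) = S_ratio z y) ->
  ~ in_lattice z u -> ~ in_lattice z (a * u + b) -> a * S_dlog z (a * u + b) = S_dlog z u.
Proof.
  intros symmetry off off_image.
  assert (Dcomp : is_Cderive (fun y => S_ratio z (a * y + b)) u
    (S_ratio z (a * u + b) * (tpi * S_dlog z (a * u + b)) * a)).
  { apply (is_Cderive_comp (S_ratio z) (fun y => a * y + b)); [Cderive; ring|].
    now apply is_Cderive_S_ratio. }
  pose proof (is_Cderive_unique _ _ _ _ Dcomp (is_Cderive_ext _ _ _ _
    (fun y => eq_sym (symmetry y)) (is_Cderive_S_ratio u off))) as E.
  rewrite symmetry in E.
  apply (Cmult_eq_reg_r _ _ (S_ratio z u * tpi)).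
  - auto using S_ratio_neq_0 with Cneq.
  - transitivity (S_ratio z u * (tpi * S_dlog z (a * u + b)) * a); [ring|]. rewrite E. ring.
Qed.

Lemma strip_convex (a b : C) (t : R) : strip z a -> strip z b -> 0 <= t <= 1 ->
  strip z (a + t * (b - a)).
Proof.
  unfold strip. intros a_in b_in t_bound.
  replace (Im (a + t * (b - a))) with ((1 - t) * Im a + t * Im b)%R
    by (unfold Cminus; rewrite im_plus, im_scal_l, im_plus, im_opp; ring).
  destruct (Rle_lt_dec t (1 / 2)); split; nra.
Qed.

Lemma strip_off_lattice (u : C) : strip z u -> ~ in_lattice z u.
Proof.
  intros u_in [m [n ->]]. unfold strip, upper in *.
  rewrite im_plus, im_scal_l, im_RtoC, Rplus_0_r in u_in.
  assert (m_bound : 0 < IZR m < 1) by nra. destruct m_bound as [m_gt m_lt].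
  apply lt_IZR in m_gt, m_lt. lia.
Qed.

Lemma strip_real_mult (t : R) : 0 < t < 1 -> strip z (t * z).
Proof. intros t_bound. unfold strip, upper in *. rewrite im_scal_l. nra. Qed.

Lemma strip_plus_1 (u : C) : strip z u -> strip z (u + 1).
Proof. unfold strip. now rewrite im_plus, im_RtoC, Rplus_0_r. Qed.

Lemma S_dlog_affine : exists a b, forall u, strip z u -> S_dlog z u = a * u + b.
Proof.
  set (u0 := RtoC (1 / 2) * z).
  assert (u0_in : strip z u0) by (apply strip_real_mult; lra).
  exists (S_dlog' z u0), (S_dlog z u0 - S_dlog' z u0 * u0). intros u u_in.
  assert (slope_const : forall y, strip z y -> S_dlog' z y = S_dlog' z u0).
  { intros y y_in. apply (is_Cderive_0_constant (strip z)); auto using strip_convex.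
    intros v v_in. apply is_Cderive_S_dlog'. now apply strip_off_lattice. }
  rewrite <- (is_Cderive_0_constant (strip z) (fun y => S_dlog z y - S_dlog' z u0 * y))
    with (a := u); auto using strip_convex; [ring|].
  intros y y_in. pose proof (is_Cderive_S_dlog y (strip_off_lattice y y_in)).
  Cderive. rewrite slope_const by easy. ring.
Qed.

Lemma S_dlog_strip (u : C) : strip z u -> S_dlog z u = 0.
Proof.
  intros u_in. destruct S_dlog_affine as [a [b affine]].
  assert (a_eq : a = 0).
  { assert (E : S_dlog z (u + 1) = S_dlog z u).
    { pose proof (S_dlog_of_symmetry 1 1 u) as E. rewrite !Cmult_1_l in E. apply E.
      - intros y. rewrite Cmult_1_l. apply S_ratio_plus_1.
      - now apply strip_off_lattice.
      - now apply strip_off_lattice, strip_plus_1. }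
    rewrite !affine in E by auto using strip_plus_1.
    replace a with (a * (u + 1) + b - (a * u + b)) by ring. rewrite E. ring. }
  assert (b_eq : b = 0).
  { set (u0 := RtoC (1 / 2) * z).
    assert (u0_in : strip z u0) by (apply strip_real_mult; lra).
    assert (fixed : - (1) * u0 + z = u0).
    { unfold u0. rewrite RtoC_div by lra. field. }
    pose proof (S_dlog_of_symmetry (- (1)) z u0) as E. rewrite fixed, affine, a_eq in E by easy.
    replace b with ((0 * u0 + b - - (1) * (0 * u0 + b)) / 2) by field. rewrite E.
    - field.
    - intros y. rewrite S_ratio_plus_z. replace (- (1) * y) with (- y) by ring. apply S_ratio_opp.
    - now apply strip_off_lattice.
    - now apply strip_off_lattice. }
  rewrite affine, a_eq, b_eq by easy. ring.
Qed.

Lemma strip_halving (n : nat) : strip z (z / 2 / 2 ^ n).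
Proof.
  replace (z / 2 / 2 ^ n) with (RtoC (/ 2 ^ S n) * z).
  - apply strip_real_mult. pose proof (pow_R1_Rle 2 n ltac:(lra)). simpl.
    split; [apply Rinv_0_lt_compat; lra|]. rewrite <- Rinv_1. apply Rinv_lt_contravar; lra.
  - rewrite RtoC_inv, RtoC_pow, Cpow_S by (apply pow_nonzero; lra). Cfield.
Qed.

Lemma klein_quotient_lim (x : C) (w : nat -> C) : upper x -> is_Clim_seq w 0 ->
  (forall n, w n <> 0) -> is_Clim_seq (fun n => klein (w n) x / w n) tpi.
Proof.
  intros x_upper w_lim w_neq.
  eapply is_Clim_seq_ext; [|exact (is_Cderive_quotient_lim _ _ _ w
    (is_Cderive_klein_0 x x_upper) w_lim w_neq)].
  intros n. cbv beta. rewrite Cplus_0_l, (klein_lattice 0 x x_upper (in_lattice_0 x)).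
  now rewrite Cminus_0_r.
Qed.

Lemma S_ratio_lim_0 : is_Clim_seq (fun n => S_ratio z (z / 2 / 2 ^ n)) 1.
Proof.
  set (w := fun n => z / 2 / 2 ^ n).
  assert (w_lim : is_Clim_seq w 0) by apply is_Clim_seq_halving.
  assert (off : forall n, ~ in_lattice z (w n))
    by (intros n; apply strip_off_lattice, strip_halving).
  assert (w_neq : forall n, w n <> 0) by (intros n; now apply (off_lattice_neq_0 z)).
  assert (scaled_lim : is_Clim_seq (fun n => w n / z) 0).
  { apply (is_Clim_seq_eq _ (0 / z)); [now field|]. now apply is_Clim_seq_div_const. }
  assert (scaled_neq : forall n, w n / z <> 0) by (intros n; unfold Cdiv; auto with Cneq).
  assert (gauss_lim : is_Clim_seq (fun n => ee (- (w n * w n / (2 * z)))) 1).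
  { apply is_Clim_seq_ee_0. apply (is_Clim_seq_eq _ (- (0 * 0 / (2 * z)))); [Cfield|].
    now apply is_Clim_seq_opp, is_Clim_seq_div_const, is_Clim_seq_mult. }
  pose proof (klein_quotient_lim z w z_upper w_lim w_neq) as klein_lim.
  pose proof (klein_quotient_lim (- / z) _ neg_inv_upper scaled_lim scaled_neq) as klein_S_lim.
  apply (is_Clim_seq_eq _ (tpi * / tpi * 1)); [Cfield|].
  eapply is_Clim_seq_ext; [|exact (is_Clim_seq_mult _ _ _ _ (is_Clim_seq_mult _ _ _ _ klein_S_lim
    (is_Cderive_lim_seq Cinv _ _ _ (is_Cderive_Cinv _ tpi_neq_0) klein_lim)) gauss_lim)].
  intros n. cbv beta. change (z / 2 / 2 ^ n) with (w n). unfold S_ratio.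
  pose proof (klein_neq_0 (w n) z z_upper (off n)). Cfield.
Qed.

Lemma S_ratio_strip (u : C) : strip z u -> S_ratio z u = 1.
Proof.
  intros u_in.
  assert (constant : forall v, strip z v -> S_ratio z v = S_ratio z u).
  { intros v v_in. apply (is_Cderive_0_constant (strip z)); auto using strip_convex.
    intros y y_in. apply is_Cderive_eq with (S_ratio z y * (tpi * S_dlog z y)).
    - rewrite S_dlog_strip by easy. ring.
    - apply is_Cderive_S_ratio. now apply strip_off_lattice. }
  apply (is_Clim_seq_unique (fun _ => S_ratio z u)); [apply is_Clim_seq_const|].
  eapply is_Clim_seq_ext; [|exact S_ratio_lim_0].
  intros n. apply constant, strip_halving.
Qed.

Lemma S_ratio_eq_1 (u : C) : ~ in_lattice z u -> S_ratio z u = 1.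
Proof.
  intros off. destruct (fundamental_domain z u z_upper) as [m [n [s [t [s_bound [_ E]]]]]].
  apply (off_lattice_shift z u m n) in off.
  assert (reduce : S_ratio z u = S_ratio z (u + IZR m * z + IZR n)).
  { rewrite <- (Cmult_1_r (IZR n)), (period_IZR_mult _ (S_ratio z) 1 S_ratio_plus_1).
    symmetry. apply (period_IZR_mult _ (S_ratio z) z S_ratio_plus_z). }
  rewrite reduce, E. rewrite E in off. set (v := s * z + t) in *.
  apply (is_Clim_seq_unique (fun k => S_ratio z (v + RtoC (1 - s) * (z / 2 / 2 ^ k)))).
  - apply (is_Cderive_lim_seq _ _ _ _ (is_Cderive_S_ratio v off)).
    apply (is_Clim_seq_eq _ (v + RtoC (1 - s) * 0)); [ring|].
    apply is_Clim_seq_plus; [apply is_Clim_seq_const|].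
    apply is_Clim_seq_scal, is_Clim_seq_halving.
  - eapply is_Clim_seq_ext; [|apply is_Clim_seq_const]. intros k. symmetry. apply S_ratio_strip.
    pose proof (strip_halving k) as in_strip. unfold strip, v in *.
    rewrite !im_plus, !im_scal_l, im_RtoC. nra.
Qed.

Lemma klein_neg_inv (u : C) :
  klein (u / z) (- / z) = / z * ee (u * u / (2 * z)) * klein u z.
Proof.
  destruct (classic (in_lattice z u)) as [lattice|off].
  - rewrite (klein_lattice u z z_upper lattice). destruct lattice as [m [n ->]].
    rewrite klein_lattice; [ring|easy|]. exists (- n)%Z, m. Ccast. now field.
  - pose proof (S_ratio_eq_1 u off) as ratio. unfold S_ratio in ratio. rewrite ee_opp in ratio.
    pose proof (klein_neq_0 u z z_upper off).
    rewrite <- (Cmult_1_r (_ * klein u z)), <- ratio. Cfield.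
Qed.

End SRatio.

(** * The transformation of the Klein form under SL2(Z) *)

Lemma automorphy_neq_0 (a b c d : Z) (z : C) :
  in_SL2Z a b c d -> upper z -> automorphy c d z <> 0.
Proof.
  intros det z_upper E. destruct (lattice_coords_0 z c (IZR d) z_upper E) as [-> d_eq].
  apply eq_IZR in d_eq as ->.
  unfold in_SL2Z in det. lia.
Qed.

Lemma mobius_id (z : C) : mobius 1 0 0 1 z = z.
Proof. unfold mobius. field. Qed.

Lemma automorphy_id (z : C) : automorphy 0 1 z = 1.
Proof. unfold automorphy. ring. Qed.

Lemma mobius_T_mul (a b c d k : Z) (z : C) : in_SL2Z a b c d -> upper z ->
  mobius (a + k * c) (b + k * d) c d z = mobius a b c d z + IZR k.
Proof.
  intros det z_upper. pose proof (automorphy_neq_0 a b c d z det z_upper).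
  unfold mobius, automorphy in *. Ccast. now field.
Qed.

Lemma in_SL2Z_S_mul (a b c d : Z) : in_SL2Z a b c d -> in_SL2Z (- c) (- d) a b.
Proof. unfold in_SL2Z. lia. Qed.

Lemma mobius_S_mul (a b c d : Z) (z : C) : in_SL2Z a b c d -> upper z ->
  mobius (- c) (- d) a b z = - / mobius a b c d z.
Proof.
  intros det z_upper. pose proof (automorphy_neq_0 a b c d z det z_upper).
  pose proof (automorphy_neq_0 _ _ _ _ z (in_SL2Z_S_mul _ _ _ _ det) z_upper).
  unfold mobius, automorphy in *. Ccast. field. auto.
Qed.

(* [SL2(Z)] is generated by [S] and [T]: Euclid's algorithm on the first column. *)
Lemma SL2Z_ind (P : Z -> Z -> Z -> Z -> Prop) :
  P 1%Z 0%Z 0%Z 1%Z ->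
  (forall a b c d k, in_SL2Z a b c d -> P a b c d -> P (a + k * c)%Z (b + k * d)%Z c d) ->
  (forall a b c d, in_SL2Z a b c d -> P a b c d -> P (- c)%Z (- d)%Z a b) ->
  forall a b c d, in_SL2Z a b c d -> P a b c d.
Proof.
  intros P_id P_T P_S a b c d.
  remember (Z.to_nat (Z.abs c)) as n eqn:n_eq.
  revert a b c d n_eq. induction n as [n IH] using lt_wf_ind. intros a b c d n_eq det.
  destruct (Z.eq_dec c 0) as [->|c_neq].
  - unfold in_SL2Z in det. destruct (Z.eq_mul_1 d a) as [-> | ->]; [lia| |].
    + pose proof (P_T 1%Z 0%Z 0%Z 1%Z b eq_refl P_id) as P_T_pow.
      replace a with (1 + b * 0)%Z by lia. now replace b with (0 + b * 1)%Z at 2 by lia.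
    + pose proof (P_S 0%Z (-1)%Z 1%Z 0%Z eq_refl (P_S 1%Z 0%Z 0%Z 1%Z eq_refl P_id)) as P_neg.
      apply (P_T (-1)%Z 0%Z 0%Z (-1)%Z (- b)%Z eq_refl) in P_neg.
      replace a with (-1 + - b * 0)%Z by lia. now replace b with (0 + - b * -1)%Z at 2 by lia.
  - set (k := (a / c)%Z). set (a' := (a mod c)%Z). set (b' := (b - k * d)%Z).
    assert (a_eq : (a = a' + k * c)%Z) by (unfold a', k; rewrite (Z.div_mod a c) at 1 by easy; lia).
    assert (a'_lt : (Z.abs a' < Z.abs c)%Z)
      by (unfold a'; pose proof (Z.mod_pos_bound a c); pose proof (Z.mod_neg_bound a c); lia).
    assert (det' : in_SL2Z a' b' c d) by (unfold in_SL2Z, b' in *; nia).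
    replace b with (b' + k * d)%Z by (unfold b'; lia). rewrite a_eq.
    apply P_T; [easy|].
    replace a' with (- - a')%Z by lia. replace b' with (- - b')%Z by lia.
    apply P_S; [unfold in_SL2Z in *; lia|].
    apply (IH (Z.to_nat (Z.abs (- a')))); [lia|easy|unfold in_SL2Z in *; lia].
Qed.

Lemma upper_mobius (a b c d : Z) (z : C) : in_SL2Z a b c d -> upper z -> upper (mobius a b c d z).
Proof.
  intros det z_upper. revert a b c d det. refine (SL2Z_ind _ _ _ _); cbv beta.
  - now rewrite mobius_id.
  - intros a b c d k det IH. rewrite mobius_T_mul by easy.
    unfold upper in *. rewrite im_plus, im_RtoC. lra.
  - intros a b c d det IH. rewrite mobius_S_mul by easy. now apply upper_neg_inv.
Qed.

Lemma automorphy_det (a b c d : Z) (z : C) : in_SL2Z a b c d ->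
  IZR a * automorphy c d z = 1 + IZR c * automorphy a b z.
Proof.
  unfold in_SL2Z, automorphy. intros det.
  transitivity (IZR (a * c) * z + IZR (a * d)); [Ccast; ring|].
  replace (a * d)%Z with (1 + b * c)%Z by lia. Ccast. ring.
Qed.

Lemma klein_mobius (a b c d : Z) (z : C) : in_SL2Z a b c d -> upper z ->
  forall u, klein (u / automorphy c d z) (mobius a b c d z) =
    / automorphy c d z * ee (IZR c * (u * u) / (2 * automorphy c d z)) * klein u z.
Proof.
  intros det z_upper. revert a b c d det. refine (SL2Z_ind _ _ _ _); cbv beta.
  - intros u. rewrite mobius_id, automorphy_id.
    replace (0%R * (u * u) / (2 * 1)) with (RtoC 0) by field.
    replace (u / 1) with u by field. rewrite ee_0. field.
  - intros a b c d k det IH u. now rewrite mobius_T_mul, klein_modulus_plus_IZR.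
  - intros a b c d det IH u. rewrite mobius_S_mul by easy.
    pose proof (automorphy_neq_0 a b c d z det z_upper) as j_neq.
    pose proof (automorphy_neq_0 _ _ _ _ z (in_SL2Z_S_mul _ _ _ _ det) z_upper) as j'_neq.
    pose proof (automorphy_det a b c d z det) as j_det.
    assert (w_eq : mobius a b c d z = automorphy a b z / automorphy c d z) by easy.
    pose proof (upper_mobius a b c d z det z_upper) as w_upper.
    set (j := automorphy c d z) in *. set (j' := automorphy a b z) in *.
    replace (u / j') with (u / j / mobius a b c d z) by (rewrite w_eq; field; auto).
    rewrite klein_neg_inv, IH, w_eq by easy.
    replace (IZR a * (u * u) / (2 * j')) with
      (u / j * (u / j) / (2 * (j' / j)) + IZR c * (u * u) / (2 * j)).
    + rewrite ee_plus. field. auto.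
    + transitivity ((1 + IZR c * j') * (u * u) / (2 * j * j')); [Cfield|].
      rewrite <- j_det. Cfield.
Qed.

Definition klein_slash (r : C) (c d : Z) (z : C) : C :=
  ee (IZR c * (r * r) * automorphy c d z / 2) * klein (r * automorphy c d z) z.

Lemma klein_mobius_slash (r : C) (a b c d : Z) (z : C) : in_SL2Z a b c d -> upper z ->
  klein r (mobius a b c d z) = / automorphy c d z * klein_slash r c d z.
Proof.
  intros det z_upper. pose proof (automorphy_neq_0 a b c d z det z_upper) as j_neq.
  unfold klein_slash. set (j := automorphy c d z) in *.
  replace r with (r * j / j) at 1 by now field. unfold j at 2.
  rewrite klein_mobius by easy. fold j.
  replace (IZR c * (r * j * (r * j)) / (2 * j)) with (IZR c * (r * r) * j / 2) by Cfield. ring.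
Qed.

(** * The discriminant *)

Definition discriminant (z : C) : C := ee z * qprod 0 z ^ 24.

Definition half_period_prod (z : C) : C :=
  klein (/ 2) z * klein (z / 2) z * klein ((z + 1) / 2) z.

Lemma half_period_prod_neq_0 (z : C) : upper z -> half_period_prod z <> 0.
Proof.
  intros z_upper.
  assert (off := fun m n => half_period_off_lattice z m n z_upper).
  unfold half_period_prod. apply Cmult_neq_0; [apply Cmult_neq_0|]; (apply klein_neq_0; [easy|]).
  - replace (/ 2) with ((0%R * z + 1%R) / 2) by field. now apply (off 0%Z 1%Z).
  - replace (z / 2) with ((1%R * z + 0%R) / 2) by field. now apply (off 1%Z 0%Z).
  - replace (z + 1) with (1%R * z + 1%R) by ring. now apply (off 1%Z 1%Z).
Qed.

(* Euler: [(q; q) (-q; q) (q^(1/2); q) (-q^(1/2); q) = (q; q)], grouping the factors of even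
   and of odd index on the right. *)
Lemma qprod_half_periods (z : C) : upper z ->
  qprod (/ 2) z * (qprod (- (z / 2)) z * qprod (- ((z + 1) / 2)) z) = 1.
Proof.
  intros z_upper. apply (Cmult_eq_reg_r _ _ (qprod 0 z)); [now apply qprod_0_neq_0|].
  rewrite Cmult_1_l.
  apply (is_Clim_seq_unique
    (fun n => partial_prod (fun k => 1 - ee (0 + INR (S k) * z)) (2 * n))).
  2:{ apply (is_Clim_seq_subseq _ _ (fun n => 2 * n)%nat); [intros n; cbv beta; lia|].
      now apply qprod_lim. }
  eapply is_Clim_seq_ext; [|exact (is_Clim_seq_mult _ _ _ _ (is_Clim_seq_mult _ _ _ _
    (qprod_lim (/ 2) z z_upper) (is_Clim_seq_mult _ _ _ _ (qprod_lim (- (z / 2)) z z_upper)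
    (qprod_lim (- ((z + 1) / 2)) z z_upper))) (qprod_lim 0 z z_upper))].
  intros n. cbv beta. induction n as [|n IH]; [cbn; ring|].
  replace (2 * S n)%nat with (S (S (2 * n))) by lia. cbn [partial_prod]. rewrite <- IH.
  set (w := INR (S n) * z).
  assert (even : 0 + INR (S (S (2 * n))) * z = 2 * w) by (unfold w; Ccast; simpl; ring).
  assert (odd : 0 + INR (S (2 * n)) * z = 2 * (- (z / 2) + w)) by (unfold w; Ccast; simpl; field).
  rewrite (ee_double _ _ even), (ee_double _ _ odd).
  replace (/ 2 + w) with (w + / 2) by ring. replace (0 + w) with w by ring.
  replace (- ((z + 1) / 2) + w) with (- (z / 2) + w - / 2) by field.
  rewrite ee_plus_half, ee_minus, ee_half. field.
Qed.

Lemma half_period_prod_qprod (z : C) : upper z -> half_period_prod z * qprod 0 z ^ 6 =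
  two_i_sin_pi (/ 2) * ee (- / 4) * ee (- (z / 2)).
Proof.
  intros z_upper.
  assert (shift : qprod (- (z / 2)) z = (1 - ee (z / 2)) * qprod (z / 2) z).
  { rewrite qprod_S by easy. now replace (- (z / 2) + z) with (z / 2) by field. }
  assert (shift' : qprod (- ((z + 1) / 2)) z = (1 - ee ((z + 1) / 2)) * qprod ((z + 1) / 2) z).
  { rewrite qprod_S by easy.
    replace (- ((z + 1) / 2) + z) with ((z + 1) / 2 - 1) by field.
    rewrite qprod_minus_1, ee_minus, ee_1. do 3 f_equal. field. }
  assert (quarter : ee (- ((z + 1) / 2 / 2)) = ee (- (z / 2 / 2)) * ee (- / 4))
    by (rewrite <- ee_plus; f_equal; field).
  assert (square : - (z / 2) = 2 * - (z / 2 / 2)) by field.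
  unfold half_period_prod, klein. replace (- / 2) with (/ 2 - 1) by field.
  rewrite qprod_minus_1, (two_i_sin_pi_factor_opp (z / 2)),
    (two_i_sin_pi_factor_opp ((z + 1) / 2)), quarter, (ee_double _ _ square).
  transitivity (two_i_sin_pi (/ 2) * ee (- / 4) * (ee (- (z / 2 / 2)) * ee (- (z / 2 / 2))) *
    (qprod (/ 2) z * (qprod (- (z / 2)) z * qprod (- ((z + 1) / 2)) z)) *
    (qprod (/ 2) z * (qprod (- (z / 2)) z * qprod (- ((z + 1) / 2)) z))).
  - rewrite shift, shift'. Cfield.
  - rewrite qprod_half_periods by easy. ring.
Qed.

Lemma discriminant_half_period_prod (z : C) : upper z ->
  discriminant z * half_period_prod z ^ 4 = (two_i_sin_pi (/ 2) * ee (- / 4)) ^ 4 * ee (- z).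
Proof.
  intros z_upper. unfold discriminant.
  replace (qprod 0 z ^ 24) with ((qprod 0 z ^ 6) ^ 4) by now rewrite <- Cpow_mult_r.
  transitivity (ee z * (half_period_prod z * qprod 0 z ^ 6) ^ 4); [rewrite Cpow_mult_l; ring|].
  rewrite half_period_prod_qprod, Cpow_mult_l, ee_pow by easy.
  replace (ee (- z)) with (ee z * ee (INR 4 * - (z / 2))); [ring|].
  rewrite <- ee_plus. f_equal. simpl. rewrite !RtoC_plus. field.
Qed.

Lemma half_period_prod_neg_inv (z : C) : upper z ->
  z ^ 3 * half_period_prod (- / z) = - (ee ((z + / z) / 4) * ee (/ 4) * half_period_prod z).
Proof.
  intros z_upper. pose proof (upper_neq_0 z z_upper) as z_neq.
  assert (at_half : z * klein (/ 2) (- / z) = ee (z / 8) * klein (z / 2) z).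
  { replace (/ 2) with (z / 2 / z) by Cfield. rewrite klein_neg_inv by easy.
    replace (z / 2 * (z / 2) / (2 * z)) with (z / 8) by Cfield. now field. }
  assert (at_z_half : z * klein (- / z / 2) (- / z) = - (ee (/ z / 8) * klein (/ 2) z)).
  { replace (- / z / 2) with (- (/ 2 / z)) by Cfield. rewrite klein_opp, klein_neg_inv by easy.
    replace (/ 2 * / 2 / (2 * z)) with (/ z / 8) by Cfield. now field. }
  assert (at_sum_half : z * klein ((- / z + 1) / 2) (- / z) =
    ee (z / 8 + / 4 + / z / 8) * klein ((z + 1) / 2) z).
  { replace ((- / z + 1) / 2) with (- ((z + 1) / 2 / z - 1)) by Cfield.
    rewrite klein_opp, klein_minus_1, klein_neg_inv by easy.
    replace ((z + 1) / 2 * ((z + 1) / 2) / (2 * z)) with (z / 8 + / 4 + / z / 8) by Cfield.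
    now field. }
  transitivity ((z * klein (/ 2) (- / z)) * (z * klein (- / z / 2) (- / z)) *
    (z * klein ((- / z + 1) / 2) (- / z))); [unfold half_period_prod; ring|].
  rewrite at_half, at_z_half, at_sum_half. unfold half_period_prod.
  replace ((z + / z) / 4) with (z / 8 + / z / 8 + (z / 8 + / z / 8)) by Cfield.
  rewrite !ee_plus. ring.
Qed.

Lemma discriminant_neg_inv (z : C) : upper z -> discriminant (- / z) = z ^ 12 * discriminant z.
Proof.
  intros z_upper. pose proof (upper_neg_inv z z_upper) as S_upper.
  pose proof (discriminant_half_period_prod z z_upper) as at_z.
  pose proof (discriminant_half_period_prod (- / z) S_upper) as at_S.
  pose proof (f_equal (fun x => x ^ 4) (half_period_prod_neg_inv z z_upper)) as prod_S.
  pose proof (Cpow_nz _ 4 (half_period_prod_neq_0 z z_upper)) as prod_neq.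
  pose proof (Cpow_nz _ 4 (half_period_prod_neq_0 _ S_upper)) as prod_S_neq.
  assert (quartic : ((- ee ((z + / z) / 4)) * ee (/ 4)) ^ 4 = ee z * ee (/ z)).
  { transitivity (ee ((z + / z) / 4) ^ 4 * ee (/ 4) ^ 4); [ring|].
    rewrite !ee_pow, <- !ee_plus, <- (ee_plus_IZR (z + / z) 1). f_equal.
    simpl. rewrite !RtoC_plus. Cfield. }
  cbv beta in prod_S.
  replace (- (ee ((z + / z) / 4) * ee (/ 4) * half_period_prod z)) with
    (- ee ((z + / z) / 4) * ee (/ 4) * half_period_prod z) in prod_S by ring.
  rewrite Cpow_mult_l, (Cpow_mult_l _ (half_period_prod z)), quartic, <- Cpow_mult_r in prod_S.
  replace (- - / z) with (/ z) in at_S by ring. rewrite (ee_opp z) in at_z.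
  apply (Cmult_eq_reg_r _ _ (half_period_prod (- / z) ^ 4)); [easy|].
  apply (Cmult_eq_reg_r _ _ (half_period_prod z ^ 4)); [easy|].
  rewrite at_S.
  transitivity (z ^ 12 * half_period_prod (- / z) ^ 4 *
    (discriminant z * half_period_prod z ^ 4)); [|ring].
  change (3 * 4)%nat with 12%nat in prod_S. rewrite at_z, prod_S. Cfield.
Qed.

Lemma discriminant_mobius (a b c d : Z) (z : C) : in_SL2Z a b c d -> upper z ->
  discriminant (mobius a b c d z) = automorphy c d z ^ 12 * discriminant z.
Proof.
  intros det z_upper. revert a b c d det. refine (SL2Z_ind _ _ _ _); cbv beta.
  - rewrite mobius_id, automorphy_id, Cpow_1_l. ring.
  - intros a b c d k det IH. rewrite <- IH, mobius_T_mul by easy.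
    unfold discriminant. now rewrite ee_plus_IZR, qprod_modulus_plus_IZR.
  - intros a b c d det IH.
    pose proof (automorphy_neq_0 a b c d z det z_upper) as j_neq.
    assert (w_eq : mobius a b c d z = automorphy a b z / automorphy c d z) by easy.
    rewrite mobius_S_mul, discriminant_neg_inv, IH, w_eq by auto using upper_mobius. now field.
Qed.

(** * Products over torsion points *)

(* The monic polynomial of degree [length l] whose lower coefficients, in increasing degree,
   are listed in [l]. *)
Fixpoint monic_eval (l : list C) (x : C) : C :=
  match l with nil => 1 | cons a l => a + x * monic_eval l x end.

Lemma monic_eval_factor (l : list C) (a r : C) : exists l', length l' = length l /\
  forall x, monic_eval (a :: l) x = monic_eval (a :: l) r + (x - r) * monic_eval l' x.
Proof.
  revert a. induction l as [|b l IH]; intros a.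
  - exists nil. split; [easy|]. intros x. simpl. ring.
  - destruct (IH b) as [l' [length_l' division]].
    exists (monic_eval (b :: l) r :: l'). split; [simpl; now rewrite length_l'|].
    intros x. change (a + x * monic_eval (b :: l) x = a + r * monic_eval (b :: l) r
      + (x - r) * (monic_eval (b :: l) r + x * monic_eval l' x)).
    rewrite (division x). ring.
Qed.

Lemma monic_eval_roots (r : nat -> C) (n : nat) (l : list C) : length l = n ->
  (forall i j, (i < j < n)%nat -> r i <> r j) ->
  (forall k, (k < n)%nat -> monic_eval l (r k) = 0) ->
  forall x, monic_eval l x = partial_prod (fun k => x - r k) n.
Proof.
  revert l. induction n as [|n IH]; intros l length_l distinct roots x.
  - destruct l; [easy|discriminate].
  - destruct l as [|a l]; [discriminate|].
    destruct (monic_eval_factor l a (r n)) as [l' [length_l' division]].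
    rewrite (roots n) in division by lia.
    rewrite division. cbn [partial_prod]. rewrite <- (IH l').
    + ring.
    + simpl in length_l. lia.
    + intros i j lt. apply distinct. lia.
    + intros k k_lt. apply (Cmult_eq_reg_r _ _ (r k - r n)).
      { apply Cminus_eq_contra, distinct. lia. }
      rewrite Cmult_0_l, <- (roots k), division by lia. ring.
Qed.

Lemma monic_eval_zeros (n : nat) (x : C) : monic_eval (repeat (RtoC 0) n) x = x ^ n.
Proof. induction n as [|n IH]; simpl; [easy|]. rewrite IH. ring. Qed.

Lemma ee_frac_neq_1 (i n : Z) : (0 < i < n)%Z -> ee (IZR i / IZR n) <> 1.
Proof.
  intros i_bound E. destruct (ee_eq_1 _ E) as [m m_eq].
  assert (i_eq : (i = m * n)%Z).
  { apply eq_IZR, RtoC_inj. rewrite mult_IZR, RtoC_mult, <- m_eq. field.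
    apply IZR_C_neq_0. lia. }
  destruct (Z.le_gt_cases m 0); nia.
Qed.

Lemma pow_minus_1_factor (N : nat) (x : C) : (0 < N)%nat ->
  x ^ N - 1 = partial_prod (fun k => x - ee (INR k / INR N)) N.
Proof.
  intros N_pos. pose proof (INR_C_neq_0 N ltac:(lia)) as N_neq. destruct N as [|n]; [lia|].
  rewrite <- (monic_eval_roots _ _ (- (1) :: repeat (RtoC 0) n)%list).
  - cbn [monic_eval]. rewrite monic_eval_zeros, Cpow_S. ring.
  - simpl. now rewrite repeat_length.
  - intros i j [lt j_lt] E.
    apply (ee_frac_neq_1 (Z.of_nat j - Z.of_nat i) (Z.of_nat (S n))); [lia|].
    rewrite minus_IZR, RtoC_minus, <- !INR_IZR_INZ.
    replace ((INR j - INR i) / INR (S n)) with (INR j / INR (S n) - INR i / INR (S n)) by now field.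
    rewrite ee_minus, E. Cfield.
  - intros k _. cbn [monic_eval]. rewrite monic_eval_zeros, <- Cpow_S, ee_pow.
    replace (INR (S n) * (INR k / INR (S n))) with (RtoC (IZR (Z.of_nat k)))
      by (rewrite <- INR_IZR_INZ; now field).
    rewrite ee_IZR. ring.
Qed.

Lemma roots_of_unity_prod (N : nat) (y : C) : (0 < N)%nat ->
  partial_prod (fun k => 1 - ee (INR k / INR N) * y) N = 1 - y ^ N.
Proof.
  intros N_pos. destruct (Ceq_dec y 0) as [->|y_neq].
  - replace (partial_prod _ N) with (partial_prod (fun _ => 1) N)
      by (apply partial_prod_ext; intros; ring).
    rewrite partial_prod_const, Cpow_1_l. destruct N; [lia|]. rewrite Cpow_S. ring.
  - transitivity (y ^ N * ((/ y) ^ N - 1)).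
    + rewrite pow_minus_1_factor, <- partial_prod_const, <- partial_prod_mult by easy.
      apply partial_prod_ext. intros k _. now field.
    + rewrite Cpow_inv by easy. Cfield.
Qed.

Lemma qprod_torsion_prod (N : nat) (z : C) : (0 < N)%nat -> upper z ->
  partial_prod (fun k => qprod (INR k / INR N) z) N = qprod 0 (INR N * z).
Proof.
  intros N_pos z_upper.
  assert (Nz_upper : upper (INR N * z)) by now apply upper_scal; [apply lt_0_INR|].
  apply (is_Clim_seq_unique (fun n => partial_prod (fun k =>
    partial_prod (fun j => 1 - ee (INR k / INR N + INR (S j) * z)) n) N)).
  - apply (is_Clim_seq_partial_prod (fun k n => partial_prod
      (fun j => 1 - ee (INR k / INR N + INR (S j) * z)) n)).
    intros k. now apply qprod_lim.
  - eapply is_Clim_seq_ext; [|exact (qprod_lim 0 _ Nz_upper)]. intros n. cbv beta.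
    rewrite partial_prod_exchange. apply partial_prod_ext. intros j _.
    replace (0 + INR (S j) * (INR N * z)) with (INR N * (INR (S j) * z)) by ring.
    rewrite <- ee_pow, <- roots_of_unity_prod by easy.
    apply partial_prod_ext. intros k _. now rewrite ee_plus.
Qed.

Lemma qprod_half_torsion_prod (M : nat) (z : C) : upper z ->
  qprod 0 z * partial_prod (fun k => qprod (INR (S k) / INR (2 * M + 1)) z *
     qprod (- (INR (S k) / INR (2 * M + 1))) z) M = qprod 0 (INR (2 * M + 1) * z).
Proof.
  intros z_upper. rewrite <- qprod_torsion_prod by (lia || easy).
  pose proof (INR_C_neq_0 (2 * M + 1) ltac:(lia)) as N_neq.
  set (N := INR (2 * M + 1)) in *. rewrite Nat.add_1_r, partial_prod_S_l, partial_prod_fold.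
  f_equal; [f_equal; simpl; now field|]. apply partial_prod_ext. intros k k_lt. f_equal.
  rewrite <- qprod_plus_1. f_equal. replace (S (2 * M - 1 - k)) with (2 * M - k)%nat by lia.
  rewrite minus_INR, RtoC_minus by lia.
  replace (RtoC (INR (2 * M))) with (N - 1); [|unfold N; Ccast; simpl; ring].
  Ccast. now field.
Qed.

Definition half_torsion_prod (M : nat) (z : C) : C :=
  partial_prod (fun k => klein (INR (S k) / INR (2 * M + 1)) z) M.

Definition half_torsion_const (M : nat) : C :=
  partial_prod (fun k => two_i_sin_pi (INR (S k) / INR (2 * M + 1))) M.

Lemma half_torsion_const_neq_0 (M : nat) : half_torsion_const M <> 0.
Proof.
  apply partial_prod_neq_0. intros k k_lt. apply two_i_sin_pi_neq_0.
  rewrite !INR_IZR_INZ. apply ee_frac_neq_1. lia.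
Qed.

Lemma half_torsion_prod_qprod (M : nat) (z : C) : upper z ->
  half_torsion_prod M z * qprod 0 z ^ (2 * M + 1) =
  half_torsion_const M * qprod 0 (INR (2 * M + 1) * z).
Proof.
  intros z_upper. rewrite <- qprod_half_torsion_prod by easy.
  assert (termwise : half_torsion_prod M z * (qprod 0 z * qprod 0 z) ^ M =
    half_torsion_const M * partial_prod (fun k =>
      qprod (INR (S k) / INR (2 * M + 1)) z * qprod (- (INR (S k) / INR (2 * M + 1))) z) M).
  { unfold half_torsion_prod, half_torsion_const.
    rewrite <- partial_prod_const, <- !partial_prod_mult.
    apply partial_prod_ext. intros k _. unfold klein. Cfield. }
  rewrite Cpow_add_r, Cpow_mult_r, Cpow_1_r.
  replace (qprod 0 z ^ 2) with (qprod 0 z * qprod 0 z) by ring.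
  rewrite Cmult_assoc, termwise. ring.
Qed.

Lemma odd_of_nat_double_S (M : nat) : Z.odd (Z.of_nat (2 * M + 1)) = true.
Proof. now rewrite Nat2Z.inj_add, Z.odd_add, Nat2Z.inj_mul, Z.odd_mul. Qed.

Lemma Gamma1_parity (N a b c' d' : Z) : Z.odd N = true ->
  in_SL2Z a b (N * c') (1 + N * d') -> Z.odd c' = true \/ Z.odd d' = false.
Proof.
  unfold in_SL2Z. intros N_odd det. apply (f_equal Z.odd) in det.
  rewrite Z.odd_sub, !Z.odd_mul, Z.odd_add, Z.odd_mul, N_odd in det.
  destruct (Z.odd c'), (Z.odd d'), (Z.odd a), (Z.odd b); auto; discriminate.
Qed.

Lemma klein_torsion_Gamma1 (N k a b c' d' : Z) (z : C) : Z.odd N = true ->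
  in_SL2Z a b (N * c') (1 + N * d') -> upper z ->
  klein (IZR k / IZR N) (mobius a b (N * c') (1 + N * d') z) =
  / automorphy (N * c') (1 + N * d') z *
  (ee (IZR (c' * k * (N - k)) / (2 * IZR N)) * klein (IZR k / IZR N) z).
Proof.
  intros N_odd det z_upper.
  assert (N_neq : RtoC (IZR N) <> 0) by (apply IZR_C_neq_0; intros ->; discriminate).
  assert (parity : ee (IZR (k * (d' + k * c' * d')) / 2) = 1).
  { apply ee_half_even. rewrite <- Z.negb_odd, Z.odd_mul, Z.odd_add, !Z.odd_mul.
    destruct (Gamma1_parity N a b c' d' N_odd det), (Z.odd k), (Z.odd c'), (Z.odd d'); easy. }
  rewrite (klein_mobius_slash _ a b _ _ z det z_upper). f_equal. unfold klein_slash.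
  replace (IZR k / IZR N * automorphy (N * c') (1 + N * d') z) with
    (IZR k / IZR N + IZR (k * c') * z + IZR (k * d'))
    by (unfold automorphy; Ccast; now field).
  rewrite klein_plus_IZR, klein_plus_IZR_z, !Cmult_assoc, <- !ee_plus by easy. f_equal.
  rewrite <- (Cmult_1_r (ee (IZR (c' * k * (N - k)) / _))), <- parity, <- ee_plus. f_equal.
  unfold automorphy. Ccast. Cfield.
Qed.

Lemma klein_torsion_Gamma0_sq (N k a b c' d' : Z) (z : C) : Z.odd N = true ->
  in_SL2Z a b (N * (N * c')) (1 + N * d') -> upper z ->
  klein (IZR k / IZR N) (mobius a b (N * (N * c')) (1 + N * d') z) =
  / automorphy (N * (N * c')) (1 + N * d') z * klein (IZR k / IZR N) z.
Proof.
  intros N_odd det z_upper. rewrite klein_torsion_Gamma1 by easy. f_equal.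
  replace (IZR (N * c' * k * (N - k)) / (2 * IZR N)) with (IZR (c' * k * (N - k)) / 2).
  2:{ assert (RtoC (IZR N) <> 0) by (apply IZR_C_neq_0; intros ->; discriminate). Ccast. Cfield. }
  rewrite ee_half_even; [ring|].
  rewrite <- Z.negb_odd, !Z.odd_mul, Z.odd_sub, N_odd.
  destruct (Z.odd c'), (Z.odd k); easy.
Qed.

Lemma partial_prod_ee (x : nat -> C) (n : nat) :
  partial_prod (fun k => ee (x k)) n = ee (partial_sum x n).
Proof.
  induction n as [|n IH]; cbn [partial_prod partial_sum]; [now rewrite ee_0|].
  now rewrite IH, ee_plus.
Qed.

Lemma partial_sum_mul_complement (c N : C) (m : nat) : N <> 0 ->
  partial_sum (fun k => c * INR (S k) * (N - INR (S k)) / (2 * N)) m =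
  c * INR m * (INR m + 1) * (3 * N - 2 * INR m - 1) / (12 * N).
Proof.
  intros N_neq. induction m as [|m IH]; cbn [partial_sum]; [simpl; Cfield|].
  rewrite IH. Ccast. Cfield.
Qed.

Lemma half_torsion_prod_Gamma1 (M t : nat) (N a b c' d' : Z) (z : C) :
  N = Z.of_nat (2 * M + 1) -> (M * (M + 1) = 6 * t)%nat ->
  in_SL2Z a b (N * c') (1 + N * d') -> upper z ->
  half_torsion_prod M (mobius a b (N * c') (1 + N * d') z) =
  (/ automorphy (N * c') (1 + N * d') z) ^ M * half_torsion_prod M z.
Proof.
  intros N_eq t_eq det z_upper.
  assert (N_odd : Z.odd N = true) by (rewrite N_eq; apply odd_of_nat_double_S).
  assert (N_INR : RtoC (IZR N) = INR (2 * M + 1)) by (rewrite N_eq; now rewrite <- INR_IZR_INZ).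
  pose proof (INR_C_neq_0 (2 * M + 1) ltac:(lia)) as N_neq.
  set (j := automorphy (N * c') (1 + N * d') z).
  set (x := fun k : nat =>
    IZR c' * INR (S k) * (INR (2 * M + 1) - INR (S k)) / (2 * INR (2 * M + 1))).
  assert (total : ee (partial_sum x M) = 1).
  { unfold x. rewrite partial_sum_mul_complement by easy.
    transitivity (ee (IZR (c' * Z.of_nat t))); [f_equal|apply ee_IZR].
    apply (f_equal (fun n => RtoC (INR n))) in t_eq.
    revert t_eq. Ccast. simpl. intros t_eq.
    assert (2 * INR M + 1 <> 0).
    { intros E. apply N_neq. rewrite <- E. Ccast. simpl. ring. }
    apply (Cmult_eq_reg_r _ _ 6); [auto with Cneq|].
    transitivity (IZR c' * (INR M * (INR M + (0 + 1)))); [Cfield|].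
    rewrite t_eq. ring. }
  transitivity ((/ j) ^ M * (ee (partial_sum x M) * half_torsion_prod M z)); [|rewrite total; ring].
  unfold half_torsion_prod.
  rewrite <- partial_prod_ee, <- partial_prod_const, <- !partial_prod_mult. apply partial_prod_ext.
  intros k _.
  pose proof (klein_torsion_Gamma1 N (Z.of_nat (S k)) a b c' d' z N_odd det z_upper) as torsion.
  rewrite N_INR, <- INR_IZR_INZ in torsion. rewrite torsion. fold j. do 3 f_equal.
  unfold x. rewrite !mult_IZR, minus_IZR, !RtoC_mult, RtoC_minus, N_INR, <- INR_IZR_INZ. easy.
Qed.

Lemma half_torsion_prod_Gamma0_sq (M : nat) (N a b c' d' : Z) (z : C) :
  N = Z.of_nat (2 * M + 1) ->
  in_SL2Z a b (N * (N * c')) (1 + N * d') -> upper z ->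
  half_torsion_prod M (mobius a b (N * (N * c')) (1 + N * d') z) =
  (/ automorphy (N * (N * c')) (1 + N * d') z) ^ M * half_torsion_prod M z.
Proof.
  intros N_eq det z_upper.
  assert (N_odd : Z.odd N = true) by (rewrite N_eq; apply odd_of_nat_double_S).
  unfold half_torsion_prod. rewrite <- partial_prod_const, <- partial_prod_mult.
  apply partial_prod_ext. intros k _.
  pose proof (klein_torsion_Gamma0_sq N (Z.of_nat (S k)) a b c' d' z N_odd det z_upper) as torsion.
  rewrite N_eq, <- !INR_IZR_INZ in torsion. now rewrite N_eq.
Qed.

Lemma half_torsion_prod_mobius_slash (M : nat) (a b c d : Z) (z : C) :
  in_SL2Z a b c d -> upper z -> half_torsion_prod M (mobius a b c d z) =
  (/ automorphy c d z) ^ M *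
    partial_prod (fun k => klein_slash (INR (S k) / INR (2 * M + 1)) c d z) M.
Proof.
  intros det z_upper. unfold half_torsion_prod.
  rewrite <- partial_prod_const, <- partial_prod_mult. apply partial_prod_ext.
  intros k _. now apply klein_mobius_slash.
Qed.

(** * Expansions at the cusps *)

Definition q_unit (g : C -> C) : Prop :=
  exists (h : nat) (k : Z) (H : C -> C), (0 < h)%nat /\
  (forall w, Cmod w < 1 -> H w <> 0 /\ exists l, is_Cderive H w l) /\
  forall z, upper z -> g z = ee (IZR k / INR h * z) * H (ee (z / INR h)).

Lemma upper_div_nat (z : C) (h : nat) : (0 < h)%nat -> upper z -> upper (z / INR h).
Proof.
  intros h_pos z_upper. assert (INR_pos : 0 < INR h) by now apply lt_0_INR.
  replace (z / INR h) with (RtoC (/ INR h) * z)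
    by (rewrite RtoC_inv by lra; field; apply INR_C_neq_0; lia).
  apply upper_scal; [now apply Rinv_0_lt_compat|easy].
Qed.

Lemma Cmod_pow_lt_1 (w : C) (n : nat) : (0 < n)%nat -> Cmod w < 1 -> Cmod (w ^ n) < 1.
Proof.
  intros n_pos w_lt. destruct n as [|n]; [lia|]. rewrite Cpow_S, Cmod_mult, Cmod_pow.
  pose proof (Cmod_ge_0 w). pose proof (pow_le_1 (Cmod w) n ltac:(lra)). nra.
Qed.

Lemma q_unit_ext (f g : C -> C) : (forall z, upper z -> f z = g z) -> q_unit f -> q_unit g.
Proof.
  intros E [h [k [H [h_pos [H_unit f_eq]]]]]. exists h, k, H. split; [easy|]. split; [easy|].
  intros z z_upper. rewrite <- E by easy. now apply f_eq.
Qed.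

Lemma q_unit_const (c : C) : c <> 0 -> q_unit (fun _ => c).
Proof.
  intros c_neq. exists 1%nat, 0%Z, (fun _ => c). split; [lia|]. split.
  - intros w _. split; [easy|]. exists 0. apply is_Cderive_const.
  - intros z _. replace (0%R / INR 1 * z) with (RtoC 0) by (simpl; field). rewrite ee_0. ring.
Qed.

Lemma q_unit_mult (f g : C -> C) : q_unit f -> q_unit g -> q_unit (fun z => f z * g z).
Proof.
  intros [hf [kf [Hf [hf_pos [Hf_unit f_eq]]]]] [hg [kg [Hg [hg_pos [Hg_unit g_eq]]]]].
  assert (hf_neq : RtoC (INR hf) <> 0) by (apply INR_C_neq_0; lia).
  assert (hg_neq : RtoC (INR hg) <> 0) by (apply INR_C_neq_0; lia).
  exists (hf * hg)%nat, (kf * Z.of_nat hg + kg * Z.of_nat hf)%Z,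
    (fun w => Hf (w ^ hg) * Hg (w ^ hf)).
  split; [nia|]. split.
  - intros w w_lt.
    destruct (Hf_unit (w ^ hg) (Cmod_pow_lt_1 w hg hg_pos w_lt)) as [Hf_neq [lf DHf]].
    destruct (Hg_unit (w ^ hf) (Cmod_pow_lt_1 w hf hf_pos w_lt)) as [Hg_neq [lg DHg]].
    split; [now apply Cmult_neq_0|]. eexists.
    apply (is_Cderive_mult (fun w => Hf (w ^ hg)) (fun w => Hg (w ^ hf))).
    + apply (is_Cderive_comp Hf (fun w => w ^ hg)); [|exact DHf]. auto_Cderive.
    + apply (is_Cderive_comp Hg (fun w => w ^ hf)); [|exact DHg]. auto_Cderive.
  - intros z z_upper. rewrite f_eq, g_eq, !ee_pow by easy. Ccast.
    replace (INR hg * (z / (INR hf * INR hg))) with (z / INR hf) by Cfield.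
    replace (INR hf * (z / (INR hf * INR hg))) with (z / INR hg) by Cfield.
    replace ((IZR kf * INR hg + IZR kg * INR hf) / (INR hf * INR hg) * z) with
      (IZR kf / INR hf * z + IZR kg / INR hg * z) by Cfield.
    rewrite ee_plus. ring.
Qed.

Lemma q_unit_inv (g : C -> C) : q_unit g -> q_unit (fun z => / g z).
Proof.
  intros [h [k [H [h_pos [H_unit g_eq]]]]].
  exists h, (- k)%Z, (fun w => / H w). split; [easy|]. split.
  - intros w w_lt. destruct (H_unit w w_lt) as [H_neq [l DH]].
    split; [now apply Cinv_neq_0|]. eexists. exact (is_Cderive_inv H w l H_neq DH).
  - intros z z_upper. rewrite g_eq by easy.
    destruct (H_unit _ (Cmod_ee_lt_1 _ (upper_div_nat z h h_pos z_upper))) as [H_neq _].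
    replace (IZR (- k) / INR h * z) with (- (IZR k / INR h * z)) by (Ccast; unfold Cdiv; ring).
    rewrite ee_opp. Cfield.
Qed.

Lemma q_unit_partial_prod (g : nat -> C -> C) (n : nat) :
  (forall k, (k < n)%nat -> q_unit (g k)) -> q_unit (fun z => partial_prod (fun k => g k z) n).
Proof.
  induction n as [|n IH]; intros g_unit.
  - apply (q_unit_const 1), C1_nz.
  - apply (q_unit_mult (fun z => partial_prod (fun k => g k z) n) (g n)); auto.
Qed.

Lemma q_unit_pow (g : C -> C) (n : nat) : q_unit g -> q_unit (fun z => g z ^ n).
Proof.
  intros g_unit. apply q_unit_ext with (fun z => partial_prod (fun _ => g z) n).
  - intros z _. apply partial_prod_const.
  - now apply q_unit_partial_prod with (g := fun _ => g).
Qed.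

Lemma q_unit_ee (k : Z) (h : nat) (b : C) : (0 < h)%nat ->
  q_unit (fun z => ee (IZR k / INR h * z + b)).
Proof.
  intros h_pos. exists h, k, (fun _ => ee b). split; [easy|]. split.
  - intros w _. split; [apply ee_neq_0|]. exists 0. apply is_Cderive_const.
  - intros z _. apply ee_plus.
Qed.

Lemma q_unit_holomorphic (g : C -> C) : q_unit g -> holo_on upper g.
Proof.
  intros [h [k [H [h_pos [H_unit g_eq]]]]] z z_upper.
  destruct (H_unit _ (Cmod_ee_lt_1 _ (upper_div_nat z h h_pos z_upper))) as [_ [l DH]].
  assert (DHee : is_Cderive (fun z => H (ee (z / INR h))) z
    (l * (tpi * ee (z / INR h) * (1 / INR h)))).
  { apply (is_Cderive_comp H (fun z => ee (z / INR h))); [Cderive; ring|exact DH]. }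
  eexists. apply (is_Cderive_ext_loc (fun z => ee (IZR k / INR h * z) * H (ee (z / INR h))) g z _
    (Im z) z_upper); [|auto_Cderive].
  intros y y_near. symmetry. apply g_eq. unfold upper.
  pose proof (im_le_Cmod (y - z)) as im_le. unfold Cminus in im_le, y_near.
  rewrite im_plus, im_opp in im_le. pose proof (Rle_abs (- (Im y + - Im z))) as im_ge.
  rewrite Rabs_Ropp in im_ge. lra.
Qed.

Lemma qpow_ee (r : R) (z : C) : qpow r z = ee (r * z).
Proof. unfold qpow, ee, tpi. f_equal. rewrite (RtoC_mult (2 * PI)). ring. Qed.

Lemma q_unit_mero_at_infty (g : C -> C) : q_unit g -> mero_at_infty g.
Proof.
  intros [h [k [H [h_pos [H_unit g_eq]]]]].
  assert (h_neq : RtoC (INR h) <> 0) by (apply INR_C_neq_0; lia).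
  set (m := Z.to_nat (Z.abs k)). set (n := Z.to_nat (Z.abs k + k)).
  exists h, m, (fun w => w ^ n * H w). split; [easy|]. split.
  - intros w w_lt. destruct (H_unit w w_lt) as [_ [l DH]]. eexists.
    apply (is_Cderive_mult (fun w => w ^ n) H); [auto_Cderive|exact DH].
  - intros z z_upper. rewrite g_eq, pow_n_Cpow by easy.
    replace (qpow (1 / INR h) z) with (ee (z / INR h)).
    2:{ rewrite qpow_ee, RtoC_div by (apply not_0_INR; lia). f_equal. now field. }
    rewrite !ee_pow.
    transitivity (ee (IZR k / INR h * z + INR m * (z / INR h)) * H (ee (z / INR h)));
      [rewrite ee_plus; ring|].
    do 2 f_equal. unfold m, n.
    rewrite !(INR_IZR_INZ (Z.to_nat _)), !Z2Nat.id, plus_IZR, RtoC_plus by lia.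
    now field.
Qed.

Lemma qpoch_power_unit (h e : nat) (c w : C) : (0 < h)%nat -> (0 < e)%nat -> Cmod c <= 1 ->
  Cmod w < 1 ->
  qpoch (c * w ^ e) (w ^ h) <> 0 /\ exists l, is_Cderive (fun y => qpoch (c * y ^ e) (y ^ h)) w l.
Proof.
  intros h_pos e_pos c_le w_lt. pose proof (Cmod_ge_0 w) as w_ge.
  split.
  - apply qpoch_neq_0_of_lt; [now apply Cmod_pow_lt_1|]. rewrite Cmod_mult.
    pose proof (Cmod_pow_lt_1 w e e_pos w_lt). pose proof (Cmod_ge_0 (w ^ e)). nra.
  - set (r := ((1 + Cmod w) / 2)%R). set (M := (1 + INR e + INR h)%R).
    pose proof (pos_INR e). pose proof (pos_INR h).
    assert (y_le : forall y, Cmod (y - w) < (1 - Cmod w) / 2 -> Cmod y <= r).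
    { intros y y_near. pose proof (Cmod_triangle_rev y w). unfold r. lra. }
    assert (pow_bound : forall y n, Cmod (y - w) < (1 - Cmod w) / 2 -> 0 <= Cmod (y ^ n) <= 1).
    { intros y n y_near. rewrite Cmod_pow. apply pow_le_1. split; [apply Cmod_ge_0|].
      pose proof (y_le y y_near). unfold r in *. lra. }
    assert (coeff_le : forall y n, Cmod (y - w) < (1 - Cmod w) / 2 -> Cmod c * Cmod (y ^ n) <= 1).
    { intros y n y_near. pose proof (pow_bound y n y_near). nra. }
    apply (ex_Cderive_qpoch (fun y => c * y ^ e) (fun y => y ^ h)
      (fun y => c * (INR e * y ^ (e - 1) * 1)) (fun y => INR h * y ^ (h - 1) * 1)
      w ((1 - Cmod w) / 2) M r); try (unfold r; lra); try (intros y _; solve [auto_Cderive]);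
      intros y y_near; rewrite ?Cmod_mult, ?Cmod_1, ?Cmod_R, ?Rmult_1_r, ?Rabs_pos_eq by easy.
    + pose proof (coeff_le y e y_near). unfold M. lra.
    + pose proof (coeff_le y (e - 1)%nat y_near).
      unfold M. nra.
    + destruct h as [|h]; [lia|]. rewrite Cpow_S, Cmod_mult.
      pose proof (pow_bound y h y_near). pose proof (y_le y y_near). pose proof (Cmod_ge_0 y). nra.
    + pose proof (pow_bound y (h - 1)%nat y_near). unfold M. nra.
Qed.

Lemma q_unit_qprod (i : Z) (h : nat) (b : R) : (0 < h)%nat -> (0 < Z.of_nat h + i)%Z ->
  q_unit (fun z => qprod (IZR i / INR h * z + b) z).
Proof.
  intros h_pos sum_pos. set (e := Z.to_nat (Z.of_nat h + i)).
  assert (h_neq : RtoC (INR h) <> 0) by (apply INR_C_neq_0; lia).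
  exists h, 0%Z, (fun w => qpoch (ee b * w ^ e) (w ^ h)). split; [easy|]. split.
  - intros w w_lt. apply qpoch_power_unit; [easy|unfold e; lia|rewrite Cmod_ee_RtoC; lra|easy].
  - intros z _. replace (0%R / INR h * z) with (RtoC 0) by now field.
    rewrite ee_0, Cmult_1_l, !ee_pow, <- ee_plus. unfold qprod. f_equal; f_equal.
    + unfold e. rewrite (INR_IZR_INZ (Z.to_nat _)), Z2Nat.id by lia. Ccast. now field.
    + now field.
Qed.

Lemma q_unit_qprod_0 : q_unit (fun z => qprod 0 z).
Proof.
  apply q_unit_ext with (fun z => qprod (0%R / INR 1 * z + 0%R) z).
  - intros z _. f_equal. simpl. field.
  - apply (q_unit_qprod 0 1 0); lia.
Qed.

Lemma q_unit_discriminant : q_unit discriminant.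
Proof.
  apply (q_unit_mult ee (fun z => qprod 0 z ^ 24)).
  - apply q_unit_ext with (fun z => ee (1%R / INR 1 * z + 0)).
    + intros z _. f_equal. simpl. field.
    + apply (q_unit_ee 1 1 0). lia.
  - apply q_unit_pow, q_unit_qprod_0.
Qed.

(* For [0 < i] the factor [1 - ee u] of [two_i_sin_pi u] completes
   [qprod u z] to [qprod (u - z) z], which has no zero. *)
Lemma q_unit_two_i_sin_pi_qprod (i : Z) (h : nat) (b : R) : (0 < h)%nat ->
  (0 <= i < Z.of_nat h)%Z -> (i = 0%Z -> ee b <> 1) ->
  q_unit (fun z => two_i_sin_pi (IZR i / INR h * z + b) * qprod (IZR i / INR h * z + b) z).
Proof.
  intros h_pos i_bound b_neq.
  assert (h_neq : RtoC (INR h) <> 0) by (apply INR_C_neq_0; lia).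
  destruct (Z.eq_dec i 0) as [->|i_neq].
  - apply q_unit_ext with (fun z => two_i_sin_pi b * qprod (0%R / INR h * z + b) z).
    + intros z _. do 2 f_equal. now field.
    + apply q_unit_mult; [now apply q_unit_const, two_i_sin_pi_neq_0, b_neq|].
      apply q_unit_qprod; lia.
  - apply q_unit_ext with (fun z => - (1) * (ee (IZR (- i) / INR (2 * h) * z + - (b / 2)) *
      qprod (IZR (i - Z.of_nat h) / INR h * z + b) z)).
    + intros z z_upper. set (u := IZR i / INR h * z + b).
      replace (IZR (i - Z.of_nat h) / INR h * z + b) with (u - z) by (unfold u; Ccast; now field).
      replace (IZR (- i) / INR (2 * h) * z + - (b / 2)) with (- (u / 2))
        by (unfold u; Ccast; simpl; Cfield).
      rewrite (qprod_S (u - z)), two_i_sin_pi_factor_opp by easy.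
      replace (u - z + z) with u by ring. ring.
    + apply q_unit_mult; [apply q_unit_const|apply q_unit_mult].
      * intros E. apply C1_nz. replace (RtoC 1) with (- - (1)) by ring. rewrite E. ring.
      * apply q_unit_ee. lia.
      * apply q_unit_qprod; lia.
Qed.

Lemma q_unit_klein_reduced (i : Z) (h : nat) (b : R) : (0 < h)%nat ->
  (0 <= i < Z.of_nat h)%Z -> (i = 0%Z -> ee b <> 1) ->
  q_unit (fun z => klein (IZR i / INR h * z + b) z).
Proof.
  intros h_pos i_bound b_neq.
  assert (h_neq : RtoC (INR h) <> 0) by (apply INR_C_neq_0; lia).
  assert (opp_unit : q_unit (fun z => qprod (- (IZR i / INR h * z + b)) z)).
  { apply q_unit_ext with (fun z => qprod (IZR (- i) / INR h * z + RtoC (- b)) z).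
    - intros z _. f_equal. Ccast. now field.
    - apply q_unit_qprod; lia. }
  eapply q_unit_ext; [|exact (q_unit_mult _ _
    (q_unit_mult _ _ (q_unit_two_i_sin_pi_qprod i h b h_pos i_bound b_neq) opp_unit)
    (q_unit_inv _ (q_unit_mult _ _ q_unit_qprod_0 q_unit_qprod_0)))].
  intros z _. cbv beta. unfold klein, Cdiv. ring.
Qed.

Lemma q_unit_klein (i : Z) (h : nat) (b : R) : (0 < h)%nat ->
  ((Z.of_nat h | i)%Z -> ee b <> 1) -> q_unit (fun z => klein (IZR i / INR h * z + b) z).
Proof.
  intros h_pos b_neq. set (m := (i / Z.of_nat h)%Z). set (i0 := (i mod Z.of_nat h)%Z).
  assert (h_neq : RtoC (INR h) <> 0) by (apply INR_C_neq_0; lia).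
  assert (i_eq : (i = Z.of_nat h * m + i0)%Z) by (apply Z.div_mod; lia).
  assert (i0_bound : (0 <= i0 < Z.of_nat h)%Z) by (apply Z.mod_pos_bound; lia).
  eapply q_unit_ext; [|apply q_unit_mult;
    [apply (q_unit_ee (- 2 * m * i0 - m * m * Z.of_nat h) (2 * h) (IZR m / 2 - IZR m * b)); lia
    |apply (q_unit_klein_reduced i0 h b h_pos i0_bound)]].
  - intros z z_upper. cbv beta.
    replace (IZR i / INR h * z + b) with (IZR i0 / INR h * z + b + IZR m * z)
      by (rewrite i_eq; Ccast; now field).
    rewrite klein_plus_IZR_z by easy. do 2 f_equal.
    rewrite minus_IZR, !mult_IZR. Ccast. simpl. Cfield.
  - intros i0_eq. apply b_neq. exists m. lia.
Qed.

Lemma q_unit_klein_slash (k N a b c d : Z) : in_SL2Z a b c d -> (0 < k < N)%Z ->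
  q_unit (klein_slash (IZR k / IZR N) c d).
Proof.
  intros det k_bound.
  assert (N_neq : RtoC (IZR N) <> 0) by (apply IZR_C_neq_0; lia).
  assert (IZR_N_neq : IZR N <> 0%R) by (apply not_0_IZR; lia).
  assert (N_INR : IZR N = INR (Z.to_nat N)) by (rewrite INR_IZR_INZ, Z2Nat.id by lia; easy).
  apply q_unit_mult.
  - apply q_unit_ext with (fun z => ee (IZR (c * c * k * k) / INR (2 * Z.to_nat N * Z.to_nat N) * z
      + IZR c * (IZR k / IZR N * (IZR k / IZR N)) * IZR d / 2)).
    + intros z _. f_equal. unfold automorphy. rewrite !mult_INR, <- N_INR. Ccast. simpl. Cfield.
    + apply q_unit_ee. lia.
  - apply q_unit_ext with (fun z => klein (IZR (k * c) / INR (Z.to_nat N) * z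
      + RtoC (IZR k * IZR d / IZR N)) z).
    + intros z _. f_equal. unfold automorphy. rewrite <- N_INR, RtoC_div by easy. Ccast. now field.
    + apply q_unit_klein; [lia|]. rewrite Z2Nat.id by lia. intros [q kc_eq] E.
      destruct (ee_eq_1 _ E) as [m m_eq]. apply RtoC_inj in m_eq.
      assert (kd_eq : (k * d = m * N)%Z).
      { apply eq_IZR. rewrite !mult_IZR, <- m_eq. now field. }
      assert (k_eq : (k = (a * m - b * q) * N)%Z).
      { unfold in_SL2Z in det. transitivity (k * (a * d - b * c))%Z; [rewrite det; ring|].
        transitivity (a * (k * d) - b * (k * c))%Z; [ring|]. rewrite kd_eq, kc_eq. ring. }
      destruct (Z.le_gt_cases (a * m - b * q) 0); nia.
Qed.

(** * The crank function *)

Lemma eta_qprod (z : C) : eta z = ee (z / 24) * qprod 0 z.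
Proof.
  unfold eta, qprod. rewrite qpow_ee, qpoch_inf_prod, Cplus_0_l. f_equal.
  - f_equal. rewrite RtoC_div by lra. field.
  - apply inf_prod_ext. intros n. rewrite qpow_ee, ee_pow, <- ee_plus. do 2 f_equal.
    Ccast. ring.
Qed.

Lemma eta_neq_0 (z : C) : upper z -> eta z <> 0.
Proof.
  intros z_upper. rewrite eta_qprod. apply Cmult_neq_0; [apply ee_neq_0|now apply qprod_0_neq_0].
Qed.

Lemma crank_qprod (u z : C) : crank (ee u) (ee z) = qprod 0 z / (qprod u z * qprod (- u) z).
Proof.
  unfold crank, qprod. now rewrite <- ee_opp, <- !ee_plus, Cplus_0_l.
Qed.

Lemma crank_klein (u z : C) : upper z -> ~ in_lattice z u ->
  ee (- (z / 24)) * crank (ee u) (ee z) = two_i_sin_pi u / (eta z * klein u z).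
Proof.
  intros z_upper off.
  pose proof (two_i_sin_pi_neq_0 u (off_lattice_ee z u off)) as sin_neq.
  pose proof (qprod_neq_0 u z z_upper off) as qprod_neq.
  pose proof (qprod_neq_0 (- u) z z_upper (off_lattice_opp z u off)) as qprod_opp_neq.
  rewrite crank_qprod, eta_qprod, ee_opp. unfold klein. Cfield.
Qed.

Lemma zeta_pow (N : Z) (l : nat) : N <> 0%Z -> pow_n (zeta N) l = ee (IZR (Z.of_nat l) / IZR N).
Proof.
  intros N_neq. pose proof (IZR_C_neq_0 N N_neq) as N_C_neq.
  replace (zeta N) with (ee (/ IZR N)).
  - rewrite pow_n_Cpow, ee_pow, <- INR_IZR_INZ. reflexivity.
  - unfold zeta, ee, tpi. rewrite RtoC_div by now apply not_0_IZR. f_equal. now field.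
Qed.

Definition eta_quotient (N : Z) (z : C) : C := eta (IZR (N ^ 2) * z) / eta z.

Lemma frac_off_lattice (k N : Z) (z : C) : (0 < k < N)%Z -> upper z ->
  ~ in_lattice z (IZR k / IZR N).
Proof.
  intros k_bound z_upper. assert (IZR N <> 0%R) by (apply not_0_IZR; lia).
  rewrite <- RtoC_div by easy. apply real_off_lattice; [easy|].
  intros m E. apply (ee_frac_neq_1 k N k_bound). rewrite <- RtoC_div, E by easy. apply ee_IZR.
Qed.

Lemma Fcrank_klein (N : Z) (l : nat) (z : C) : (0 < Z.of_nat l < N)%Z -> upper z ->
  Fcrank N l z = two_i_sin_pi (IZR (Z.of_nat l) / IZR N) * eta_quotient N z /
    klein (IZR (Z.of_nat l) / IZR N) z.
Proof.
  intros l_bound z_upper.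
  pose proof (frac_off_lattice _ _ z l_bound z_upper) as off.
  pose proof (eta_neq_0 z z_upper) as eta_neq.
  pose proof (klein_neq_0 _ z z_upper off) as klein_neq.
  unfold Fcrank. rewrite zeta_pow, !qpow_ee by lia.
  replace (1%R * z) with z by ring.
  replace ((-1 / 24)%R * z) with (- (z / 24)) 
    by (replace (-1 / 24)%R with (- / 24)%R by lra; rewrite RtoC_opp, RtoC_inv by lra; field).
  rewrite <- Cmult_assoc, crank_klein by easy. unfold eta_quotient. now field.
Qed.

Lemma eta_quotient_qprod (N : Z) (t : nat) (c X z : C) : (N ^ 2 = 24 * Z.of_nat t + 1)%Z ->
  upper z -> X * qprod 0 z ^ (24 * t + 1) = c * qprod 0 (IZR (N ^ 2) * z) ->
  c * eta_quotient N z = discriminant z ^ t * X.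
Proof.
  intros N_sq z_upper X_eq. pose proof (qprod_0_neq_0 z z_upper) as qprod_neq.
  unfold eta_quotient. rewrite !eta_qprod.
  transitivity (ee (IZR (N ^ 2) * z / 24 - z / 24) *
    (c * qprod 0 (IZR (N ^ 2) * z)) / qprod 0 z); [rewrite ee_minus; Cfield|].
  rewrite <- X_eq. unfold discriminant.
  rewrite Cpow_mult_l, <- Cpow_mult_r, ee_pow, Cpow_add_r, Cpow_1_r.
  replace (IZR (N ^ 2) * z / 24 - z / 24) with (INR t * z); [now field|].
  rewrite N_sq. Ccast. field.
Qed.

Lemma eta_quotient_torsion (N : Z) (t : nat) (z : C) : (N ^ 2 = 24 * Z.of_nat t + 1)%Z ->
  upper z -> half_torsion_const (12 * t) * eta_quotient N z =
    discriminant z ^ t * half_torsion_prod (12 * t) z.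
Proof.
  intros N_sq z_upper. apply eta_quotient_qprod; [easy|easy|].
  replace (24 * t + 1)%nat with (2 * (12 * t) + 1)%nat by lia.
  rewrite half_torsion_prod_qprod by easy.
  replace (IZR (N ^ 2)) with (INR (2 * (12 * t) + 1)) by (rewrite INR_IZR_INZ; f_equal; lia). easy.
Qed.

Lemma eta_quotient_iterated_torsion (N : Z) (M t : nat) (z : C) : N = Z.of_nat (2 * M + 1) ->
  (M * (M + 1) = 6 * t)%nat -> upper z ->
  half_torsion_const M ^ (2 * M + 2) * eta_quotient N z =
  discriminant z ^ t * (half_torsion_prod M (IZR N * z) * half_torsion_prod M z ^ (2 * M + 1)).
Proof.
  intros N_eq t_eq z_upper. apply eta_quotient_qprod; [nia|easy|].
  assert (N_INR : IZR N = INR (2 * M + 1)) by now rewrite N_eq, INR_IZR_INZ.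
  assert (Nz_upper : upper (IZR N * z)) by (apply upper_scal; [apply IZR_lt; lia|easy]).
  pose proof (half_torsion_prod_qprod M z z_upper) as at_z.
  pose proof (half_torsion_prod_qprod M _ Nz_upper) as at_Nz. rewrite <- N_INR in at_z, at_Nz.
  replace (24 * t + 1)%nat with ((2 * M + 1) * (2 * M + 1))%nat by lia.
  replace (2 * M + 2)%nat with (S (2 * M + 1)) by lia.
  replace (IZR (N ^ 2) * z) with (IZR N * (IZR N * z)) by (rewrite Z.pow_2_r; Ccast; ring).
  rewrite Cpow_mult_r, <- Cmult_assoc, <- Cpow_mult_l, at_z, Cpow_mult_l, Cpow_S.
  transitivity (half_torsion_const M ^ (2 * M + 1) *
    (half_torsion_prod M (IZR N * z) * qprod 0 (IZR N * z) ^ (2 * M + 1))); [ring|].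
  rewrite at_Nz. ring.
Qed.

Lemma automorphy_scale (N c d : Z) (z : C) : automorphy c d (IZR N * z) = automorphy (N * c) d z.
Proof. unfold automorphy. Ccast. ring. Qed.

Lemma mobius_scale (N a b c d : Z) (z : C) :
  mobius a (N * b) c d (IZR N * z) = IZR N * mobius a b (N * c) d z.
Proof.
  unfold mobius. fold (automorphy c d (IZR N * z)) (automorphy (N * c) d z).
  rewrite automorphy_scale. Ccast. unfold Cdiv. ring.
Qed.

Lemma eta_quotient_Gamma0_sq (N : Z) (M t : nat) (a b c' d' : Z) (z : C) :
  N = Z.of_nat (2 * M + 1) -> (M * (M + 1) = 6 * t)%nat ->
  in_SL2Z a b (N * (N * c')) (1 + N * d') -> upper z ->
  eta_quotient N (mobius a b (N * (N * c')) (1 + N * d') z) = eta_quotient N z.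
Proof.
  intros N_eq t_eq det z_upper.
  pose proof (automorphy_neq_0 _ _ _ _ z det z_upper) as j_neq.
  assert (Nz_upper : upper (IZR N * z)) by (apply upper_scal; [apply IZR_lt; lia|easy]).
  apply (Cmult_eq_reg_r _ _ (half_torsion_const M ^ (2 * M + 2)));
    [apply Cpow_nz, half_torsion_const_neq_0|].
  rewrite !(Cmult_comm _ (half_torsion_const M ^ _)).
  rewrite !(eta_quotient_iterated_torsion N M t) by auto using upper_mobius.
  rewrite <- mobius_scale, discriminant_mobius, (half_torsion_prod_Gamma1 M t),
    half_torsion_prod_Gamma0_sq, automorphy_scale by (easy || unfold in_SL2Z in *; lia).
  set (j := automorphy (N * (N * c')) (1 + N * d') z) in *.
  assert (weight : (j ^ 12) ^ t * ((/ j) ^ M * ((/ j) ^ M) ^ (2 * M + 1)) = 1).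
  { rewrite <- !Cpow_mult_r, <- Cpow_add_r, Cpow_inv by easy.
    replace (M + M * (2 * M + 1))%nat with (12 * t)%nat by lia. apply Cinv_r. now apply Cpow_nz. }
  rewrite !Cpow_mult_l. rewrite <- (Cmult_1_l (discriminant z ^ t * _)), <- weight. ring.
Qed.

Lemma Fcrank_Gamma0_sq (N : Z) (l M t : nat) (a b c' d' : Z) (z : C) :
  N = Z.of_nat (2 * M + 1) -> (M * (M + 1) = 6 * t)%nat -> (0 < Z.of_nat l < N)%Z ->
  in_SL2Z a b (N * (N * c')) (1 + N * d') -> upper z ->
  Fcrank N l (mobius a b (N * (N * c')) (1 + N * d') z) =
  automorphy (N * (N * c')) (1 + N * d') z * Fcrank N l z.
Proof.
  intros N_eq t_eq l_bound det z_upper.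
  pose proof (automorphy_neq_0 _ _ _ _ z det z_upper) as j_neq.
  pose proof (klein_neq_0 _ z z_upper (frac_off_lattice _ _ z l_bound z_upper)) as klein_neq.
  assert (N_odd : Z.odd N = true) by (rewrite N_eq; apply odd_of_nat_double_S).
  rewrite !Fcrank_klein by auto using upper_mobius.
  rewrite (eta_quotient_Gamma0_sq N M t), klein_torsion_Gamma0_sq by easy. now field.
Qed.

Lemma eta_quotient_mobius (N : Z) (t : nat) (a b c d : Z) (z : C) :
  (N ^ 2 = 24 * Z.of_nat t + 1)%Z -> in_SL2Z a b c d -> upper z ->
  eta_quotient N (mobius a b c d z) = / half_torsion_const (12 * t) * (discriminant z ^ t *
    partial_prod (fun k => klein_slash (INR (S k) / INR (2 * (12 * t) + 1)) c d z) (12 * t)).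
Proof.
  intros N_sq det z_upper.
  pose proof (automorphy_neq_0 a b c d z det z_upper) as j_neq.
  pose proof (half_torsion_const_neq_0 (12 * t)) as const_neq.
  apply (Cmult_eq_reg_r _ _ (half_torsion_const (12 * t))); [easy|].
  rewrite Cmult_comm, (eta_quotient_torsion N t), discriminant_mobius,
    half_torsion_prod_mobius_slash, Cpow_mult_l, <- Cpow_mult_r, Cpow_inv
    by auto using upper_mobius.
  Cfield.
Qed.

Lemma slash_Fcrank (N : Z) (l t : nat) (a b c d : Z) (z : C) :
  (N ^ 2 = 24 * Z.of_nat t + 1)%Z -> (0 < Z.of_nat l < N)%Z -> in_SL2Z a b c d -> upper z ->
  slash 1 (Fcrank N l) a b c d z =
  two_i_sin_pi (IZR (Z.of_nat l) / IZR N) / half_torsion_const (12 * t) * discriminant z ^ t *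
  partial_prod (fun k => klein_slash (INR (S k) / INR (2 * (12 * t) + 1)) c d z) (12 * t) *
  / klein_slash (IZR (Z.of_nat l) / IZR N) c d z.
Proof.
  intros N_sq l_bound det z_upper.
  pose proof (upper_mobius a b c d z det z_upper) as w_upper.
  pose proof (automorphy_neq_0 a b c d z det z_upper) as j_neq.
  pose proof (klein_neq_0 _ _ w_upper (frac_off_lattice _ _ _ l_bound w_upper)) as klein_neq.
  pose proof (half_torsion_const_neq_0 (12 * t)) as const_neq.
  unfold slash.
  rewrite pow_n_Cpow, Cpow_1_r, Fcrank_klein, (eta_quotient_mobius N t) by easy.
  rewrite klein_mobius_slash in klein_neq |- * by easy.
  assert (slash_neq : klein_slash (IZR (Z.of_nat l) / IZR N) c d z <> 0).
  { intros zero. apply klein_neq. rewrite zero. ring. }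
  now field.
Qed.

Lemma q_unit_slash_Fcrank (N : Z) (l t : nat) (a b c d : Z) :
  (N ^ 2 = 24 * Z.of_nat t + 1)%Z -> (0 < Z.of_nat l < N)%Z -> in_SL2Z a b c d ->
  q_unit (slash 1 (Fcrank N l) a b c d).
Proof.
  intros N_sq l_bound det.
  eapply q_unit_ext; [intros z z_upper; symmetry; now apply (slash_Fcrank N l t)|].
  apply (q_unit_mult _ (fun z => / klein_slash _ c d z));
    [|apply q_unit_inv; now apply q_unit_klein_slash with a b].
  apply (q_unit_mult _ (fun z => partial_prod _ _)).
  - apply q_unit_mult with (f := fun _ => _);
      [apply q_unit_const|apply q_unit_pow, q_unit_discriminant].
    apply Cmult_neq_0; [|apply Cinv_neq_0, half_torsion_const_neq_0].
    apply two_i_sin_pi_neq_0. now apply ee_frac_neq_1.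
  - apply q_unit_partial_prod with
      (g := fun k => klein_slash (INR (S k) / INR (2 * (12 * t) + 1)) c d).
    intros k k_lt. rewrite !INR_IZR_INZ. apply q_unit_klein_slash with a b; [easy|lia].
Qed.

Lemma slash_id (f : C -> C) (z : C) : slash 1 f 1 0 0 1 z = f z.
Proof. unfold slash. rewrite mobius_id, automorphy_id, pow_n_Cpow, Cpow_1_r. field. Qed.

Lemma prime_gt_3_odd_sq_mod_24 (p : Z) : prime p -> (3 < p)%Z ->
  exists M t : nat, p = Z.of_nat (2 * M + 1) /\ (M * (M + 1) = 6 * t)%nat.
Proof.
  intros p_prime p_gt.
  assert (not_multiple : forall n, (1 < n < p)%Z -> (p mod n <> 0)%Z).
  { intros n n_bound E. apply Z.mod_divide in E; [|lia].
    apply (prime_divisors p p_prime) in E. lia. }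
  pose proof (not_multiple 2%Z ltac:(lia)) as p_mod_2.
  pose proof (not_multiple 3%Z ltac:(lia)) as p_mod_3.
  set (m := (p / 2)%Z).
  assert (p_eq : (p = 2 * m + 1)%Z) by (unfold m; Z.to_euclidean_division_equations; lia).
  assert (even : exists i, (m * (m + 1) = 2 * i)%Z).
  { destruct (Z.Even_or_Odd m) as [[q ->]|[q ->]];
      [exists (q * (2 * q + 1))%Z|exists ((2 * q + 1) * (q + 1))%Z]; ring. }
  assert (triple : exists j, (m * (m + 1) = 3 * j)%Z).
  { assert (m_mod_3 : exists q, (m = 3 * q \/ m = 3 * q + 2)%Z)
      by (exists (m / 3)%Z; unfold m; Z.to_euclidean_division_equations; lia).
    destruct m_mod_3 as [q [-> | ->]];
      [exists (q * (3 * q + 1))%Z|exists ((3 * q + 2) * (q + 1))%Z]; ring. }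
  destruct even as [i even], triple as [j triple].
  exists (Z.to_nat m), (Z.to_nat (i - j)). split; [lia|].
  apply Nat2Z.inj. rewrite !Nat2Z.inj_mul, Nat2Z.inj_add, !Z2Nat.id by lia. lia.
Qed.

Theorem theorem2p4 (p : Z) (l : nat) :
  prime p -> (3 < p)%Z -> (1 <= l)%nat -> (Z.of_nat l <= p - 1)%Z ->
  weakly_hol_modular_form 1 (in_Gamma0p2_Gamma1p p) (Fcrank p l).
Proof.
  intros p_prime p_gt l_pos l_le.
  destruct (prime_gt_3_odd_sq_mod_24 p p_prime p_gt) as [M [t [p_eq t_eq]]].
  assert (l_bound : (0 < Z.of_nat l < p)%Z) by lia.
  assert (p_sq : (p ^ 2 = 24 * Z.of_nat t + 1)%Z) by nia.
  assert (slash_unit := fun a b c d => q_unit_slash_Fcrank p l t a b c d p_sq l_bound).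
  split; [|split].
  - apply q_unit_holomorphic, q_unit_ext with (slash 1 (Fcrank p l) 1 0 0 1).
    + intros z _. apply slash_id.
    + now apply slash_unit.
  - intros a b c d [det [[c' c_eq] [_ [d' d_eq]]]] z z_upper.
    replace c with (p * (p * c'))%Z in * by (rewrite c_eq; ring).
    replace d with (1 + p * d')%Z in * by lia.
    rewrite pow_n_Cpow, Cpow_1_r. now apply (Fcrank_Gamma0_sq p l M t).
  - intros a b c d det. now apply q_unit_mero_at_infty, slash_unit.
Qed.
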